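(* Let $n\ge1$, $k>0$. The partial Cayley transform $\Phi:\mathcal{X}^J_n\to\mathcal{D}^J_n$, $\Phi(v,u)=(W,z)$, $$W=(v-\mathrm{i}\mathbb{I}_n)(v+\mathrm{i}\mathbb{I}_n)^{-1},\qquad z=2\mathrm{i}(v+\mathrm{i}\mathbb{I}_n)^{-1}u,$$ is a Kähler homogeneous diffeomorphism, $\Phi^*\omega_n=\omega'_n$. That is, under $\Phi$ the Kähler two-form $\omega_n$ on $\mathcal{D}^J_n$, $$-\mathrm{i}\,\omega_n=\tfrac{k}{2}\mathrm{Tr}(B\wedge\bar B)+\mathrm{Tr}(A^t\bar M\wedge\bar A),\quad M=(\mathbb{I}_n-W\bar W)^{-1},\ B=M\,dW,\ A=dz+dW\,\bar\eta,\ \eta=M(z+W\bar z),$$ which is invariant under the $G^J_n$-action $$W_1=(pW+q)(\bar qW+\bar p)^{-1},\qquad z_1=(Wq^*+p^* )^{-1}(z+\alpha-W\bar\alpha),$$ becomes the Kähler two-form $\omega'_n$ on $\mathcal{X}^J_n$, $$-\mathrm{i}\,\omega'_n=\tfrac{k}{2}\mathrm{Tr}(H\wedge\bar H)+\tfrac{2}{\mathrm{i}}\mathrm{Tr}(G^tD\wedge\bar G),\quad D=(\bar v-v)^{-1},\ H=D\,dv,\ G=du-dv\,D(\bar u-u),$$ which is invariant under the $G^J_n(\mathbb{R})_0$-action $$v_1=(av+b)(cv+d)^{-1}=(vc^t+d^t)^{-1}(va^t+b^t),\qquad u_1=(vc^t+d^t)^{-1}(u+v\mathsf n+\mathsf 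m).$$
   Context: $\mathbb{I}_n$ is the identity matrix, $A^t$ the transpose, $\bar A$ the entrywise conjugate, $A^*=\bar A^t$; vectors are columns. Siegel ball: $\mathcal{D}_n=\{W\in M(n,\mathbb{C}):W=W^t,\ \mathbb{I}_n-W\bar W>0\}$. Siegel upper half plane: $\mathcal{X}_n=\{v=s+\mathrm{i}r:s,r\in M(n,\mathbb{R})\text{ symmetric},\ r>0\}$. $\mathcal{D}^J_n=\mathbb{C}^n\times\mathcal{D}_n$ with points $(z,W)$ (also written $(W,z)$); $\mathcal{X}^J_n=\mathcal{X}_n\times\mathbb{C}^n$ with points $(v,u)$. The Jacobi group $G^J_n$ acts through pairs $(g_{\mathbb{C}},\alpha)$ (its center acts trivially), where $\alpha\in\mathbb{C}^n$ and $g_{\mathbb{C}}=\begin{pmatrix}p&q\\\bar q&\bar p\end{pmatrix}\in\mathrm{Sp}(n,\mathbb{R})_{\mathbb{C}}=\mathrm{Sp}(n,\mathbb{C})\cap\mathrm{U}(n,n)$, i.e. $pp^*-qq^*=\mathbb{I}_n$, $pq^t=qp^t$, $p^*p-q^t\bar q=\mathbb{I}_n$, $p^t\bar q=q^*p$. The restricted real Jacobi group $G^J_n(\mathbb{R})_0$ consists of pairs $(g,l)$ with $g=\begin{pmatrix}a&b\\c&d\end{pmatrix}\in\mathrm{Sp}(n,\mathbb{R})$ (real $2n\times2n$ matrices with $g^tJg=J$, $J=\begin{pmatrix}0&\mathbb{I}_n\\-\mathbb{I}_n&0\end{pmatrix}$) and $l=(\mathsf n,\mathsf m)$, $\mathsf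 n,\mathsf m\in\mathbb{R}^n$. A Kähler homogeneous diffeomorphism is a diffeomorphism $\phi:M\to N$ of homogeneous Kähler manifolds with $\phi^*\omega_N=\omega_M$. *)

(* Defs.v *)
From HB Require Import structures.
From mathcomp Require Import all_boot all_order all_algebra.
From mathcomp Require Import complex.
From mathcomp Require Import boolp classical_sets reals topology normedtype derive.

Set Implicit Arguments.
Unset Strict Implicit.
Unset Printing Implicit Defensive.

Import Order.TTheory GRing.Theory Num.Theory.
Import numFieldNormedType.Exports.

Local Open Scope classical_set_scope.
Local Open Scope ring_scope.

(* Every manifold below is given by one global chart: it is a relatively open
   subset [M] of a linear subspace [T] of a real normed space [E].  The tangent
   space at each point is [T], [J] is the (constant) complex structure, and a
   two-form is a function [point -> tangent vector -> tangent vector -> value]. *)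

Section SmoothMaps.
Variable R : realType.

(* C^k maps in terms of iterated directional derivatives along [T]: at points of
   [M] these only involve the values of [f] on the relatively open set [M]. *)
Fixpoint Ck_on (E F : normedModType R) (T M : set E) (k : nat) (f : E -> F) :
    Prop :=
  {within M, continuous f} /\
  if k is j.+1 then
    forall X, T X ->
      (forall p, M p -> derivable f p X) /\ Ck_on T M j (fun p => 'D_X f p)
  else True.

Definition smooth_on (E F : normedModType R) (T M : set E) (f : E -> F) :=
  forall k, Ck_on T M k f.

Definition pullback (E F : normedModType R) (f : E -> F)
    (omega : F -> F -> F -> R[i]) : E -> E -> E -> R[i] :=
  fun p X Y => omega (f p) ('D_X f p) ('D_Y f p).

End SmoothMaps.

Section Kahler.
Variables (R : realType) (E : normedModType R).
Variables (T : set E) (J : E -> E) (M : set E) (omega : E -> E -> E -> R[i]).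

Record complex_domain : Prop := ComplexDomain {
  tangent0 : T 0;
  tangent_lin : forall a X Y, T X -> T Y -> T (a *: X + Y);
  cplxstr_lin : forall a X Y, J (a *: X + Y) = a *: J X + J Y;
  cplxstr_sq : forall X, J (J X) = - X;
  cplxstr_tangent : forall X, T X -> T (J X);
  domain_open : exists2 U, open U & M = T `&` U
}.

(* The values of [omega] are complex numbers, required to be real on [M].  The
   exterior derivative is evaluated on constant vector fields, so that there is
   no Lie bracket term.  [omega(., J .)] is the Riemannian metric. *)
Record kahler_form : Prop := KahlerForm {
  kahler_real : forall p X Y, M p -> T X -> T Y -> complex.Im (omega p X Y) = 0;
  kahler_lin : forall p a X Y Z, M p -> T X -> T Y -> T Z ->
    omega p (a *: X + Y) Z = a%:C%C * omega p X Z + omega p Y Z;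
  kahler_alt : forall p X Y, M p -> T X -> T Y -> omega p X Y = - omega p Y X;
  kahler_smooth : forall X Y, T X -> T Y ->
    smooth_on T M (fun p => complex.Re (omega p X Y) : R);
  kahler_closed : forall p X Y Z, M p -> T X -> T Y -> T Z ->
    'D_X (fun x => complex.Re (omega x Y Z) : R) p
    - 'D_Y (fun x => complex.Re (omega x X Z) : R) p
    + 'D_Z (fun x => complex.Re (omega x X Y) : R) p = 0;
  kahler_11 : forall p X Y, M p -> T X -> T Y ->
    omega p (J X) (J Y) = omega p X Y;
  kahler_pos : forall p X, M p -> T X -> X != 0 -> 0 < omega p X (J X)
}.

Record holomorphic_isometry (f : E -> E) : Prop := HolomorphicIsometry {
  isom_maps : forall p, M p -> M (f p);
  isom_smooth : smooth_on T M f;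
  isom_holo : forall p X, M p -> T X -> 'D_(J X) f p = J ('D_X f p);
  isom_pullback : forall p X Y, M p -> T X -> T Y ->
    pullback f omega p X Y = omega p X Y
}.

Record group_on (gT : Type) (G : set gT) (mul : gT -> gT -> gT) (one : gT)
    (inv : gT -> gT) : Prop := GroupOn {
  group_mul : forall g h, G g -> G h -> G (mul g h);
  group_one : G one;
  group_inv : forall g, G g -> G (inv g);
  group_assoc : forall g h x, G g -> G h -> G x ->
    mul g (mul h x) = mul (mul g h) x;
  group_mul1 : forall g, G g -> mul one g = g;
  group_mulV : forall g, G g -> mul (inv g) g = one
}.

Record homogeneous_kahler (gT : Type) (G : set gT) (mul : gT -> gT -> gT)
    (one : gT) (inv : gT -> gT) (act : gT -> E -> E) : Prop :=
  HomogeneousKahler {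
  homog_domain : complex_domain;
  homog_form : kahler_form;
  homog_group : group_on G mul one inv;
  homog_act1 : forall p, M p -> act one p = p;
  homog_actM : forall g h p, G g -> G h -> M p ->
    act (mul g h) p = act g (act h p);
  homog_isometry : forall g, G g -> holomorphic_isometry (act g);
  homog_transitive : forall p q, M p -> M q -> exists2 g, G g & act g p = q
}.

End Kahler.

(* [phi] is a diffeomorphism from [M] to [N] with [phi^* omegaN = omegaM]. *)
Definition kahler_diffeomorphism (R : realType) (E F : normedModType R)
    (TM M : set E) (omegaM : E -> E -> E -> R[i])
    (TN N : set F) (omegaN : F -> F -> F -> R[i]) (phi : E -> F) : Prop :=
  (exists psi : F -> E,
    [/\ forall p, M p -> N (phi p) /\ psi (phi p) = p,
        forall q, N q -> M (psi q) /\ phi (psi q) = q,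
        smooth_on TM M phi & smooth_on TN N psi]) /\
  (forall p X Y, M p -> TM X -> TM Y ->
    pullback phi omegaN p X Y = omegaM p X Y).

Notation "A ^cj" := (map_mx Num.conj A) (at level 2, format "A ^cj").
Notation "A ^adj" := ((map_mx Num.conj A)^T) (at level 2, format "A ^adj").

(* The pair (S, a) with S in M(n,C) and a in C^n is represented by
   ((Re S, Im S), (Re a, Im a)). *)
Notation coords R n :=
  ((('M[R]_n * 'M[R]_n) * ('cV[R]_n * 'cV[R]_n))%type).

Section Coordinates.
Variables (R : realType) (n : nat).

Definition cplxmx m1 m2 (s r : 'M[R]_(m1, m2)) : 'M[R[i]]_(m1, m2) :=
  \matrix_(i, j) (s i j +i* r i j)%C.

Definition matpart (p : coords R n) : 'M[R[i]]_n := cplxmx p.1.1 p.1.2.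
Definition vecpart (p : coords R n) : 'cV[R[i]]_n := cplxmx p.2.1 p.2.2.

Definition mkpoint (S : 'M[R[i]]_n) (a : 'cV[R[i]]_n) : coords R n :=
  ((map_mx (@complex.Re R) S, map_mx (@complex.Im R) S),
   (map_mx (@complex.Re R) a, map_mx (@complex.Im R) a)).

Definition mulI (X : coords R n) : coords R n :=
  mkpoint ('i%C *: matpart X) ('i%C *: vecpart X).

Definition sym_tangent : set (coords R n) :=
  [set X | (matpart X)^T = matpart X].

(* A positive Hermitian form; the order of [R[i]] forces the value to be real. *)
Definition posdefC (A : 'M[R[i]]_n) :=
  forall x : 'cV[R[i]]_n, x != 0 -> 0 < (x^adj *m A *m x) 0 0.

Definition posdefR (A : 'M[R]_n) :=
  forall x : 'cV[R]_n, x != 0 -> 0 < (x^T *m A *m x) 0 0.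

(* No factor 1/2 in the wedge product of one-forms. *)
Definition wedge (V : Type) m1 m2 m3 (a : V -> 'M[R[i]]_(m1, m2))
    (b : V -> 'M[R[i]]_(m2, m3)) (X Y : V) : 'M[R[i]]_(m1, m3) :=
  a X *m b Y - a Y *m b X.

End Coordinates.

Section SiegelJacobiBall.
Variables (R : realType) (n : nat).
Local Notation C := R[i].

(* The point (W, z) is the point of real coordinates [x] with
   W = [matpart x] and z = [vecpart x]. *)
Definition siegel_jacobi_ball : set (coords R n) :=
  [set x | (matpart x)^T = matpart x /\
           posdefC (1%:M - matpart x *m (matpart x)^cj)].

Definition ball_M (x : coords R n) : 'M[C]_n :=
  invmx (1%:M - matpart x *m (matpart x)^cj).

Definition ball_eta (x : coords R n) : 'cV[C]_n :=
  ball_M x *m (vecpart x + matpart x *m (vecpart x)^cj).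

(* [dW] and [dz] evaluated at the tangent vector [X] are [matpart X] and
   [vecpart X]. *)
Definition ball_B (x X : coords R n) : 'M[C]_n := ball_M x *m matpart X.

Definition ball_A (x X : coords R n) : 'cV[C]_n :=
  vecpart X + matpart X *m (ball_eta x)^cj.

(* - i omega = k/2 Tr(B /\ conj B) + Tr(A^t (conj M) /\ conj A) *)
Definition omega_ball (k : R) (x X Y : coords R n) : C :=
  'i%C * ((k / 2)%:C%C * \tr (wedge (ball_B x) (fun Z => (ball_B x Z)^cj) X Y)
          + \tr (wedge (fun Z => (ball_A x Z)^T *m (ball_M x)^cj)
                       (fun Z => (ball_A x Z)^cj) X Y)).

(* The element ((p, q), alpha) stands for the pair of the complex symplectic
   matrix g = block_mx p q (q^cj) (p^cj) and alpha in C^n; the center of the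
   Jacobi group, which acts trivially, is omitted. *)
Notation jacobiC := (('M[C]_n * 'M[C]_n) * 'cV[C]_n)%type.

Definition jacobiC_group : set jacobiC :=
  [set g | let: ((p, q), _) := g in
    [/\ p *m p^adj - q *m q^adj = 1%:M,
        p *m q^T = q *m p^T,
        p^adj *m p - q^T *m q^cj = 1%:M &
        p^T *m q^cj = q^adj *m p]].

(* (g, alpha) (g', alpha') = (g g', alpha' + g'^-1 . alpha), where
   g . alpha = p alpha + q (conj alpha) and g^-1 is given by (p^*, - q^t). *)
Definition jacobiC_mul (g h : jacobiC) : jacobiC :=
  let: ((p, q), a) := g in let: ((p', q'), a') := h in
  ((p *m p' + q *m q'^cj, p *m q' + q *m p'^cj),
   a' + p'^adj *m a - q'^T *m a^cj).

Definition jacobiC_one : jacobiC := ((1%:M, 0), 0).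

Definition jacobiC_inv (g : jacobiC) : jacobiC :=
  let: ((p, q), a) := g in ((p^adj, - q^T), - (p *m a + q *m a^cj)).

Definition act_ball (g : jacobiC) (x : coords R n) : coords R n :=
  let: ((p, q), a) := g in let W := matpart x in let z := vecpart x in
  mkpoint ((p *m W + q) *m invmx (q^cj *m W + p^cj))
          (invmx (W *m q^adj + p^adj) *m (z + a - W *m a^cj)).

End SiegelJacobiBall.

Section SiegelJacobiSpace.
Variables (R : realType) (n : nat).
Local Notation C := R[i].

(* The point (v, u) has v = s + i r with s = [y.1.1] and r = [y.1.2], and
   u = [vecpart y]. *)
Definition siegel_jacobi_space : set (coords R n) :=
  [set y | [/\ y.1.1^T = y.1.1, y.1.2^T = y.1.2 & posdefR y.1.2]].

Definition space_D (y : coords R n) : 'M[C]_n :=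
  invmx ((matpart y)^cj - matpart y).

Definition space_H (y X : coords R n) : 'M[C]_n := space_D y *m matpart X.

Definition space_G (y X : coords R n) : 'cV[C]_n :=
  vecpart X - matpart X *m space_D y *m ((vecpart y)^cj - vecpart y).

(* - i omega' = k/2 Tr(H /\ conj H) + (2/i) Tr(G^t D /\ conj G) *)
Definition omega_space (k : R) (y X Y : coords R n) : C :=
  'i%C * ((k / 2)%:C%C * \tr (wedge (space_H y) (fun Z => (space_H y Z)^cj) X Y)
          + 2 / 'i%C * \tr (wedge (fun Z => (space_G y Z)^T *m space_D y)
                                  (fun Z => (space_G y Z)^cj) X Y)).

(* The element (g, l) has g = block_mx a b c d and l = row_mx n^t m^t; the
   product is (g, l) (g', l') = (g g', l g' + l'). *)
Notation jacobiR := ('M[R]_(n + n) * 'rV[R]_(n + n))%type.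

Definition sympl_form : 'M[R]_(n + n) := block_mx 0 1%:M (- 1%:M) 0.

Definition jacobiR_group : set jacobiR :=
  [set g | g.1^T *m sympl_form *m g.1 = sympl_form].

Definition jacobiR_mul (g h : jacobiR) : jacobiR :=
  (g.1 *m h.1, g.2 *m h.1 + h.2).

Definition jacobiR_one : jacobiR := (1%:M, 0).

Definition jacobiR_inv (g : jacobiR) : jacobiR :=
  (invmx g.1, - (g.2 *m invmx g.1)).

Definition blk_a (g : jacobiR) : 'M[C]_n := map_mx (real_complex R) (ulsubmx g.1).
Definition blk_b (g : jacobiR) : 'M[C]_n := map_mx (real_complex R) (ursubmx g.1).
Definition blk_c (g : jacobiR) : 'M[C]_n := map_mx (real_complex R) (dlsubmx g.1).
Definition blk_d (g : jacobiR) : 'M[C]_n := map_mx (real_complex R) (drsubmx g.1).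
Definition vec_n (g : jacobiR) : 'cV[C]_n := map_mx (real_complex R) (lsubmx g.2)^T.
Definition vec_m (g : jacobiR) : 'cV[C]_n := map_mx (real_complex R) (rsubmx g.2)^T.

Definition act_space (g : jacobiR) (y : coords R n) : coords R n :=
  let v := matpart y in let u := vecpart y in
  mkpoint ((blk_a g *m v + blk_b g) *m invmx (blk_c g *m v + blk_d g))
          (invmx (v *m (blk_c g)^T + (blk_d g)^T)
             *m (u + v *m vec_n g + vec_m g)).

End SiegelJacobiSpace.

Definition partial_cayley (R : realType) (n : nat) (y : coords R n) :
    coords R n :=
  let v := matpart y in let u := vecpart y in
  mkpoint ((v - ('i%C)%:M) *m invmx (v + ('i%C)%:M))
          ((2 * 'i%C) *: (invmx (v + ('i%C)%:M) *m u)).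

(* [invmx] is total and returns its argument on singular matrices, so the
   invertibility of every inverted matrix is stated separately. *)
Definition ball_inverses_defined (R : realType) (n : nat) : Prop :=
  forall x : coords R n, siegel_jacobi_ball x ->
    1%:M - matpart x *m (matpart x)^cj \in unitmx /\
    forall p q a, jacobiC_group ((p, q), a) ->
      q^cj *m matpart x + p^cj \in unitmx /\
      matpart x *m q^adj + p^adj \in unitmx.

Definition space_inverses_defined (R : realType) (n : nat) : Prop :=
  forall y : coords R n, siegel_jacobi_space y ->
    [/\ matpart y + ('i%C)%:M \in unitmx,
        (matpart y)^cj - matpart y \in unitmx &
        forall g, jacobiR_group g ->
          blk_c g *m matpart y + blk_d g \in unitmx /\
          matpart y *m (blk_c g)^T + (blk_d g)^T \in unitmx].

(* Main.v *)
(* On both sides the form is [i (h X Y - h Y X)] for an explicit positive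
   Hermitian form [h].  Invariance comes from coordinates that linearize the
   fibre: on the ball [z = eta - W eta^cj], and on the upper half space
   [u = v q + w] with [q], [w] real.  The group moves these affinely, and with
   N the denominator of the action one gets [dW1 = N^-1 dW N^-T],
   [1 - W1 W1^cj = N^-1 (1 - W W^cj) N^-adj] and [A1 = N^-1 A]; likewise for
   [dv], [v^cj - v] and [G].  For the Cayley transform, with S = (v + i)^-1,
   [W = 1 - 2i S], [dW = 2i S dv S], [eta = w + i q] and [A = 2i S G], so both
   Hermitian forms agree.  Closedness follows from
   [D_X h (Y, Z) = t (X, Y, Z) + conj (t (X, Z, Y))] with [t] symmetric in its
   first two arguments.  Transitivity follows from Cholesky factorizations of
   [1 - W W^cj] and of the imaginary part of [v]. *)

Require Import Defs.
From HB Require Import structures.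
From mathcomp Require Import all_boot all_order all_algebra.
From mathcomp Require Import complex.
From mathcomp Require Import boolp classical_sets reals topology normedtype derive.
From mathcomp Require Import ring.

Import Order.TTheory GRing.Theory Num.Theory.
Import numFieldNormedType.Exports.
Local Open Scope ring_scope.

Set Implicit Arguments.
Unset Strict Implicit.
Unset Printing Implicit Defensive.

(** * Matrix identities *)

(** The linearizing coordinates settle invariance and closedness at once. Differentiating
    [z = eta - W eta^cj] gives [A = d eta - W (d eta)^cj], and differentiating [u = v q + w] gives
    [G = v dq + dw]: written in the new coordinates, [A] and [G] contain neither [dW] nor [dv]. The
    group acts on these coordinates by maps that do not depend on the base point, so [A] and [G]
    pick up only the factor [N^-1]. Conversely [d eta] and [dq] are functions of [A] and [G], so the
    derivative of each Hermitian form is again an expression in [A], [dW] or in [G], [dv]. Two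
    obstacles shape the rest. Matrices do not commute, so the block relations of the groups serve as
    oriented rewriting rules on left-associated products; this algebra is done over an arbitrary
    [numClosedFieldType]. And the forms involve conjugates, so no holomorphic calculus applies:
    complex functions are differentiated through their real and imaginary parts, and only along
    directions with symmetric matrix part, in which the domains are relatively open. *)

Ltac mxabel :=
  repeat match goal with |- context[?A *m ?B] => move: (A *m B) => ? end;
  apply/matrixP => ? ?; rewrite !mxE; ring.

Lemma invmx_mul (K : comUnitRingType) n (A B : 'M[K]_n) :
  A \in unitmx -> B \in unitmx -> invmx (A *m B) = invmx B *m invmx A.
Proof.
move=> uA uB; have uAB : A *m B \in unitmx by rewrite unitmx_mul uA.
by apply: (can_inj (mulmxK uAB)); rewrite mulVmx// -mulmxA mulKmx// mulVmx.
Qed.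

(** Products are normalized to the left, so a factor pair inside a longer product has the shape
    [X *m A *m B]. This variant lets a relation on [A *m B] be rewritten there. *)
Lemma mul_left (K : pzRingType) m n p (A : 'M[K]_(m, n)) (B : 'M_(n, p)) (D : 'M_(m, p)) :
  A *m B = D -> forall l (X : 'M_(l, m)), X *m A *m B = X *m D.
Proof. by move=> <- l X; rewrite mulmxA. Qed.

Lemma unitmx_ker (K : fieldType) n (A : 'M[K]_n) :
  (forall x : 'cV_n, A *m x = 0 -> x = 0) -> A \in unitmx.
Proof.
move=> kA; rewrite -unitmx_tr -row_free_unit; apply: inj_row_free => v vA.
by apply: trmx_inj; rewrite trmx0; apply: kA; rewrite -[A]trmxK -trmx_mul vA trmx0.
Qed.

Lemma tr_mx11 (K : Type) (Z : 'M[K]_1) : Z^T = Z.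
Proof. by apply/matrixP => i j; rewrite !mxE !ord1. Qed.

(** * Conjugation, transposition, and the action on the ball *)

Section Conjugation.
Variable C : numClosedFieldType.

Lemma conj_mul m n p (A : 'M[C]_(m, n)) (B : 'M_(n, p)) : (A *m B)^cj = A^cj *m B^cj.
Proof. exact: map_mxM. Qed.
Lemma conj_inv n (A : 'M[C]_n) : (invmx A)^cj = invmx A^cj.
Proof. exact: map_invmx. Qed.
Lemma conj_tr m n (A : 'M[C]_(m, n)) : A^T^cj = A^cj^T.
Proof. by rewrite map_trmx. Qed.
Lemma conj_add m n (A B : 'M[C]_(m, n)) : (A + B)^cj = A^cj + B^cj.
Proof. exact: map_mxD. Qed.
Lemma conj_opp m n (A : 'M[C]_(m, n)) : (- A)^cj = - A^cj.
Proof. exact: map_mxN. Qed.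
Lemma conj_scale m n c (A : 'M[C]_(m, n)) : (c *: A)^cj = Num.conj c *: A^cj.
Proof. exact: map_mxZ. Qed.
Lemma conj_scalar n c : (c%:M : 'M[C]_n)^cj = (Num.conj c)%:M.
Proof. exact: map_scalar_mx. Qed.
Lemma conj_one n : (1%:M : 'M[C]_n)^cj = 1%:M.
Proof. exact: map_mx1. Qed.
Lemma conj_K m n (A : 'M[C]_(m, n)) : A^cj^cj = A.
Proof. by apply/matrixP => i j; rewrite !mxE conjCK. Qed.
Lemma conj_unit n (A : 'M[C]_n) : (A^cj \in unitmx) = (A \in unitmx).
Proof. exact: map_unitmx. Qed.
Lemma adj_unit n (A : 'M[C]_n) : (A^adj \in unitmx) = (A \in unitmx).
Proof. by rewrite unitmx_tr conj_unit. Qed.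
Lemma conj_trace n (A : 'M[C]_n) : Num.conj (\tr A) = \tr (A^cj).
Proof. by rewrite rmorph_sum; apply: eq_bigr => i _; rewrite mxE. Qed.
Lemma tr_add m n (A B : 'M[C]_(m, n)) : (A + B)^T = A^T + B^T.
Proof. exact: linearD. Qed.
Lemma tr_opp m n (A : 'M[C]_(m, n)) : (- A)^T = - A^T.
Proof. exact: linearN. Qed.
Lemma tr_scale m n c (A : 'M[C]_(m, n)) : (c *: A)^T = c *: A^T.
Proof. exact: linearZ. Qed.
Lemma tr_inv n (A : 'M[C]_n) : (invmx A)^T = invmx A^T.
Proof. exact: trmx_inv. Qed.

Definition conjE := (conj_mul, conj_inv, conj_tr, conj_add, conj_opp, conj_scale,
  conj_one, conj_scalar, conj_K).
Definition trE := (trmx_mul, tr_inv, tr_add, tr_opp, tr_scale, @tr_scalar_mx C,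
  @trmx1 C, @trmxK C).

Section BallAlgebra.
Variable n : nat.
Implicit Types W X A : 'M[C]_n.

(** The push-through identity [(1 - W W^cj) W = W (1 - W W^cj)^cj], multiplied by the inverses on
    both sides. *)
Lemma ball_commute W A : (1%:M - W *m W^cj) *m A = 1%:M -> A *m (1%:M - W *m W^cj) = 1%:M ->
  W *m A^cj = A *m W.
Proof.
move=> rA lA; rewrite -[LHS]mul1mx -lA.
transitivity (A *m (W *m ((1%:M - W *m W^cj) *m A)^cj)).
  by rewrite !conjE !(mulmxBl, mulmxBr, mul1mx, mulmx1, mulmxA).
by rewrite rA conj_one mulmx1.
Qed.

(** The equation is only real linear in [e]. Adding [W] times its conjugate eliminates [e^cj] and
    leaves [(1 - W W^cj) e]. It is applied at points, to find eta, and to tangent vectors, to find d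
    eta. *)
Lemma ball_solve W A (z e : 'cV[C]_n) : A *m (1%:M - W *m W^cj) = 1%:M ->
  W *m A^cj = A *m W ->
  z = e - W *m e^cj <-> A *m (z + W *m z^cj) = e.
Proof.
move=> lA cA; split=> [->|<-].
  rewrite !conjE mulmxBr mulmxA addrA subrK.
  transitivity (A *m ((1%:M - W *m W^cj) *m e)); first by rewrite mulmxBl mul1mx.
  by rewrite mulmxA lA mul1mx.
rewrite !conjE !mulmxDr !mulmxA cA.
transitivity (A *m (1%:M - W *m W^cj) *m z); first by rewrite lA mul1mx.
by rewrite mulmxBr mulmx1 mulmxBl !mulmxA; mxabel.
Qed.

Variables p q : 'M[C]_n.
Hypothesis pTp : p^T *m p^cj = 1%:M + q^adj *m q.
Hypothesis pAp : p^adj *m p = 1%:M + q^T *m q^cj.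
Hypothesis pTq : p^T *m q^cj = q^adj *m p.
Hypothesis qTp : q^T *m p^cj = p^adj *m q.

Let reduce := (mul_left pTp, mul_left pAp, mul_left pTq, mul_left qTp, pTp, pAp, pTq, qTp).

Local Notation N W := (W *m q^adj + p^adj).
Local Notation K W := (W *m p^T + q^T).

Lemma ball_NT W : W^T = W -> (N W)^T = q^cj *m W + p^cj.
Proof. by move=> sW; rewrite !trE sW. Qed.

Lemma ball_KT W : W^T = W -> (K W)^T = p *m W + q.
Proof. by move=> sW; rewrite !trE sW. Qed.

(** The row [(N, K)] is [(1, W) g^adj] for the block matrix g of p and q, and the four hypotheses
    say that g preserves the Hermitian form diag(1, -1). *)
Lemma ball_NN_KK W : W^T = W -> N W *m (N W)^adj - K W *m (K W)^adj = 1%:M - W *m W^cj.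
Proof.
move=> sW; have sWc : (W^cj)^T = W^cj by rewrite -conj_tr sW.
rewrite !conjE !trE sWc !(mulmxDl, mulmxDr) !mulmxA !reduce.
by rewrite !(mulmxDl, mulmxDr) !mulmxA ?mulmx1; mxabel.
Qed.

(** The symplectic counterpart: the row [(1, W)] is isotropic because W is symmetric, and its image
    [(N, K)] stays isotropic. *)
Lemma ball_KN_sym W : W^T = W -> K W *m (N W)^T = N W *m (K W)^T.
Proof.
move=> sW; rewrite !trE sW !(mulmxDl, mulmxDr) !mulmxA !reduce.
by rewrite !(mulmxDl, mulmxDr) !mulmxA ?mulmx1 ?mul1mx; mxabel.
Qed.

Section Mobius.
Variable W : 'M[C]_n.
Hypothesis sW : W^T = W.
Hypothesis uN : N W \in unitmx.

(** Cross-multiplied, equality of the right and the left quotient is the symmetry of [K *m N^T]. The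
    left quotient is preferred from here on because its denominator N is also the one of the fibre
    action. *)
Lemma ball_mobius : (p *m W + q) *m invmx (q^cj *m W + p^cj) = invmx (N W) *m K W.
Proof.
have uT : (N W)^T \in unitmx by rewrite unitmx_tr.
rewrite -(ball_NT sW) -(ball_KT sW).
apply: (can_inj (mulKmx uN)); apply: (can_inj (mulmxK uT)).
by rewrite -[LHS]mulmxA (mulmxKV uT) (mulKVmx uN) (ball_KN_sym sW).
Qed.

Lemma ball_mobius_sym : (invmx (N W) *m K W)^T = invmx (N W) *m K W.
Proof. by rewrite trmx_mul tr_inv (ball_NT sW) (ball_KT sW) ball_mobius. Qed.

Lemma ball_mobius_defect (W1 := invmx (N W) *m K W) :
  1%:M - W1 *m W1^cj = invmx (N W) *m (1%:M - W *m W^cj) *m (invmx (N W))^adj.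
Proof.
rewrite -(ball_NN_KK sW) mulmxBr mulmxBl (mulKmx uN); congr (_ - _).
  by rewrite -trmx_mul -conj_mul (mulVmx uN) conj_one trmx1.
have -> : W1^cj = (K W)^adj *m (invmx (N W))^adj.
  by rewrite /W1 -ball_mobius_sym conj_tr conj_mul trmx_mul.
by rewrite /W1 !mulmxA.
Qed.

(** The left side is the first factor in the derivative [(p - W1 q^cj) dW (q^cj W + p^cj)^-1] of the
    Möbius map, which thereby becomes [N^-1 dW N^-T]. *)
Lemma ball_mobius_inv : p - invmx (N W) *m K W *m q^cj = invmx (N W).
Proof.
apply: (can_inj (mulKmx uN)); rewrite (mulmxV uN) mulmxBr -mulmxA (mulKVmx uN).
by rewrite !mulmxDl !reduce !mulmxA; mxabel.
Qed.

Lemma ball_mobius_invT : p^T - q^adj *m (invmx (N W) *m K W) = (invmx (N W))^T.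
Proof. by rewrite -{2}ball_mobius_inv !trE -ball_mobius_sym !trE. Qed.

(** In the coordinate eta the point W drops out of the fibre action: eta goes to
    [p (eta + a) + q (eta + a)^cj] on every fibre. After multiplication by N this is a polynomial
    identity, since [N W1 = K]. *)
Lemma ball_mobius_eta (z z1 a e : 'cV[C]_n) : z = e - W *m e^cj ->
  z1 = invmx (N W) *m (z + a - W *m a^cj) ->
  z1 = (p *m (e + a) + q *m (e + a)^cj) -
    invmx (N W) *m K W *m (p *m (e + a) + q *m (e + a)^cj)^cj.
Proof.
move=> -> ->; apply: (can_inj (mulKmx uN)).
rewrite (mulKVmx uN) mulmxBr -mulmxA (mulKVmx uN).
rewrite !conjE !(mulmxDl, mulmxDr) !mulmxA !reduce.
by rewrite !(mulmxDl, mulmxDr) !mulmxA ?mulmx1 ?mul1mx; mxabel.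
Qed.

(** Here [x] and [X] stand for dz and dW, and the left side is [dz1 + dW1 e1^cj]. The terms in X
    collapse once both eta coordinates are expressed through [e1]. *)
Lemma ball_mobius_A (x a e z1 e1 : 'cV[C]_n) X :
  e1 = p *m (e + a) + q *m (e + a)^cj -> z1 = e1 - invmx (N W) *m K W *m e1^cj ->
  invmx (N W) *m (x - X *m (a^cj + q^adj *m z1)) +
    invmx (N W) *m X *m (invmx (N W))^T *m e1^cj = invmx (N W) *m (x + X *m e^cj).
Proof.
move=> e1E ->; rewrite -ball_mobius_invT.
(* The conjugate of the inverse affine map [e = p^adj e1 - q^T e1^cj - a]. *)
have -> : e^cj = p^T *m e1^cj - q^adj *m e1 - a^cj.
  rewrite e1E !conjE !(mulmxDl, mulmxDr) !mulmxA !reduce !(mulmxDl, mulmxDr) !mul1mx.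
  by mxabel.
rewrite !(mulmxDl, mulmxDr, mulNmx, mulmxN, mulmxA).
by mxabel.
Qed.

End Mobius.
End BallAlgebra.

(** Cocycle rule: the primed matrix sends the column [(W, 1)] to [(W', 1)] times its denominator,
    and applying the unprimed one to [(W', 1)] gives numerator and denominator of the product. *)
Lemma ball_mobius_comp n (p q p' q' W W' : 'M[C]_n) :
  W' *m (q'^cj *m W + p'^cj) = p' *m W + q' ->
  (p *m p' + q *m q'^cj) *m W + (p *m q' + q *m p'^cj) =
    (p *m W' + q) *m (q'^cj *m W + p'^cj) /\
  (p *m q' + q *m p'^cj)^cj *m W + (p *m p' + q *m q'^cj)^cj =
    (q^cj *m W' + p^cj) *m (q'^cj *m W + p'^cj).
Proof.
move=> W'E; rewrite !(mulmxDl _ _ (_ + _)) -!(mulmxA _ W') W'E.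
by rewrite !conjE !(mulmxDl, mulmxDr) !mulmxA; split; mxabel.
Qed.

End Conjugation.

(** * Trace identities behind closedness *)

Section Closedness.
Variables (C : numClosedFieldType) (n : nat).
Implicit Types (W A D X Y Z : 'M[C]_n) (a b c : 'cV[C]_n).

(** [DA] is the derivative of [A = (1 - W W^cj)^-1] in the direction X. Of the four traces from the
    product rule, the two linear in X appear directly; the two containing [X^cj] form the conjugate
    after a cyclic shift. *)
Lemma ball_closed_matrix W A X Y Z (DA := A *m (X *m W^cj + W *m X^cj) *m A) :
  W *m A^cj = A *m W ->
  \tr (DA *m Y *m (A *m Z)^cj + A *m Y *m (DA *m Z)^cj) =
  \tr (A *m X *m A^cj *m W^cj *m Y *m A^cj *m Z^cj) +
  \tr (A *m Y *m A^cj *m W^cj *m X *m A^cj *m Z^cj) +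
  Num.conj (\tr (A *m X *m A^cj *m W^cj *m Z *m A^cj *m Y^cj) +
            \tr (A *m Z *m A^cj *m W^cj *m X *m A^cj *m Y^cj)).
Proof.
move=> cA; have cA' : W^cj *m A = A^cj *m W^cj.
  by have := congr1 (fun X => X^cj) cA; rewrite !conj_mul conj_K.
rewrite /DA rmorphD /= !conj_trace !conjE !(mulmxDl, mulmxDr) !mulmxA.
rewrite !(mul_left cA) !(mul_left cA') !mxtraceD !mulmxA.
have -> : \tr (A^cj *m X^cj *m A *m W *m Z^cj *m A *m Y) =
    \tr (A *m Y *m A^cj *m X^cj *m A *m W *m Z^cj).
  by rewrite -(mulmxA _ A Y) mxtrace_mulC !mulmxA.
have -> : \tr (A^cj *m Z^cj *m A *m W *m X^cj *m A *m Y) =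
    \tr (A *m W *m X^cj *m A *m Y *m A^cj *m Z^cj).
  by rewrite -!mulmxA (mulmxA A^cj) mxtrace_mulC !mulmxA.
by ring.
Qed.

(** [a], [b], [c] are the values of the one-form A on X, Y, Z. The vector [h] is the conjugate of d
    eta on X, so [Y *m h] is the derivative of A(Y). The traces are of 1 by 1 matrices, and
    transposing them matches the terms that cyclicity cannot reach. *)
Lemma ball_closed_vector W A X Y Z a b c (DA := A *m (X *m W^cj + W *m X^cj) *m A)
    (h := A^cj *m (a^cj + W^cj *m a)) :
  W^T = W -> A^cj = A^T -> X^T = X -> Y^T = Y -> Z^T = Z -> W *m A^cj = A *m W ->
  \tr (((Y *m h)^T *m A^cj + b^T *m DA^cj) *m c^cj + b^T *m A^cj *m (Z *m h)^cj) =
  \tr (a^T *m A^cj *m W^cj *m Y *m A^cj *m c^cj) +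
  \tr (b^T *m A^cj *m W^cj *m X *m A^cj *m c^cj) +
  \tr (b^T *m A^cj *m Z^cj *m A *m a) +
  Num.conj (\tr (a^T *m A^cj *m W^cj *m Z *m A^cj *m b^cj) +
            \tr (c^T *m A^cj *m W^cj *m X *m A^cj *m b^cj) +
            \tr (c^T *m A^cj *m Y^cj *m A *m a)).
Proof.
move=> sW hA sX sY sZ cA; have cA' : W^cj *m A = A^cj *m W^cj.
  by have := congr1 (fun X => X^cj) cA; rewrite !conj_mul conj_K.
have hA' : A^adj = A by rewrite hA trmxK.
have sc (U : 'M[C]_n) : U^T = U -> (U^cj)^T = U^cj by move=> sU; rewrite -conj_tr sU.
rewrite /DA /h !rmorphD /= !conj_trace !conjE !trE !hA' (sc _ sW) sY.
rewrite !(mulmxDl, mulmxDr) !mulmxA !(mul_left cA) !(mul_left cA') !mxtraceD !mulmxA.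
have t (m : nat) (U : 'M[C]_m) : \tr U = \tr U^T by rewrite mxtrace_tr.
have -> : \tr ((a^cj)^T *m A *m W *m Z^cj *m A *m b) =
    \tr (b^T *m A^cj *m Z^cj *m A *m W *m a^cj).
  by rewrite t !trE (sc _ sZ) sW -hA !mulmxA (mul_left cA) !mulmxA.
have -> : \tr ((c^cj)^T *m A *m W *m X^cj *m A *m b) =
    \tr (b^T *m A^cj *m X^cj *m A *m W *m c^cj).
  by rewrite t !trE (sc _ sX) sW -hA !mulmxA (mul_left cA) !mulmxA.
have -> : \tr ((c^cj)^T *m A *m Y *m A^cj *m a^cj) =
    \tr ((a^cj)^T *m A *m Y *m A^cj *m c^cj).
  by rewrite t !trE sY hA' -hA !mulmxA.
by ring.
Qed.

(** [DD] is the derivative of [D = (v^cj - v)^-1] in the direction X; sorting by X and [X^cj] works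
    as on the ball. *)
Lemma space_closed_matrix D X Y Z (DD := D *m (X - X^cj) *m D) : D^cj = - D ->
  \tr (DD *m Y *m (D *m Z)^cj + D *m Y *m (DD *m Z)^cj) =
  - (\tr (D *m X *m D *m Y *m D *m Z^cj) + \tr (D *m Y *m D *m X *m D *m Z^cj)) +
  Num.conj (- (\tr (D *m X *m D *m Z *m D *m Y^cj) + \tr (D *m Z *m D *m X *m D *m Y^cj))).
Proof.
move=> cD; rewrite /DD rmorphN rmorphD /= !conj_trace !conjE !cD.
rewrite !(mulmxDl, mulmxDr, mulmxN, mulNmx, opprK) !mulmxA !mxtraceD.
have t m (U : 'M[C]_m) : \tr (- U) = - \tr U by rewrite raddfN.
rewrite !t.
have -> : \tr (D *m X^cj *m D *m Z^cj *m D *m Y) = \tr (D *m Y *m D *m X^cj *m D *m Z^cj).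
  by rewrite -(mulmxA _ D Y) mxtrace_mulC !mulmxA.
have -> : \tr (D *m Z^cj *m D *m X^cj *m D *m Y) = \tr (D *m X^cj *m D *m Y *m D *m Z^cj).
  by rewrite -!mulmxA (mulmxA D) mxtrace_mulC !mulmxA.
by ring.
Qed.

(** [a], [b], [c] are the values of G on X, Y, Z, and [h] is -dq on X, so [Y *m h] is the derivative
    of G(Y). The scalar [s] stands for 2/i; being imaginary, it offsets the sign from
    [D^cj = - D]. *)
Lemma space_closed_vector D X Y Z a b c (s : C) (DD := D *m (X - X^cj) *m D)
    (h := - (D *m (a^cj - a))) :
  D^T = D -> D^cj = - D -> X^T = X -> Y^T = Y -> Z^T = Z -> Num.conj s = - s ->
  s * \tr (((Y *m h)^T *m D + b^T *m DD) *m c^cj + b^T *m D *m (Z *m h)^cj) =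
  s * (\tr (a^T *m D *m Y *m D *m c^cj) + \tr (b^T *m D *m X *m D *m c^cj) +
       \tr (b^T *m D *m Z^cj *m D *m a)) +
  Num.conj (s * (\tr (a^T *m D *m Z *m D *m b^cj) + \tr (c^T *m D *m X *m D *m b^cj) +
       \tr (c^T *m D *m Y^cj *m D *m a))).
Proof.
move=> sD cD sX sY sZ cs.
have sc (U : 'M[C]_n) : U^T = U -> (U^cj)^T = U^cj by move=> sU; rewrite -conj_tr sU.
rewrite /DD /h !(rmorphM, rmorphD) /= cs !conj_trace !conjE !trE sD sY !cD.
rewrite !(mulmxDl, mulmxDr, mulmxN, mulNmx, opprK) !mulmxA !mxtraceD.
have tN m (U : 'M[C]_m) : \tr (- U) = - \tr U by rewrite raddfN.
rewrite !tN.
have t (m : nat) (U : 'M[C]_m) : \tr U = \tr U^T by rewrite mxtrace_tr.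
have -> : \tr ((a^cj)^T *m D *m Z^cj *m D *m b) = \tr (b^T *m D *m Z^cj *m D *m a^cj).
  by rewrite t !trE (sc _ sZ) sD !mulmxA.
have -> : \tr ((c^cj)^T *m D *m X^cj *m D *m b) = \tr (b^T *m D *m X^cj *m D *m c^cj).
  by rewrite t !trE (sc _ sX) sD !mulmxA.
have -> : \tr ((c^cj)^T *m D *m Y *m D *m a^cj) = \tr ((a^cj)^T *m D *m Y *m D *m c^cj).
  by rewrite t !trE sY sD !mulmxA.
by ring.
Qed.

End Closedness.

(** * The action on the upper half space *)

Section SpaceAlgebra.
Variables (C : numClosedFieldType) (n : nat).
Variables a b c d : 'M[C]_n.
Hypothesis ra : a^cj = a.
Hypothesis rb : b^cj = b.
Hypothesis rc : c^cj = c.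
Hypothesis rd : d^cj = d.
Hypothesis aTc : a^T *m c = c^T *m a.
Hypothesis aTd : a^T *m d = 1%:M + c^T *m b.
Hypothesis dTa : d^T *m a = 1%:M + b^T *m c.
Hypothesis bTd : b^T *m d = d^T *m b.

Let reduce := (mul_left aTc, mul_left aTd, mul_left dTa, mul_left bTd, aTc, aTd, dTa, bTd).
Let real := (ra, rb, rc, rd).

Local Notation N v := (v *m c^T + d^T).
Local Notation K v := (v *m a^T + b^T).

Variable v : 'M[C]_n.
Hypothesis sv : v^T = v.

Lemma space_NT : (N v)^T = c *m v + d.
Proof. by rewrite !trE sv. Qed.

Lemma space_KT : (K v)^T = a *m v + b.
Proof. by rewrite !trE sv. Qed.

Lemma space_KN_sym : K v *m (N v)^T = N v *m (K v)^T.
Proof.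
rewrite !trE sv !(mulmxDl, mulmxDr) !mulmxA !reduce.
by rewrite !(mulmxDl, mulmxDr) !mulmxA ?mulmx1 ?mul1mx; mxabel.
Qed.

(** The row [(K, N)] is [(v, 1) g^T], and g is real and preserves the symplectic form; the value of
    the skew form on [(v, 1)] and its adjoint is the right side up to sign. *)
Lemma space_NK_defect : N v *m (K v)^adj - K v *m (N v)^adj = v^cj - v.
Proof.
have svc : (v^cj)^T = v^cj by rewrite -conj_tr sv.
rewrite !conjE !real !trE svc !(mulmxDl, mulmxDr) !mulmxA !reduce.
by rewrite !(mulmxDl, mulmxDr) !mulmxA ?mulmx1 ?mul1mx; mxabel.
Qed.

Hypothesis uN : N v \in unitmx.

Lemma space_mobius : (a *m v + b) *m invmx (c *m v + d) = invmx (N v) *m K v.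
Proof.
have uT : (N v)^T \in unitmx by rewrite unitmx_tr.
rewrite -space_NT -space_KT.
apply: (can_inj (mulKmx uN)); apply: (can_inj (mulmxK uT)).
by rewrite -[LHS]mulmxA (mulmxKV uT) (mulKVmx uN) space_KN_sym.
Qed.

Lemma space_mobius_sym : (invmx (N v) *m K v)^T = invmx (N v) *m K v.
Proof. by rewrite trmx_mul tr_inv space_NT space_KT space_mobius. Qed.

Lemma space_mobius_defect (v1 := invmx (N v) *m K v) :
  v1^cj - v1 = invmx (N v) *m (v^cj - v) *m (invmx (N v))^adj.
Proof.
rewrite -space_NK_defect mulmxBr mulmxBl (mulKmx uN).
have -> : v1^cj = (K v)^adj *m (invmx (N v))^adj.
  by rewrite /v1 -space_mobius_sym conj_tr conj_mul trmx_mul.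
congr (_ - _); rewrite /v1 -!mulmxA -trmx_mul -conj_mul (mulVmx uN) conj_one trmx1.
by rewrite mulmx1.
Qed.

Lemma space_mobius_inv : a - invmx (N v) *m K v *m c = invmx (N v).
Proof.
apply: (can_inj (mulKmx uN)); rewrite (mulmxV uN) mulmxBr -mulmxA (mulKVmx uN).
by rewrite !mulmxDl !reduce !mulmxA; mxabel.
Qed.

Lemma space_mobius_invT : a^T - c^T *m (invmx (N v) *m K v) = (invmx (N v))^T.
Proof. by rewrite -{2}space_mobius_inv !trE -space_mobius_sym !trE. Qed.

(** Expresses the old pair (q, w) through the new one, as [g^T (q1, w1) - (l, m)]. In this direction
    g need not be inverted. *)
Lemma space_mobius_q (u u1 m l w1 q1 : 'cV[C]_n) :
  u1 = invmx (N v) *m (u + v *m l + m) -> u1 = invmx (N v) *m K v *m q1 + w1 ->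
  u = v *m (a^T *m q1 + c^T *m w1 - l) + (b^T *m q1 + d^T *m w1 - m).
Proof.
move=> e1 e2.
have e3 : u + v *m l + m = K v *m q1 + N v *m w1.
  by rewrite -[LHS](mulKVmx uN) -e1 e2 mulmxDr !mulmxA (mulmxV uN) mul1mx.
have -> : u = K v *m q1 + N v *m w1 - m - v *m l by rewrite -e3 !addrK.
by rewrite !(mulmxDl, mulmxDr, mulmxN) !mulmxA; mxabel.
Qed.

(** Here [x] and [X] stand for du and dv, and the left side is [du1 - dv1 q1]. Only the coefficient
    of X has to be compared, and there the derivative factor [N^-T] is replaced by
    [a^T - c^T v1]. *)
Lemma space_mobius_G (x l u1 w1 q1 q : 'cV[C]_n) (X : 'M[C]_n) :
  u1 = invmx (N v) *m K v *m q1 + w1 -> q = a^T *m q1 + c^T *m w1 - l ->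
  invmx (N v) *m (x + X *m (l - c^T *m u1)) -
    invmx (N v) *m X *m (invmx (N v))^T *m q1 = invmx (N v) *m (x - X *m q).
Proof.
move=> -> ->; rewrite -space_mobius_invT.
rewrite !(mulmxDl, mulmxDr, mulNmx, mulmxN, opprD, opprK, mulmxA).
by mxabel.
Qed.

End SpaceAlgebra.

Section SpaceMisc.
Variables (C : numClosedFieldType) (n : nat).

(** Since q and w are real, subtracting u from its conjugate removes w and leaves [(v^cj - v) q]. So
    the real pair is determined by u. *)
Lemma space_solve (v D : 'M[C]_n) (u q w : 'cV[C]_n) : D *m (v^cj - v) = 1%:M ->
  q^cj = q -> w^cj = w -> u = v *m q + w -> D *m (u^cj - u) = q.
Proof.
move=> DQ rq rw ->; rewrite !conjE rq rw.
transitivity (D *m (v^cj - v) *m q); last by rewrite DQ mul1mx.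
by rewrite -mulmxA; congr (_ *m _); rewrite mulmxBl; mxabel.
Qed.

(** Existence of the real pair: D and [u^cj - u] both change sign under conjugation, so q is fixed;
    [(v^cj - v) q = u^cj - u] then says that [u - v q] is fixed too. *)
Lemma space_real (v D : 'M[C]_n) (u : 'cV[C]_n) (q := D *m (u^cj - u)) :
  D *m (v^cj - v) = 1%:M -> (v^cj - v) *m D = 1%:M ->
  [/\ D^cj = - D, q^cj = q & (u - v *m q)^cj = u - v *m q].
Proof.
move=> lD rD; have cD : D^cj = - D.
  have e : D^cj *m (v^cj - v) = - 1%:M.
    by rewrite -(conj_one C n) -lD !conjE -mulmxN; congr (_ *m _); rewrite opprB.
  by rewrite -[LHS]mulmx1 -rD mulmxA e mulNmx mul1mx.
have rq : q^cj = q.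
  by rewrite /q !conjE cD mulNmx -mulmxN opprB.
split=> //; rewrite conj_add conj_opp conj_mul rq.
have e : (v^cj - v) *m q = u^cj - u by rewrite /q mulmxA rD mul1mx.
have -> : v^cj = (v^cj - v) + v by rewrite subrK.
by rewrite mulmxDl e; mxabel.
Qed.

Lemma space_mobius_comp (a b c d a' b' c' d' v v' : 'M[C]_n) :
  v' *m (c' *m v + d') = a' *m v + b' ->
  (a *m a' + b *m c') *m v + (a *m b' + b *m d') = (a *m v' + b) *m (c' *m v + d') /\
  (c *m a' + d *m c') *m v + (c *m b' + d *m d') = (c *m v' + d) *m (c' *m v + d').
Proof.
move=> v'E; rewrite !(mulmxDl _ _ (_ + _)) -!(mulmxA _ v') v'E.
by rewrite !(mulmxDl, mulmxDr) !mulmxA; split; mxabel.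
Qed.

Lemma space_comp_vec (a c b d v v' : 'M[C]_n) (u l m l' m' : 'cV[C]_n) :
  v *m c^T + d^T \in unitmx -> (v *m c^T + d^T) *m v' = v *m a^T + b^T ->
  u + v *m (a^T *m l + c^T *m m + l') + (b^T *m l + d^T *m m + m') =
  (v *m c^T + d^T) *m (invmx (v *m c^T + d^T) *m (u + v *m l' + m') + v' *m l + m).
Proof.
move=> uN v'E; rewrite !(mulmxDr (v *m c^T + d^T)) (mulKVmx uN) (mulmxA _ v') v'E.
by rewrite !(mulmxDl, mulmxDr) !mulmxA; mxabel.
Qed.

Lemma ball_comp_vec (W p q W' : 'M[C]_n) (z a a' : 'cV[C]_n) :
  W *m q^adj + p^adj \in unitmx -> (W *m q^adj + p^adj) *m W' = W *m p^T + q^T ->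
  z + (a' + p^adj *m a - q^T *m a^cj) - W *m (a' + p^adj *m a - q^T *m a^cj)^cj =
  (W *m q^adj + p^adj) *m (invmx (W *m q^adj + p^adj) *m (z + a' - W *m a'^cj) + a - W' *m a^cj).
Proof.
move=> uN W'E; rewrite mulmxBr !(mulmxDr (_ + _)) (mulKVmx uN) (mulmxA _ W') W'E.
by rewrite !conjE !(mulmxDl, mulmxDr, mulmxN) !mulmxA; mxabel.
Qed.

End SpaceMisc.

(** * The Cayley transform with an abstract imaginary unit *)

Section CayleyAlgebra.
Variables (C : numClosedFieldType) (n : nat) (ii : C).
Hypothesis ii2 : ii * ii = -1.
Hypothesis cii : Num.conj ii = - ii.
Implicit Types v S W T X : 'M[C]_n.

Lemma cayley_W v : v + ii%:M \in unitmx ->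
  (v - ii%:M) *m invmx (v + ii%:M) = 1%:M - (2 * ii) *: invmx (v + ii%:M).
Proof.
move=> u; apply: (can_inj (mulmxK u)); rewrite (mulmxKV u) mulmxBl mul1mx -scalemxAl (mulVmx u).
by rewrite -(scalemx1 n ii); apply/matrixP => i j; rewrite !mxE; ring.
Qed.

Lemma cayley_defect v (S := invmx (v + ii%:M)) : v + ii%:M \in unitmx -> v^T = v ->
  1%:M - (1%:M - (2 * ii) *: S) *m (1%:M - (2 * ii) *: S)^cj =
  S *m ((2 * ii) *: (v^cj - v)) *m S^adj.
Proof.
move=> u sv; have cS : (v + ii%:M)^cj = v^cj - ii%:M by rewrite conj_add conj_scalar cii raddfN.
have uc : v^cj - ii%:M \in unitmx by rewrite -cS conj_unit.
have Sc : S^cj = invmx (v^cj - ii%:M) by rewrite /S conj_inv cS.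
have sS : S^T = S by rewrite /S tr_inv tr_add tr_scalar_mx sv.
rewrite -conj_tr sS conj_add conj_one conj_opp conj_scale Sc.
have S1 : S *m (v + ii%:M) = 1%:M by rewrite /S mulVmx.
have S2 : (v^cj - ii%:M) *m invmx (v^cj - ii%:M) = 1%:M by rewrite mulmxV.
(* Only the one-sided relations [S (v + ii) = 1] and [(v^cj - ii) S' = 1] are needed now, so the two
   inverses become independent variables. *)
move: {Sc sS cS uc} S S1 (invmx _) S2 => S S1 S' S2.
have e1 : S *m v = 1%:M - ii *: S by rewrite -S1 mulmxDr mul_mx_scalar addrK.
have e2 : v^cj *m S' = 1%:M + ii *: S' by rewrite -S2 mulmxBl mul_scalar_mx subrK.
rewrite -[in RHS]scalemxAr -[in RHS]scalemxAl [in RHS]mulmxBr [in RHS]mulmxBl e1.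
rewrite -(mulmxA S) e2.
rewrite rmorphM /= cii (rmorph_nat Num.conj 2).
rewrite !(mulmxDl, mulmxDr, mulNmx, mulmxN, mul1mx, mulmx1) -!scalemxAl -!scalemxAr.
move: (S *m S') => Z; apply/matrixP => i j; rewrite !mxE.
by ring: ii2.
Qed.

Lemma conj_2ii : Num.conj (2 * ii) = - (2 * ii).
Proof. by rewrite rmorphM /= cii (rmorph_nat Num.conj 2) mulrN. Qed.

Lemma cayley_eta (v S : 'M[C]_n) (u q w : 'cV[C]_n) : S *m (v + ii%:M) = 1%:M ->
  q^cj = q -> w^cj = w -> u = v *m q + w ->
  (2 * ii) *: (S *m u) = (w + ii *: q) - (1%:M - (2 * ii) *: S) *m (w + ii *: q)^cj.
Proof.
move=> S1 rq rw ->; rewrite conj_add conj_scale rq rw cii.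
have e1 : S *m v = 1%:M - ii *: S by rewrite -S1 mulmxDr mul_mx_scalar addrK.
rewrite !(mulmxDl, mulmxDr, mulNmx, mulmxN, mul1mx, mulmx1) mulmxA e1.
rewrite !(mulmxDl, mulNmx, mul1mx) -!scalemxAl -!scalemxAr.
move: (S *m q) (S *m w) => Z1 Z2; apply/matrixP => i j; rewrite !mxE.
by ring: ii2.
Qed.

(** The first summand is dz and the second [dW eta^cj] with [eta = w + ii q]. From [S v = 1 - ii S],
    the w-terms and the terms with two factors S cancel. *)
Lemma cayley_A (v S X : 'M[C]_n) (u x q w : 'cV[C]_n) : S *m (v + ii%:M) = 1%:M ->
  q^cj = q -> w^cj = w -> u = v *m q + w ->
  (2 * ii) *: (S *m x - S *m X *m S *m u) +
    (2 * ii) *: (S *m X *m S) *m (w + ii *: q)^cj = (2 * ii) *: (S *m (x - X *m q)).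
Proof.
move=> S1 rq rw ->; rewrite conj_add conj_scale rq rw cii.
have e1 : S *m X *m S *m v = S *m X - ii *: (S *m X *m S).
  rewrite -(mulmxA _ S).
  have -> : S *m v = 1%:M - ii *: S by rewrite -S1 mulmxDr mul_mx_scalar addrK.
  by rewrite mulmxBr mulmx1 -scalemxAr.
rewrite -scalemxAl -scalerDr; congr (_ *: _).
rewrite !(mulmxDr, mulmxN) mulmxA e1 !mulmxA !(mulmxDl, mulNmx) -!scalemxAl -!scalemxAr.
by mxabel.
Qed.

(* The ball matrix [invmx (1 - W W^cj)] at the Cayley transform of [v]. *)
Lemma cayley_M (S D : 'M[C]_n) : S \in unitmx -> D \in unitmx ->
  invmx (S *m ((2 * ii) *: D) *m S^adj) =
  (- ii / 2) *: (invmx S^adj *m invmx D *m invmx S).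
Proof.
move=> uS uD; have ii0 : ii != 0.
  by apply: contra_eqN ii2 => /eqP ->; rewrite mul0r eq_sym oppr_eq0 oner_eq0.
have uc : 2 * ii \is a GRing.unit by rewrite unitfE mulf_neq0 ?pnatr_eq0.
have uSa : S^adj \in unitmx by rewrite adj_unit.
have uDc : (2 * ii) *: D \in unitmx by rewrite unitmxZ.
rewrite invmx_mul ?unitmx_mul ?uS // invmx_mul // invmxZ // -scalemxAl -scalemxAr mulmxA.
congr (_ *: _); apply: (mulfI (_ : 2 * ii != 0)); first by rewrite mulf_neq0 ?pnatr_eq0.
rewrite divff ?mulf_neq0 ?pnatr_eq0 //.
transitivity (- (ii * ii)); first by rewrite ii2 opprK.
by field.
Qed.

(** The scalars give [(- ii / 2) (2 ii) = 1], so B becomes [(S^cj)^-1 (D X) S]. In the product with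
    a conjugate the inner S cancels, and the outer [S^cj] cancels under the trace. *)
Lemma cayley_matrix_form (S D X Y : 'M[C]_n) : S \in unitmx -> S^T = S ->
  let M := (- ii / 2) *: (invmx S^adj *m D *m invmx S) in
  \tr (M *m ((2 * ii) *: (S *m X *m S)) *m (M *m ((2 * ii) *: (S *m Y *m S)))^cj) =
  \tr (D *m X *m (D *m Y)^cj).
Proof.
move=> uS sS M.
have uc : S^cj \in unitmx by rewrite conj_unit.
have k1 : (- ii / 2) * (2 * ii) = 1.
  by transitivity (- (ii * ii)); [field | rewrite ii2 opprK].
have e Z : M *m ((2 * ii) *: (S *m Z *m S)) = invmx S^cj *m (D *m Z) *m S.
  rewrite /M -scalemxAl -scalemxAr scalerA k1 scale1r -conj_tr sS !mulmxA.
  by rewrite (mulmxKV uS).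
rewrite !e !conj_mul conj_inv conj_K -!mulmxA mxtrace_mulC -!mulmxA.
by rewrite (mulmxV uc) mulmx1 (mulmxA S) (mulmxV uS) mul1mx.
Qed.

(** Source of the factor 2/i in the form on the upper half space: [2 ii], its conjugate [- 2 ii],
    and [- ii / 2] from [M^cj] (where [D^cj = - D] supplies a sign) multiply to
    [- 2 ii = 2 / ii]. *)
Lemma cayley_vector_form (S D : 'M[C]_n) (g h : 'cV[C]_n) : S \in unitmx -> S^T = S -> D^cj = - D ->
  let M := (- ii / 2) *: (invmx S^adj *m D *m invmx S) in
  \tr (((2 * ii) *: (S *m g))^T *m M^cj *m ((2 * ii) *: (S *m h))^cj) =
  2 / ii * \tr (g^T *m D *m h^cj).
Proof.
move=> uS sS cD M.
have uc : S^cj \in unitmx by rewrite conj_unit.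
have ii0 : ii != 0.
  by apply: contra_eqN ii2 => /eqP ->; rewrite mul0r eq_sym oppr_eq0 oner_eq0.
have iV : ii^-1 = - ii.
  by apply: (mulfI ii0); rewrite divff // mulrN ii2 opprK.
have cM : M^cj = (- (ii / 2)) *: (invmx S *m D *m invmx S^cj).
  rewrite /M conj_scale !conj_mul !conj_inv conj_tr conj_K sS cD mulmxN mulNmx scalerN -scaleNr.
  by rewrite rmorphM fmorphV rmorphN /= cii opprK (rmorph_nat Num.conj 2).
rewrite cM !conj_scale tr_scale trmx_mul sS conj_mul conj_2ii.
rewrite -!scalemxAl -!scalemxAr -!scalemxAl !scalerA !mulmxA (mulmxK uS) (mulmxKV uc).
rewrite mxtraceZ; congr (_ * _); rewrite iV.
transitivity (2 * (ii * ii) * ii); last by rewrite ii2; ring.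
by field.
Qed.

(** With [T = (1 - W)^-1], the matrix [2 ii T - ii] is the inverse Cayley transform of W. The
    product on the right expands by [T W = T - 1] and [W^cj T^cj = T^cj - 1]. *)
Lemma cayley_inv_defect W T : T *m (1%:M - W) = 1%:M -> (1%:M - W^cj) *m T^cj = 1%:M ->
  ((2 * ii) *: T - ii%:M)^cj - ((2 * ii) *: T - ii%:M) =
  (- (2 * ii)) *: (T *m (1%:M - W *m W^cj) *m T^cj).
Proof.
move=> TW WT; rewrite mulmxBr mulmx1 mulmxBl mulmxA -(mulmxA (T *m W)).
have -> : T *m W = T - 1%:M by rewrite -TW mulmxBr mulmx1 opprB addrC subrK.
have -> : W^cj *m T^cj = T^cj - 1%:M by rewrite -WT mulmxBl mul1mx opprB addrC subrK.
rewrite !(mulmxDl, mulmxDr, mulmxN, mulNmx, mul1mx, mulmx1).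
rewrite conj_add conj_opp conj_scale conj_scalar conj_2ii cii -(scalemx1 n ii) -(scalemx1 n (- ii)).
by move: (T *m T^cj) => Z; apply/matrixP => i j; rewrite !mxE; ring.
Qed.

End CayleyAlgebra.

(** * Cholesky factorization and positivity *)

Section Cholesky.
Variables (K : numFieldType) (cj : {rmorphism K -> K}).
Hypothesis cjK : involutive cj.
Hypothesis cj_sqrt : forall a : K, 0 < a -> exists2 b, b * cj b = a & b != 0.
Local Notation "A ^h" := ((map_mx cj A)^T) (at level 2, format "A ^h").

Lemma hermK m n (A : 'M[K]_(m, n)) : A^h^h = A.
Proof. by apply/matrixP => i j; rewrite !mxE cjK. Qed.

Lemma hermM m n p (A : 'M[K]_(m, n)) (B : 'M_(n, p)) : (A *m B)^h = B^h *m A^h.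
Proof. by rewrite map_mxM trmx_mul. Qed.

(** The involution is left abstract because both complex conjugation (for [1 - W W^cj]) and the
    identity of a real closed field (for the imaginary part of v) are needed. Induction on the size,
    by splitting off the first row and column. *)
Lemma cholesky n (A : 'M[K]_n) : A^h = A ->
  (forall x : 'cV_n, x != 0 -> 0 < (x^h *m A *m x) 0 0) ->
  exists2 L : 'M[K]_n, L \in unitmx & A = L *m L^h.
Proof.
elim: n A => [|n IH] A hA pA; first by exists A; rewrite ?flatmx0 // unitmxE det_mx00 unitr1.
pose A' := A : 'M_(1 + n); have hA' : A'^h = A' := hA.
have pA' : forall x : 'cV_(1 + n), x != 0 -> 0 < (x^h *m A' *m x) 0 0 := pA.
suff: exists2 L : 'M[K]_(1 + n), L \in unitmx & A' = L *m L^h by [].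
set a := A 0 0; pose u := dlsubmx A'; pose B := drsubmx A'.
have eA : A' = block_mx (a%:M) u^h u B.
  rewrite -[LHS]submxK -/u -/B; congr (block_mx _ _ _ _).
    by rewrite [LHS]mx11_scalar !mxE /a; congr (A' _ _)%:M; apply/val_inj.
  by apply/matrixP => i j; rewrite !mxE -[in LHS]hA' !mxE.
have hB : B^h = B by apply/matrixP => i j; rewrite !mxE -[in RHS]hA' !mxE.
have a0 : 0 < a.
  have := pA (delta_mx 0 0).
  have -> : delta_mx 0 0 != 0 :> 'cV[K]_n.+1.
    by apply/eqP => /matrixP/(_ 0 0); rewrite !mxE eqxx => /eqP; rewrite oner_eq0.
  move=> /(_ isT); congr (_ < _).
  rewrite -[_ *m A *m _]mulmxA mxE (bigD1 0) //= big1 ?addr0 => [|i i0].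
    rewrite !mxE eqxx rmorph1 mul1r (bigD1 0) //= big1 ?addr0 => [|i i0].
      by rewrite !mxE eqxx mulr1.
    by rewrite !mxE (negPf i0) mulr0.
  by rewrite !mxE (negPf i0) rmorph0 mul0r.
have ca : cj a = a by have := congr1 (fun X : 'M_n.+1 => X 0 0) hA; rewrite !mxE.
have [b bb b0] := cj_sqrt a0.
(* The Schur complement of the corner entry [a]. *)
pose S := B - a^-1 *: (u *m u^h).
have hS : S^h = S.
  rewrite /S map_mxB map_mxZ linearB linearZ /= hB hermM hermK.
  by rewrite fmorphV ca.
have pS (y : 'cV_n) : y != 0 -> 0 < (y^h *m S *m y) 0 0.
  (* This choice of the first coordinate cancels the cross terms, so the form of A at [(t, y)]
     equals the form of S at [y]. *)
  move=> y0; pose t : 'M[K]_1 := - (a^-1 *: (u^h *m y)).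
  have := pA' (col_mx t y).
  have -> : col_mx t y != 0.
    apply: contraNneq y0 => ty0; apply/eqP; rewrite -(col_mxKd t y).
    by rewrite ty0 linear0.
  move=> /(_ isT); congr (_ < _ 0 0).
  rewrite eA map_col_mx tr_col_mx mul_row_block mul_row_col /S.
  have -> : t^h = - (a^-1 *: (y^h *m u)).
    by rewrite /t map_mxN map_mxZ linearN linearZ /= hermM hermK fmorphV ca.
  rewrite /t !mul_mx_scalar !(mulmxDl, mulmxBr, mulNmx, mulmxN, scalerN, opprK).
  rewrite -!scalemxAl -!scalemxAr -!scalemxAl !scalerA !mulmxA.
  rewrite divff ?gt_eqF// mul1r.
  by move: (_ *: _) => Y; rewrite subrr add0r addrC.
have [L uL eS] := IH S hS pS.
have cb0 : cj b != 0 by rewrite fmorph_eq0.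
exists (block_mx (b%:M) 0 ((cj b)^-1 *: u) L : 'M_(1 + n)).
  by rewrite unitmxE det_lblock det_scalar1 unitrM unitfE b0 /= -unitmxE.
rewrite eA map_block_mx tr_block_mx mulmx_block.
rewrite map_scalar_mx tr_scalar_mx map_mx0 trmx0 map_mxZ linearZ /= fmorphV cjK.
rewrite !mul0mx !mulmx0 !addr0 -scalar_mxM bb mul_scalar_mx scalerA divff // scale1r.
rewrite mul_mx_scalar scalerA divff // scale1r -scalemxAl -scalemxAr scalerA -eS.
have -> : (cj b)^-1 / b = a^-1 by rewrite -bb invfM mulrC.
by rewrite /S addrC subrK.
Qed.

End Cholesky.

(** * Positive definite Hermitian matrices *)

Section Positive.
Variable C : numClosedFieldType.

(** The condition [posdefC] over an arbitrary closed field; at [R[i]] the two are convertible. *)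
Definition posdef n (A : 'M[C]_n) :=
  forall x : 'cV[C]_n, x != 0 -> 0 < (x^adj *m A *m x) 0 0.

Lemma posdef_unit n (A : 'M[C]_n) : posdef A -> A \in unitmx.
Proof.
move=> pA; apply: unitmx_ker => x Ax; apply/eqP/negPn/negP => /pA.
by rewrite -mulmxA Ax mulmx0 mxE ltxx.
Qed.

Lemma posdef_congr n (A P : 'M[C]_n) : P \in unitmx -> posdef A ->
  posdef (P^adj *m A *m P).
Proof.
move=> uP pA x x0; have := pA (P *m x).
rewrite conj_mul trmx_mul !mulmxA; apply.
by apply: contraNneq x0 => Px; rewrite -(mulKmx uP x) Px mulmx0.
Qed.

Lemma posdef_cholesky n (A : 'M[C]_n) : A^adj = A -> posdef A ->
  exists2 L, L \in unitmx & A = L *m L^adj.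
Proof.
move=> hA pA; apply: (@cholesky C Num.conj) => //; first exact: conjCK.
move=> a a0; exists (sqrtC a); last by rewrite sqrtC_eq0 gt_eqF.
by rewrite -[LHS]normCK ger0_norm ?sqrtC_ge0 ?ltW// sqrtCK.
Qed.

Lemma adj_mul_diag m n (S : 'M[C]_(m, n)) : \tr (S *m S^adj) = \sum_i \sum_j `|S i j| ^+ 2.
Proof.
apply: eq_bigr => i _; rewrite mxE; apply: eq_bigr => j _.
by rewrite !mxE normCK.
Qed.

Lemma trace_adj_ge0 m n (S : 'M[C]_(m, n)) : 0 <= \tr (S *m S^adj).
Proof. by rewrite adj_mul_diag; do 2!(apply: sumr_ge0 => ? _); rewrite exprn_ge0. Qed.

Lemma trace_adj_gt0 m n (S : 'M[C]_(m, n)) : S != 0 -> 0 < \tr (S *m S^adj).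
Proof.
move=> S0; rewrite lt_def trace_adj_ge0 andbT; apply: contraNneq S0.
rewrite adj_mul_diag => /eqP; rewrite psumr_eq0 => [/allP S0|i _]; last first.
  by apply: sumr_ge0 => j _; rewrite exprn_ge0.
apply/eqP/matrixP => i j; have /eqP := S0 i (mem_index_enum i); rewrite mxE.
move=> /eqP; rewrite psumr_eq0 => [/allP/(_ j (mem_index_enum j))|k _]; last by rewrite exprn_ge0.
by rewrite sqrf_eq0 normr_eq0 => /eqP.
Qed.

(* With P = L L^adj and S = L^adj Y L^cj, the trace is Tr(S S^adj). *)
Lemma trace_posdef_gt0 n (P Y : 'M[C]_n) : P^adj = P -> posdef P -> Y^T = Y -> Y != 0 ->
  0 < \tr (P *m Y *m P^cj *m Y^cj).
Proof.
move=> hP pP sY Y0; have [L uL eP] := posdef_cholesky hP pP.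
have uLc : L^cj \in unitmx by rewrite conj_unit.
have uLa : L^adj \in unitmx by rewrite unitmx_tr.
have -> : \tr (P *m Y *m P^cj *m Y^cj) =
    \tr ((L^adj *m Y *m L^cj) *m (L^adj *m Y *m L^cj)^adj).
  by rewrite eP !conjE !trE -(conj_tr Y) sY -!mulmxA mxtrace_mulC -!mulmxA.
apply: trace_adj_gt0; apply: contraNneq Y0 => LYL.
have <- : invmx L^adj *m (L^adj *m Y *m L^cj) *m invmx L^cj = Y.
  by rewrite !mulmxA mulVmx// mul1mx mulmxK.
by rewrite LYL mulmx0 mul0mx.
Qed.

Lemma posdef_inv n (A : 'M[C]_n) : A^adj = A -> posdef A -> posdef (invmx A).
Proof.
move=> hA pA; have uA := posdef_unit pA.
have -> : invmx A = (invmx A)^adj *m A *m invmx A.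
  by rewrite !conjE !trE hA mulVmx// mul1mx.
by apply: posdef_congr => //; rewrite unitmx_inv.
Qed.


Lemma posdef_scale n (A : 'M[C]_n) (k : C) : 0 < k -> posdef A -> posdef (k *: A).
Proof. by move=> k0 pA x /pA Ax; rewrite -scalemxAr -scalemxAl mxE mulr_gt0. Qed.

Lemma posdef_add n (A B : 'M[C]_n) : posdef A -> posdef B -> posdef (A + B).
Proof. by move=> pA pB x x0; rewrite mulmxDr mulmxDl mxE addr_gt0 ?pA ?pB. Qed.

Lemma posdef_one n : posdef (1%:M : 'M[C]_n).
Proof.
move=> x x0; rewrite mulmx1; have := @trace_adj_gt0 _ _ x^T.
by rewrite trmx_eq0 conj_tr trmxK -trace_mx11 -[in X in _ -> X]mxtrace_tr trmx_mul trmxK; apply.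
Qed.

(** Transposition turns the shape [x^T A^cj x^cj], in which the vector term of the forms occurs,
    into [x^adj A x]. *)
Lemma posdef_conj_tr n (A : 'M[C]_n) : A^adj = A -> posdef A -> forall x : 'cV[C]_n, x != 0 ->
  0 < \tr (x^T *m A^cj *m x^cj).
Proof.
move=> hA pA x x0; rewrite -mxtrace_tr trace_mx11 !trmx_mul trmxK hA mulmxA.
exact: pA.
Qed.

(** The cross terms carry opposite coefficients [ii] and [- ii] and are equal by symmetry of r. *)
Lemma quad_real n (r : 'M[C]_n) (a b : 'cV[C]_n) (ii : C) : ii * ii = -1 -> Num.conj ii = - ii ->
  a^cj = a -> b^cj = b -> r^T = r ->
  (a + ii *: b)^adj *m r *m (a + ii *: b) = a^T *m r *m a + b^T *m r *m b.
Proof.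
move=> ii2 cii ra rb sr; rewrite conj_add conj_scale ra rb cii tr_add tr_scale.
have e : a^T *m r *m b = b^T *m r *m a.
  by rewrite -[LHS]tr_mx11 !trmx_mul trmxK sr mulmxA.
rewrite !(mulmxDl, mulmxDr) -!scalemxAr -!scalemxAl !scalerA e mulrN ii2.
by mxabel.
Qed.

Section Units.
Variable n : nat.
Implicit Types W v : 'M[C]_n.

(** If [N^adj x = 0], the form of [1 - W W^cj] at x is minus the squared norm of [K^adj x], hence
    not positive. *)
Lemma ball_N_unit (W N K : 'M[C]_n) : posdef (1%:M - W *m W^cj) ->
  N *m N^adj - K *m K^adj = 1%:M - W *m W^cj -> N \in unitmx.
Proof.
move=> pW NK; rewrite -adj_unit.
apply: unitmx_ker => x Nx; apply/eqP/negPn/negP => x0.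
have e1 : x^adj *m (N *m N^adj) *m x = 0 by rewrite -(mulmxA _ _ x) -(mulmxA N) Nx !mulmx0.
have := pW x x0; rewrite -NK mulmxBr mulmxBl e1 sub0r mxE oppr_gt0 => /lt_geF.
suff -> : 0 <= (x^adj *m (K *m K^adj) *m x) 0 0 by [].
have -> : (x^adj *m (K *m K^adj) *m x) 0 0 = \tr ((x^adj *m K) *m (x^adj *m K)^adj).
  by rewrite trace_mx11 [in RHS]conj_mul trmx_mul conj_tr conj_K trmxK !mulmxA.
exact: trace_adj_ge0.
Qed.

Variable ii : C.

(** If [N^adj x = 0], then also [x^adj N = 0], and both terms of the defect vanish at x. *)
Lemma space_N_unit (v N K : 'M[C]_n) : posdef (ii *: (v^cj - v)) ->
  N *m K^adj - K *m N^adj = v^cj - v -> N \in unitmx.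
Proof.
move=> pv NK; rewrite -adj_unit.
apply: unitmx_ker => x Nx; apply/eqP/negPn/negP => x0.
have xN : x^adj *m N = 0.
  have := congr1 (fun A : 'cV_n => A^adj) Nx.
  by rewrite conj_mul trmx_mul conj_tr conj_K trmxK map_mx0 trmx0.
have := pv x x0; rewrite -NK -scalemxAr -scalemxAl mulmxBr mulmxBl mulmxA xN !mul0mx.
by rewrite -(mulmxA _ _ x) -(mulmxA K) Nx !mulmx0 subr0 scaler0 mxE ltxx.
Qed.

Lemma sym_unit v : v^T = v -> posdef (ii *: (v^cj - v)) -> v \in unitmx.
Proof.
move=> sv pv; apply: (space_N_unit (K := - 1%:M) pv).
rewrite conj_opp conj_one tr_opp trmx1 mulmxN mulmx1 mulNmx mul1mx -conj_tr sv opprK.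
by rewrite addrC.
Qed.

(** A vector fixed by [W^cj] satisfies [x^adj W = x^adj] as W is symmetric, so the form of
    [1 - W W^cj] vanishes at it. This makes the inverse Cayley transform well defined. *)
Lemma one_sub_unit W : W^T = W -> posdef (1%:M - W *m W^cj) -> 1%:M - W \in unitmx.
Proof.
move=> sW pW; rewrite -conj_unit conj_add conj_one conj_opp.
apply: unitmx_ker => x; rewrite mulmxBl mul1mx => /(canRL (subrK _)); rewrite add0r => Wx.
apply/eqP/negPn/negP => x0; have := pW x x0.
have xW : x^adj = x^adj *m W.
  by rewrite {1}Wx conj_mul conj_K trmx_mul sW.
by rewrite mulmxBr mulmx1 mulmxA -xW mulmxBl -mulmxA -Wx subrr mxE ltxx.
Qed.

End Units.
End Positive.

(** * Group actions and transitivity *)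

Lemma symplectic_blocks (K : comPzRingType) n (a b c d : 'M[K]_n) :
  (block_mx a b c d)^T *m block_mx 0 1%:M (- 1%:M) 0 *m block_mx a b c d =
    block_mx 0 1%:M (- 1%:M) 0 ->
  [/\ a^T *m c = c^T *m a, a^T *m d = 1%:M + c^T *m b,
      d^T *m a = 1%:M + b^T *m c & b^T *m d = d^T *m b].
Proof.
rewrite tr_block_mx !mulmx_block !(mulmx0, mulmx1, mulmxN, mulNmx, add0r, addr0).
move=> /eq_block_mx[e1 e2 e3 e4]; split.
- by apply/eqP; rewrite -subr_eq0 addrC e1.
- by rewrite -e2 addrC addrA subrr add0r.
- by apply: oppr_inj; rewrite opprD -e3 addrK.
- by apply/eqP; rewrite -subr_eq0 addrC e4.
Qed.

Section MobiusDerivatives.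
Variables (C : numClosedFieldType) (n : nat).

Lemma adj_K m l (A : 'M[C]_(m, l)) : A^adj^adj = A.
Proof. by rewrite conj_tr trmxK conj_K. Qed.

Lemma ball_mobius_dW (p q W X : 'M[C]_n) (N := W *m q^adj + p^adj) :
  p^T *m p^cj = 1%:M + q^adj *m q -> p^adj *m p = 1%:M + q^T *m q^cj ->
  p^T *m q^cj = q^adj *m p -> q^T *m p^cj = p^adj *m q -> W^T = W -> N \in unitmx ->
  (p *m X - (p *m W + q) *m invmx (q^cj *m W + p^cj) *m (q^cj *m X)) *m
    invmx (q^cj *m W + p^cj) = invmx N *m X *m (invmx N)^T.
Proof.
move=> pTp pAp pTq qTp sW uN.
rewrite (ball_mobius pTp pAp pTq qTp sW uN) mulmxA -mulmxBl.
by rewrite (ball_mobius_inv pAp pTq uN) tr_inv (ball_NT p q sW).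
Qed.

(** The inner factors [(N^-1)^T] and [N^T] cancel, the outer ones [N^adj] and its inverse cancel by
    cyclicity of the trace. *)
Lemma ball_act_form (N A B B' : 'M[C]_n) : N \in unitmx ->
  \tr (N^adj *m B *m (invmx N)^T *m (N^adj *m B' *m (invmx N)^T)^cj) = \tr (B *m B'^cj).
Proof.
move=> uN; rewrite !conj_mul !conj_tr conj_K conj_inv.
have uT : N^T \in unitmx by rewrite unitmx_tr.
have uTc : N^adj \in unitmx by rewrite adj_unit.
rewrite !tr_inv !mulmxA (mulmxKV uT) mxtrace_mulC !mulmxA.
by rewrite (mulVmx uTc) mul1mx.
Qed.

Lemma ball_act_form_vec (N A : 'M[C]_n) (a b : 'cV[C]_n) : N \in unitmx ->
  \tr ((invmx N *m a)^T *m (N^adj *m A *m N)^cj *m (invmx N *m b)^cj) =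
  \tr (a^T *m A^cj *m b^cj).
Proof.
move=> uN; rewrite !conj_mul conj_tr conj_K conj_inv trmx_mul tr_inv.
have uT : N^T \in unitmx by rewrite unitmx_tr.
have uc : N^cj \in unitmx by rewrite conj_unit.
by rewrite !mulmxA (mulmxKV uT) (mulmxK uc).
Qed.

Lemma space_mobius_dv (a b c d v X : 'M[C]_n) (N := v *m c^T + d^T) :
  a^T *m c = c^T *m a -> a^T *m d = 1%:M + c^T *m b ->
  d^T *m a = 1%:M + b^T *m c -> b^T *m d = d^T *m b -> v^T = v -> N \in unitmx ->
  (a *m X - (a *m v + b) *m invmx (c *m v + d) *m (c *m X)) *m invmx (c *m v + d) =
  invmx N *m X *m (invmx N)^T.
Proof.
move=> h1 h2 h3 h4 sv uN.
rewrite (space_mobius h1 h2 h3 h4 sv uN) mulmxA -mulmxBl.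
by rewrite (space_mobius_inv h1 h3 uN) tr_inv (space_NT c d sv).
Qed.

Lemma space_act_form_vec (N D : 'M[C]_n) (g h : 'cV[C]_n) : N \in unitmx ->
  \tr ((invmx N *m g)^T *m (N^T *m D *m N^cj) *m (invmx N *m h)^cj) = \tr (g^T *m D *m h^cj).
Proof.
move=> uN; rewrite conj_mul conj_inv trmx_mul tr_inv.
have uT : N^T \in unitmx by rewrite unitmx_tr.
have uc : N^cj \in unitmx by rewrite conj_unit.
by rewrite !mulmxA (mulmxKV uT) (mulmxK uc).
Qed.

Lemma ball_form_sym (A Z : 'M[C]_n) (a b : 'cV[C]_n) : A^cj = A^T -> Z^T = Z ->
  \tr (b^T *m A^cj *m Z^cj *m A *m a) = \tr (a^T *m A^cj *m Z^cj *m A *m b).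
Proof.
move=> hA sZ; rewrite -[LHS]mxtrace_tr !trmx_mul trmxK hA trmxK -conj_tr sZ.
by rewrite !mulmxA.
Qed.

Lemma form_conj (A : 'M[C]_n) (a b : 'cV[C]_n) : A^adj = A ->
  \tr (b^T *m A^cj *m a^cj) = \tr ((a^T *m A^cj *m b^cj)^cj).
Proof.
move=> hA; rewrite -[LHS]mxtrace_tr !trmx_mul trmxK hA !conj_mul conj_tr !conj_K.
by rewrite mulmxA.
Qed.

Lemma invmx_congr (N A : 'M[C]_n) : N \in unitmx -> A \in unitmx ->
  invmx (invmx N *m A *m (invmx N)^adj) = N^adj *m invmx A *m N.
Proof.
move=> uN uA; have uNV : invmx N \in unitmx by rewrite unitmx_inv.
have uNa : (invmx N)^adj \in unitmx by rewrite adj_unit.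
rewrite invmx_mul ?unitmx_mul ?uNV ?uA // invmx_mul // conj_inv tr_inv !invmxK.
by rewrite mulmxA.
Qed.

Lemma congr_mul_inv (N A X : 'M[C]_n) : N \in unitmx ->
  N^adj *m A *m N *m (invmx N *m X *m (invmx N)^T) = N^adj *m (A *m X) *m (invmx N)^T.
Proof. by move=> uN; rewrite !mulmxA (mulmxK uN). Qed.

Lemma conj_real_comb (a c : 'M[C]_n) (q w l : 'cV[C]_n) : a^cj = a -> c^cj = c ->
  q^cj = q -> w^cj = w -> l^cj = l ->
  (a^T *m q + c^T *m w - l)^cj = a^T *m q + c^T *m w - l.
Proof.
by move=> ra rc rq rw rl; rewrite !conj_add conj_opp !conj_mul !conj_tr ra rc rq rw rl.
Qed.

(** Needed because ['i (v^cj - v)] is twice the imaginary part of v. *)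
Lemma posdef_double (A : 'M[C]_n) : posdef (A + A) <-> posdef A.
Proof.
split=> pA; last exact: posdef_add.
by move=> x /pA; rewrite mulmxDr mulmxDl mxE -mulr2n pmulrn_lgt0.
Qed.

(** Scalar rearrangements are stated with plain variables, so that [ring] never meets the traces
    they are applied to. *)
Lemma form_sym (k a b a' b' d d' : C) : d = d' ->
  k * (a + b) + (a' + b' + d) = k * (b + a) + (b' + a' + d').
Proof. by move=> ->; ring. Qed.

Lemma tr_sub m (A B : 'M[C]_m) : \tr (A - B) = \tr A - \tr B.
Proof. exact: raddfB. Qed.

Lemma hermitian_difference (c k a b a' b' : C) :
  c * (k * (a - b) + (a' - b')) = c * ((k * a + a') - (k * b + b')).
Proof. by ring. Qed.

Lemma form_linear (k c a b a' b' : C) :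
  k * (c * a + b) + (c * a' + b') = c * (k * a + a') + (k * b + b').
Proof. by ring. Qed.

End MobiusDerivatives.

Section ComplexJacobiGroup.
Variables (C : numClosedFieldType) (n : nat).
Implicit Types (p q W : 'M[C]_n) (a z : 'cV[C]_n).

(** Membership in the complex Jacobi group without the vector component, over an arbitrary closed
    field. *)
Definition unitary_symplectic p q :=
  [/\ p *m p^adj - q *m q^adj = 1%:M, p *m q^T = q *m p^T,
      p^adj *m p - q^T *m q^cj = 1%:M & p^T *m q^cj = q^adj *m p].

Lemma unitary_symplectic_relations p q : unitary_symplectic p q ->
  [/\ p^T *m p^cj = 1%:M + q^adj *m q, p^adj *m p = 1%:M + q^T *m q^cj,
      p^T *m q^cj = q^adj *m p & q^T *m p^cj = p^adj *m q].
Proof.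
move=> [_ _ g3 g4]; have e3 : p^adj *m p = 1%:M + q^T *m q^cj by rewrite -g3 subrK.
split => //.
  by have := congr1 (fun A => A^cj) e3; rewrite !conjE.
by have := congr1 (fun A => A^cj) g4; rewrite !conjE.
Qed.

(** These are the block relations with g on the left of its adjoint; the previous ones have it on
    the right. A product needs both kinds: one contracts the inner factor, the same kind for the
    outer factor then finishes. *)
Lemma unitary_symplectic_relations_r p q : unitary_symplectic p q ->
  [/\ p *m p^adj = 1%:M + q *m q^adj, p^cj *m p^T = 1%:M + q^cj *m q^T,
      p *m q^T = q *m p^T & p^cj *m q^adj = q^cj *m p^adj].
Proof.
move=> [g1 g2 _ _]; have e1 : p *m p^adj = 1%:M + q *m q^adj by rewrite -g1 subrK.
split => //.
  by have := congr1 (fun A => A^cj) e1; rewrite !conjE.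
by have := congr1 (fun A => A^cj) g2; rewrite !conjE.
Qed.

Lemma unitary_symplectic_mul p q p' q' : unitary_symplectic p q -> unitary_symplectic p' q' ->
  unitary_symplectic (p *m p' + q *m q'^cj) (p *m q' + q *m p'^cj).
Proof.
move=> G H; have [g1 g2 g3 g4] := unitary_symplectic_relations G.
have [h1 h2 h3 h4] := unitary_symplectic_relations_r H.
have [k1 k2 k3 k4] := unitary_symplectic_relations_r G.
have [l1 l2 l3 l4] := unitary_symplectic_relations H.
have rg := (mul_left g1, mul_left g2, mul_left g3, mul_left g4).
have rh := (mul_left h1, mul_left h2, mul_left h3, mul_left h4).
split; rewrite ?conjE ?trE !(mulmxDl, mulmxDr) !mulmxA.
- rewrite !rh !(mulmxDl, mulmxDr) !mulmxA ?mulmx1 k1.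
  by mxabel.
- by rewrite !rh !(mulmxDl, mulmxDr) !mulmxA ?mulmx1 k3; mxabel.
- rewrite !rg !(mulmxDl, mulmxDr) !mulmxA ?mulmx1 l2.
  by mxabel.
- by rewrite !rg !(mulmxDl, mulmxDr) !mulmxA ?mulmx1 l3; mxabel.
Qed.

Lemma unitary_symplectic_one : unitary_symplectic 1%:M 0.
Proof.
by split; rewrite ?map_mx0 ?map_mx1 ?trmx0 ?trmx1 ?mulmx1 ?mulmx0 ?mul0mx ?subr0.
Qed.

Lemma unitary_symplectic_inv p q : unitary_symplectic p q -> unitary_symplectic p^adj (- q^T).
Proof.
move=> G; have [g1 g2 g3 g4] := G; have [k1 k2 k3 k4] := unitary_symplectic_relations_r G.
have [_ _ _ l4] := unitary_symplectic_relations G.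
by split; rewrite ?conjE ?trE ?mulmxN ?mulNmx ?opprK // ?l4 ?k4.
Qed.

Lemma jacobiC_assoc_mx (p q p' q' p2 q2 : 'M[C]_n) :
  p *m (p' *m p2 + q' *m q2^cj) + q *m (p' *m q2 + q' *m p2^cj)^cj =
    (p *m p' + q *m q'^cj) *m p2 + (p *m q' + q *m p'^cj) *m q2^cj /\
  p *m (p' *m q2 + q' *m p2^cj) + q *m (p' *m p2 + q' *m q2^cj)^cj =
    (p *m p' + q *m q'^cj) *m q2 + (p *m q' + q *m p'^cj) *m p2^cj.
Proof. by split; rewrite !conjE !(mulmxDl, mulmxDr) !mulmxA; mxabel. Qed.

Lemma jacobiC_assoc_vec (p' q' p2 q2 : 'M[C]_n) (a a' a2 : 'cV[C]_n) :
  a2 + p2^adj *m a' - q2^T *m a'^cj + (p' *m p2 + q' *m q2^cj)^adj *m a -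
    (p' *m q2 + q' *m p2^cj)^T *m a^cj =
  a2 + p2^adj *m (a' + p'^adj *m a - q'^T *m a^cj) -
    q2^T *m (a' + p'^adj *m a - q'^T *m a^cj)^cj.
Proof. by rewrite ?conjE ?trE !(mulmxDl, mulmxDr, mulmxN) !mulmxA; mxabel. Qed.

Lemma jacobiC_inv_mul p q a : unitary_symplectic p q ->
  [/\ p^adj *m p + - q^T *m q^cj = 1%:M, p^adj *m q + - q^T *m p^cj = 0 &
      a + p^adj *m - (p *m a + q *m a^cj) - q^T *m (- (p *m a + q *m a^cj))^cj = 0].
Proof.
move=> G; have [k1 k2 k3 k4] := unitary_symplectic_relations G.
split; rewrite ?mulNmx ?k2 ?k4 ?addrK ?subrr //.
rewrite !conjE !(mulmxN, mulmxDr) !mulmxA k2 k4 !mulmxDl mul1mx.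
by mxabel.
Qed.

Lemma ball_act_comp p q p' q' W (W' := (p' *m W + q') *m invmx (q'^cj *m W + p'^cj)) :
  q'^cj *m W + p'^cj \in unitmx -> q^cj *m W' + p^cj \in unitmx ->
  ((p *m p' + q *m q'^cj) *m W + (p *m q' + q *m p'^cj)) *m
    invmx ((p *m q' + q *m p'^cj)^cj *m W + (p *m p' + q *m q'^cj)^cj) =
  (p *m W' + q) *m invmx (q^cj *m W' + p^cj).
Proof.
move=> u1 u2; have [-> ->] := ball_mobius_comp p q (mulmxKV u1 _ : W' *m _ = _).
by rewrite (invmx_mul u2 u1) mulmxA (mulmxK u1).
Qed.

Lemma ball_act_comp_vec p q p' q' W W' z a a' :
  W *m q'^adj + p'^adj \in unitmx -> W' *m q^adj + p^adj \in unitmx ->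
  (W *m q'^adj + p'^adj) *m W' = W *m p'^T + q'^T ->
  invmx (W *m (p *m q' + q *m p'^cj)^adj + (p *m p' + q *m q'^cj)^adj) *m
    (z + (a' + p'^adj *m a - q'^T *m a^cj) - W *m (a' + p'^adj *m a - q'^T *m a^cj)^cj) =
  invmx (W' *m q^adj + p^adj) *m
    (invmx (W *m q'^adj + p'^adj) *m (z + a' - W *m a'^cj) + a - W' *m a^cj).
Proof.
move=> u1 u2 W'E.
have -> : W *m (p *m q' + q *m p'^cj)^adj + (p *m p' + q *m q'^cj)^adj =
    (W *m q'^adj + p'^adj) *m (W' *m q^adj + p^adj).
  rewrite [RHS]mulmxDr (mulmxA _ W') W'E !conjE !trE !(mulmxDl, mulmxDr) !mulmxA.
  by mxabel.
by rewrite (invmx_mul u1 u2) -mulmxA (ball_comp_vec _ _ _ u1 W'E) (mulKmx u1).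
Qed.

Lemma space_act_comp (a b c d a' b' c' d' v : 'M[C]_n)
    (v' := (a' *m v + b') *m invmx (c' *m v + d')) :
  c' *m v + d' \in unitmx -> c *m v' + d \in unitmx ->
  ((a *m a' + b *m c') *m v + (a *m b' + b *m d')) *m
    invmx ((c *m a' + d *m c') *m v + (c *m b' + d *m d')) =
  (a *m v' + b) *m invmx (c *m v' + d).
Proof.
move=> u1 u2; have [-> ->] := space_mobius_comp a b c d (mulmxKV u1 _ : v' *m _ = _).
by rewrite (invmx_mul u2 u1) mulmxA (mulmxK u1).
Qed.

Lemma space_act_comp_vec (a' b' c d c' d' v v' : 'M[C]_n) (u l m l' m' : 'cV[C]_n) :
  v *m c'^T + d'^T \in unitmx -> v' *m c^T + d^T \in unitmx ->
  (v *m c'^T + d'^T) *m v' = v *m a'^T + b'^T ->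
  invmx (v *m (c *m a' + d *m c')^T + (c *m b' + d *m d')^T) *m
    (u + v *m (a'^T *m l + c'^T *m m + l') + (b'^T *m l + d'^T *m m + m')) =
  invmx (v' *m c^T + d^T) *m
    (invmx (v *m c'^T + d'^T) *m (u + v *m l' + m') + v' *m l + m).
Proof.
move=> u1 u2 v'E.
have -> : v *m (c *m a' + d *m c')^T + (c *m b' + d *m d')^T =
    (v *m c'^T + d'^T) *m (v' *m c^T + d^T).
  rewrite [RHS]mulmxDr (mulmxA _ v') v'E !trE !(mulmxDl, mulmxDr) !mulmxA.
  by mxabel.
by rewrite (invmx_mul u1 u2) -mulmxA (space_comp_vec _ _ _ _ _ u1 v'E) (mulKmx u1).
Qed.

(* With [1 - W W^cj = L L^adj], the element with [p = (L^adj)^-1] and [q = W p^cj] maps 0 to W. *)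
Lemma ball_transitive_mx W L : W^T = W -> L \in unitmx -> 1%:M - W *m W^cj = L *m L^adj ->
  let p := invmx L^adj in unitary_symplectic p (W *m p^cj).
Proof.
move=> sW uL eL p.
have uLa : L^adj \in unitmx by rewrite adj_unit.
have sWc : (W^cj)^T = W^cj by rewrite -conj_tr sW.
have pa : p^adj = invmx L by rewrite /p conj_inv tr_inv conj_tr conj_K trmxK.
have pc : p^cj = invmx L^T by rewrite /p conj_inv conj_tr conj_K.
set A := p *m p^adj.
have rA : (1%:M - W *m W^cj) *m A = 1%:M.
  by rewrite eL /A pa /p mulmxA (mulmxK uLa) (mulmxV uL).
have lA : A *m (1%:M - W *m W^cj) = 1%:M by exact: mulmx1C rA.
have cA := ball_commute rA lA.
have Ac : A^cj = p^cj *m p^T by rewrite /A conj_mul conj_tr conj_K.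
have pWp : p^adj *m (1%:M - W *m W^cj) *m p = 1%:M.
  by rewrite eL pa mulmxA (mulVmx uL) mul1mx /p (mulmxV uLa).
split.
- rewrite conj_mul conj_K trmx_mul sWc !mulmxA -(mulmxA W) -Ac cA -/A.
  by rewrite -[X in X - _]mulmx1 -mulmxA -mulmxBr.
- rewrite trmx_mul sW mulmxA -/A -cA Ac.
  by rewrite !mulmxA.
- rewrite trmx_mul sW conj_mul conj_K.
  by move: pWp; rewrite mulmxBr mulmx1 mulmxBl !mulmxA.
- by rewrite !conj_mul conj_K trmx_mul sWc !mulmxA.
Qed.

Lemma ball_form_transport (k : C) (N A A1 B B1 B' B1' : 'M[C]_n) (a a1 b b1 : 'cV[C]_n) :
  N \in unitmx -> A1 = N^adj *m A *m N ->
  B1 = N^adj *m B *m (invmx N)^T -> B1' = N^adj *m B' *m (invmx N)^T ->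
  a1 = invmx N *m a -> b1 = invmx N *m b ->
  k * \tr (B1 *m B1'^cj) + \tr (a1^T *m A1^cj *m b1^cj) =
  k * \tr (B *m B'^cj) + \tr (a^T *m A^cj *m b^cj).
Proof.
by move=> uN -> -> -> -> ->; rewrite ball_act_form // ball_act_form_vec.
Qed.

Lemma space_form_transport (k s : C) (N D D1 B B1 B' B1' : 'M[C]_n) (a a1 b b1 : 'cV[C]_n) :
  N \in unitmx -> D1 = N^T *m D *m N^cj ->
  B1 = N^adj *m B *m (invmx N)^T -> B1' = N^adj *m B' *m (invmx N)^T ->
  a1 = invmx N *m a -> b1 = invmx N *m b ->
  k * \tr (B1 *m B1'^cj) + s * \tr (a1^T *m D1 *m b1^cj) =
  k * \tr (B *m B'^cj) + s * \tr (a^T *m D *m b^cj).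
Proof.
by move=> uN -> -> -> -> ->; rewrite ball_act_form // space_act_form_vec.
Qed.

End ComplexJacobiGroup.

Section SpaceForms.
Variables (C : numClosedFieldType) (n : nat).

Lemma space_derive_q (D X : 'M[C]_n) (q x u : 'cV[C]_n) : q^cj = q -> D *m (u^cj - u) = q ->
  D *m (X - X^cj) *m D *m (u^cj - u) + D *m (x^cj - x) =
  D *m ((x - X *m q)^cj - (x - X *m q)).
Proof.
move=> rq qE; rewrite -(mulmxA (D *m _)) qE conj_add conj_opp conj_mul rq -mulmxA -mulmxDr.
by congr (_ *m _); rewrite mulmxBl; mxabel.
Qed.

Lemma space_form_conj (D : 'M[C]_n) (s : C) (a b : 'cV[C]_n) : D^T = D -> D^cj = - D ->
  Num.conj s = - s -> s * \tr (b^T *m D *m a^cj) = Num.conj (s * \tr (a^T *m D *m b^cj)).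
Proof.
move=> sD cD cs; rewrite rmorphM /= cs conj_trace !conj_mul conj_K conj_tr cD.
rewrite -[in LHS]mxtrace_tr !trmx_mul trmxK sD mulmxN mulNmx raddfN mulrNN.
by rewrite mulmxA.
Qed.

Lemma space_hermitian (D B B' : 'M[C]_n) (k s : C) (a b : 'cV[C]_n) : D^T = D -> D^cj = - D ->
  Num.conj k = k -> Num.conj s = - s ->
  k * \tr (B' *m B^cj) + s * \tr (b^T *m D *m a^cj) =
  Num.conj (k * \tr (B *m B'^cj) + s * \tr (a^T *m D *m b^cj)).
Proof.
move=> sD cD ck cs; rewrite (space_form_conj _ _ sD cD cs) rmorphD /= [X in _ = X + _]rmorphM /=.
by rewrite ck conj_trace conj_mul conj_K mxtrace_mulC.
Qed.

Lemma space_form_sym (D Z : 'M[C]_n) (k s x y x' y' : C) (a b : 'cV[C]_n) :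
  D^T = D -> Z^T = Z ->
  k * - (x + y) + s * (x' + y' + \tr (b^T *m D *m Z^cj *m D *m a)) =
  k * - (y + x) + s * (y' + x' + \tr (a^T *m D *m Z^cj *m D *m b)).
Proof.
move=> sD sZ; rewrite -[\tr (b^T *m _ *m _ *m _ *m _)]mxtrace_tr !trmx_mul trmxK sD -conj_tr sZ.
by rewrite !mulmxA (addrC y) (addrC y').
Qed.

Section Positive.
Variables (N D : 'M[C]_n) (ii : C).
Hypothesis ii2 : ii * ii = -1.
Hypothesis cii : Num.conj ii = - ii.
Hypothesis pN : posdef N.
Hypothesis hN : N^adj = N.
Hypothesis rN : N^cj = N.
Hypothesis DE : D = ii *: N.

Lemma space_matrix_gt0 (X : 'M[C]_n) : X^T = X -> X != 0 -> 0 < \tr (D *m X *m (D *m X)^cj).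
Proof.
move=> sX X0; have -> : D *m X *m (D *m X)^cj = N *m X *m N^cj *m X^cj.
  rewrite DE !conj_mul conj_scale cii -!scalemxAl -!scalemxAr scalerA mulrN ii2 opprK scale1r.
  by rewrite !mulmxA.
exact: trace_posdef_gt0.
Qed.

Lemma space_vector_gt0 (g : 'cV[C]_n) : g != 0 -> 0 < 2 / ii * \tr (g^T *m D *m g^cj).
Proof.
have ii0 : ii != 0.
  by apply: contra_eqN ii2 => /eqP ->; rewrite mul0r eq_sym oppr_eq0 oner_eq0.
move=> g0; rewrite DE -scalemxAr -scalemxAl mxtraceZ mulrA divfK //.
by rewrite mulr_gt0 // -{1}rN; exact: posdef_conj_tr.
Qed.

End Positive.

(** For [Q = v^cj - v] this writes [D = ii N] with N real and positive definite, namely the inverse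
    of twice the imaginary part of v. The positivity of both terms of the form is read off from
    N. *)
Lemma inv_scale_posdef (Q : 'M[C]_n) (ii : C) : ii * ii = -1 -> Num.conj ii = - ii ->
  Q^T = Q -> Q^cj = - Q -> posdef (ii *: Q) ->
  let N := invmx (ii *: Q) in
  [/\ posdef N, N^adj = N, N^cj = N & invmx Q = ii *: N].
Proof.
move=> ii2 cii sQ cQ pQ N; have u := posdef_unit pQ.
have ii0 : ii != 0.
  by apply: contra_eqN ii2 => /eqP ->; rewrite mul0r eq_sym oppr_eq0 oner_eq0.
have cP : (ii *: Q)^cj = ii *: Q by rewrite conj_scale cii cQ scaleNr scalerN opprK.
have sP : (ii *: Q)^T = ii *: Q by rewrite tr_scale sQ.
split.
- by apply: posdef_inv => //; rewrite cP sP.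
- by rewrite /N conj_inv tr_inv cP sP.
- by rewrite /N conj_inv cP.
- by rewrite /N invmxZ // scalerA divff // scale1r.
Qed.

Lemma conj_2_div (ii : C) : Num.conj ii = - ii -> Num.conj (2 / ii) = - (2 / ii).
Proof. by move=> cii; rewrite rmorphM fmorphV /= cii (rmorph_nat Num.conj 2) invrN mulrN. Qed.

End SpaceForms.

Lemma scale_congr (C : comPzRingType) n c (N N' X X1 : 'M[C]_n) : X1 = c *: X ->
  N *m X1 *m N' = c *: (N *m X *m N').
Proof. by move=> ->; rewrite -scalemxAr -scalemxAl. Qed.

Lemma scale_affine (C : comPzRingType) n c (N X X1 : 'M[C]_n) (x x1 e : 'cV[C]_n) :
  X1 = c *: X -> x1 = c *: x -> N *m (x1 + X1 *m e) = c *: (N *m (x + X *m e)).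
Proof. by move=> -> ->; rewrite -scalemxAl -scalerDr -scalemxAr. Qed.

Lemma scale_affineN (C : comPzRingType) n c (N X X1 : 'M[C]_n) (x x1 e : 'cV[C]_n) :
  X1 = c *: X -> x1 = c *: x -> N *m (x1 - X1 *m e) = c *: (N *m (x - X *m e)).
Proof. by move=> -> ->; rewrite -scalemxAl -scalerBr -scalemxAr. Qed.

Lemma form_linear2 (C : comPzRingType) (k s c a b a' b' : C) :
  k * (c * a + b) + s * (c * a' + b') = c * (k * a + s * a') + (k * b + s * b').
Proof. by ring. Qed.

Lemma hermitian_difference2 (C : comPzRingType) (c k s a b a' b' : C) :
  c * (k * (a - b) + s * (a' - b')) = c * ((k * a + s * a') - (k * b + s * b')).
Proof. by ring. Qed.

Lemma form_scale2 (C : comPzRingType) (k s c a a' : C) :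
  k * (c * a) + s * (c * a') = c * (k * a + s * a').
Proof. by ring. Qed.

Lemma cholesky_real (R : rcfType) n (r : 'M[R]_n) : r^T = r ->
  (forall x : 'cV[R]_n, x != 0 -> 0 < (x^T *m r *m x) 0 0) ->
  exists2 L : 'M[R]_n, L \in unitmx & r = L *m L^T.
Proof.
move=> sr pr; have sqr (a : R) : 0 < a -> exists2 b : R, b * idfun b = a & b != 0.
  move=> a0; exists (Num.sqrt a); last by rewrite sqrtr_eq0 -ltNge.
  by rewrite /= -expr2 sqr_sqrtr // ltW.
have idE m l (A : 'M[R]_(m, l)) : map_mx idfun A = A by exact: map_mx_id.
have [] := @cholesky R idfun (fun x => erefl) sqr n r.
- by rewrite idE.
- by move=> x x0; rewrite idE; exact: pr.
by move=> L uL; rewrite idE => eL; exists L.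
Qed.

Section RealSymplectic.
Variables (K : fieldType) (n : nat).
Local Notation J := (block_mx 0 1%:M (- 1%:M) 0 : 'M[K]_(n + n)).

(** Since [J J = -1], the matrix [- J g^T J] is a left inverse of g. *)
Lemma symplectic_unit (g : 'M[K]_(n + n)) : g^T *m J *m g = J -> g \in unitmx.
Proof.
move=> gE; have JJ : - J *m J = 1%:M.
  rewrite mulNmx mulmx_block !(mulmx0, mul0mx, mulmx1, mul1mx, add0r, addr0) opp_block_mx.
  by rewrite !oppr0 opprK -scalar_mx_block.
have : (- J *m g^T *m J) *m g = 1%:M by rewrite -!mulmxA (mulmxA g^T) gE JJ.
by move/mulmx1_unit => [].
Qed.

Lemma symplectic_mul (g h : 'M[K]_(n + n)) : g^T *m J *m g = J -> h^T *m J *m h = J ->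
  (g *m h)^T *m J *m (g *m h) = J.
Proof.
move=> gE hE; transitivity (h^T *m (g^T *m J *m g) *m h); last by rewrite gE.
by rewrite trmx_mul !mulmxA.
Qed.

Lemma symplectic_inv (g : 'M[K]_(n + n)) : g^T *m J *m g = J ->
  (invmx g)^T *m J *m invmx g = J.
Proof.
move=> gE; have u := symplectic_unit gE.
rewrite -{1}gE !mulmxA -trmx_mul (mulmxV u) trmx1 mul1mx -mulmxA (mulmxV u).
by rewrite mulmx1.
Qed.

(** This element sends the base point i to [(i L + s L^-T) L^T = s + i L L^T], which is why it gives
    transitivity. *)
Lemma symplectic_triangular (L s : 'M[K]_n) : L \in unitmx -> s^T = s ->
  let g := block_mx L (s *m invmx L^T) 0 (invmx L^T) in g^T *m J *m g = J.
Proof.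
move=> uL ss g; have uLT : L^T \in unitmx by rewrite unitmx_tr.
rewrite /g tr_block_mx !mulmx_block
  !(mulmx0, mul0mx, mulmx1, mulmxN, mulNmx, add0r, addr0, trmx0, oppr0).
rewrite trmx_mul !trmx_inv trmxK ss (mulmxV uLT) (mulVmx uL) !mulmxA.
by rewrite addNr.
Qed.

End RealSymplectic.

(** * The Cayley transform on matrices *)

Section CayleyTransform.
Variables (C : numClosedFieldType) (n : nat) (ii : C).
Hypothesis ii2 : ii * ii = -1.
Hypothesis cii : Num.conj ii = - ii.
Implicit Types v S W X Y D : 'M[C]_n.

Let ii0 : ii != 0.
Proof. by apply: contra_eqN ii2 => /eqP ->; rewrite mul0r eq_sym oppr_eq0 oner_eq0. Qed.

Let two_ii0 : 2 * ii != 0.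
Proof. by rewrite mulf_neq0 ?pnatr_eq0. Qed.

(** Adding [ii] to v adds 2 to [ii (v^cj - v)], so [v + ii] still has positive definite imaginary
    part and is invertible. *)
Lemma cayley_unit v : v^T = v -> posdef (ii *: (v^cj - v)) -> v + ii%:M \in unitmx.
Proof.
move=> sv pv; apply: (@sym_unit _ _ ii); first by rewrite tr_add tr_scalar_mx sv.
rewrite conj_add conj_scalar cii.
have -> : ii *: (v^cj + (- ii)%:M - (v + ii%:M)) = ii *: (v^cj - v) + (1%:M + 1%:M).
  rewrite -(scalemx1 n ii) -(scalemx1 n (- ii)).
  by apply/matrixP => i j; rewrite !mxE; ring: ii2.
by apply: posdef_add => //; apply: posdef_add; exact: posdef_one.
Qed.

Lemma cayley_ball v (W := 1%:M - (2 * ii) *: invmx (v + ii%:M)) :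
  v^T = v -> posdef (ii *: (v^cj - v)) -> W^T = W /\ posdef (1%:M - W *m W^cj).
Proof.
move=> sv pv; have u := cayley_unit sv pv; split.
  by rewrite tr_add tr_opp trmx1 tr_scale tr_inv tr_add tr_scalar_mx sv.
rewrite (cayley_defect ii2 cii u sv).
have uS : (invmx (v + ii%:M))^adj \in unitmx by rewrite adj_unit unitmx_inv.
have p2 : posdef ((2 * ii) *: (v^cj - v)).
  by rewrite -scalerA; apply: posdef_scale.
by have := posdef_congr uS p2; rewrite adj_K.
Qed.

Lemma cayley_derive_W v X (S := invmx (v + ii%:M)) : v + ii%:M \in unitmx ->
  (X - (v - ii%:M) *m S *m X) *m S = (2 * ii) *: (S *m X *m S).
Proof.
move=> u; rewrite (cayley_W u).
have -> : X - (1%:M - (2 * ii) *: S) *m X = (2 * ii) *: (S *m X).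
  by rewrite mulmxBl mul1mx opprB addrC subrK -scalemxAl.
by rewrite -scalemxAl.
Qed.

Lemma cayley_derive_A v X (S := invmx (v + ii%:M)) (u x q w : 'cV[C]_n) : v + ii%:M \in unitmx ->
  q^cj = q -> w^cj = w -> u = v *m q + w ->
  (2 * ii) *: (S *m (x - X *m (S *m u))) +
    (2 * ii) *: (S *m X *m S) *m (w + ii *: q)^cj = (2 * ii) *: (S *m (x - X *m q)).
Proof.
move=> uv rq rw uE; rewrite mulmxBr !mulmxA.
exact: (cayley_A cii X x (mulVmx uv) rq rw uE).
Qed.

Lemma cayley_form_transport (k : C) (S D M1 X B1 Y B1' : 'M[C]_n) (g a1 h b1 : 'cV[C]_n) :
  S \in unitmx -> S^T = S -> D^cj = - D ->
  M1 = (- ii / 2) *: (invmx S^adj *m D *m invmx S) ->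
  B1 = M1 *m ((2 * ii) *: (S *m X *m S)) -> B1' = M1 *m ((2 * ii) *: (S *m Y *m S)) ->
  a1 = (2 * ii) *: (S *m g) -> b1 = (2 * ii) *: (S *m h) ->
  k * \tr (B1 *m B1'^cj) + \tr (a1^T *m M1^cj *m b1^cj) =
  k * \tr (D *m X *m (D *m Y)^cj) + 2 / ii * \tr (g^T *m D *m h^cj).
Proof.
move=> uS sS cD -> -> -> -> ->.
by rewrite (cayley_matrix_form ii2) // (cayley_vector_form ii2 cii).
Qed.

Lemma cayley_inv_space W (v := (2 * ii) *: invmx (1%:M - W) - ii%:M) : W^T = W ->
  posdef (1%:M - W *m W^cj) -> v^T = v /\ posdef (ii *: (v^cj - v)).
Proof.
move=> sW pW; have u := one_sub_unit sW pW.
have sT : (invmx (1%:M - W))^T = invmx (1%:M - W) by rewrite tr_inv tr_add tr_opp trmx1 sW.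
split; first by rewrite tr_add tr_opp tr_scale tr_scalar_mx sT.
have e2 : (1%:M - W^cj) *m (invmx (1%:M - W))^cj = 1%:M.
  have -> : 1%:M - W^cj = (1%:M - W)^cj by rewrite conj_add conj_opp conj_one.
  by rewrite -conj_mul mulmxV // conj_one.
rewrite /v (cayley_inv_defect cii (mulVmx u) e2) scalerA.
have -> : ii * - (2 * ii) = 2 by rewrite mulrN mulrCA ii2 mulrN1 opprK.
apply: posdef_scale => //; rewrite -[in X in _ *m X]sT conj_tr.
have uT : (invmx (1%:M - W))^adj \in unitmx by rewrite adj_unit unitmx_inv.
by have := posdef_congr uT pW; rewrite adj_K.
Qed.

Lemma cayleyK_W W (v := (2 * ii) *: invmx (1%:M - W) - ii%:M) (z : 'cV[C]_n) :
  1%:M - W \in unitmx ->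
  (v - ii%:M) *m invmx (v + ii%:M) = W /\
  (2 * ii) *: (invmx (v + ii%:M) *m (invmx (1%:M - W) *m z)) = z.
Proof.
move=> u; have vE : v + ii%:M = (2 * ii) *: invmx (1%:M - W) by rewrite /v subrK.
have uc : 2 * ii \is a GRing.unit by rewrite unitfE.
have uT : invmx (1%:M - W) \in unitmx by rewrite unitmx_inv.
have uv : v + ii%:M \in unitmx by rewrite vE unitmxZ.
have vV : invmx (v + ii%:M) = (2 * ii)^-1 *: (1%:M - W).
  by rewrite vE invmxZ ?invmxK // unitmxZ.
split; first by rewrite (cayley_W uv) vV scalerA divff // scale1r opprB addrC subrK.
by rewrite vV -scalemxAl scalerA divff // scale1r mulKVmx.
Qed.

Lemma cayleyK_v v (W := (v - ii%:M) *m invmx (v + ii%:M)) (u : 'cV[C]_n) :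
  v + ii%:M \in unitmx ->
  (2 * ii) *: invmx (1%:M - W) - ii%:M = v /\
  invmx (1%:M - W) *m ((2 * ii) *: (invmx (v + ii%:M) *m u)) = u.
Proof.
move=> uv; have uc : 2 * ii \is a GRing.unit by rewrite unitfE.
have uS : invmx (v + ii%:M) \in unitmx by rewrite unitmx_inv.
have WV : invmx (1%:M - W) = (2 * ii)^-1 *: (v + ii%:M).
  by rewrite /W (cayley_W uv) opprB addrC subrK invmxZ ?invmxK // unitmxZ.
split; first by rewrite WV scalerA divff // scale1r addrK.
by rewrite WV -scalemxAr -scalemxAl scalerA divff // scale1r mulKVmx.
Qed.

End CayleyTransform.

(** * Calculus on open subsets of a linear subspace *)

Section Calculus.
Local Open Scope classical_set_scope.
Variables (R : realType) (E : normedModType R) (T M : set E).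

(** The part of [complex_domain] that the calculus uses. [M] is open in the subspace [T], in general
    not in [E], so derivatives are only controlled along [T]. *)
Definition charted :=
  (forall a X Y, T X -> T Y -> T (a *: X + Y)) /\
  (exists2 U, open U & M = T `&` U).

Hypothesis TM : charted.

Lemma near_charted p X : M p -> T X -> \forall h \near (0 : R), M (h *: X + p).
Proof.
case: TM => Tlin [U Uop MU] Mp TX.
have Up : U p by move: Mp; rewrite MU => -[].
have Tp : T p by move: Mp; rewrite MU => -[].
have cvX : h *: X + p @[h --> (0 : R)] --> (0 : R) *: X + p.
  by apply: cvgD; [exact: cvgZr_tmp | exact: cvg_cst].
have nU : \forall h \near (0 : R), U (h *: X + p).
  by apply: cvX; rewrite scale0r add0r; exact: open_nbhs_nbhs.
apply: (filterS (P := fun h : R => U (h *: X + p))) nU => h Uh.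
by rewrite MU; split => //; exact: Tlin.
Qed.

Section Ext.
Variables (F : normedModType R) (f g : E -> F).
Hypothesis fg : forall p, M p -> f p = g p.

(** From a point of M a short segment along T stays in M, so difference quotients along T only see
    values on M. Formulas valid on M alone, such as those with [invmx], may then be differentiated
    freely. *)
Let near_quot p X : M p -> T X -> \forall h \near (0 : R)^',
  h^-1 *: ((f \o shift p) (h *: X) - f p) =
  h^-1 *: ((g \o shift p) (h *: X) - g p).
Proof.
move=> Mp TX; apply: cvg_within; apply: filterS (near_charted Mp TX) => h Mh /=.
by rewrite !fg.
Qed.

Lemma derivable_charted p X : M p -> T X -> derivable f p X -> derivable g p X.
Proof.
move=> Mp TX /cvg_ex[l fl]; apply/cvg_ex; exists l.
apply: cvg_trans fl; apply: near_eq_cvg.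
by move: (near_quot Mp TX); apply: filterS => h /= ->.
Qed.

Lemma derive_charted p X : M p -> T X -> 'D_X f p = 'D_X g p.
Proof.
move=> Mp TX; rewrite /derive; congr (lim _).
by rewrite eqEsubset; split; apply: near_eq_cvg;
  move: (near_quot Mp TX); apply: filterS => h /= ->.
Qed.

End Ext.

Lemma Ck_on_ext (F : normedModType R) k (f g : E -> F) :
  (forall p, M p -> f p = g p) -> Ck_on T M k f -> Ck_on T M k g.
Proof.
elim: k f g => [|k IH] f g fg /= [cf Df]; split => //.
1,2: by apply: subspace_eq_continuous cf => x; rewrite inE; exact: fg.
move=> X TX; have [df Ckf] := Df X TX; split=> [p Mp|].
  exact: derivable_charted fg _ _ _ _ (df p Mp).
by apply: IH Ckf => p Mp; exact: derive_charted.
Qed.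

Lemma Ck_onW (F : normedModType R) k (f : E -> F) :
  Ck_on T M k.+1 f -> Ck_on T M k f.
Proof.
elim: k f => [|k IH] f [cf Df]; split => // X TX.
by have [df Ckf] := Df X TX; split => //; exact: IH.
Qed.

Lemma within_cont (F : normedModType R) (f : E -> F) :
  {within M, continuous f} <->
  forall p, M p -> f x @[x --> within M (nbhs p)] --> f p.
Proof. exact: subspace_continuousP. Qed.

Lemma Ck_on_cst (F : normedModType R) k (c : F) : Ck_on T M k (fun=> c).
Proof.
elim: k c => [|k IH] c /=; split => //.
1,2: by apply: continuous_subspaceT => x; exact: cvg_cst.
move=> X TX; split=> [p _|]; first exact: derivable_cst.
by apply: Ck_on_ext (IH 0) => p _; rewrite derive_cst.
Qed.

Lemma Ck_onD (F : normedModType R) k (f g : E -> F) :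
  Ck_on T M k f -> Ck_on T M k g -> Ck_on T M k (fun p => f p + g p).
Proof.
elim: k f g => [|k IH] f g [/within_cont cf Df] [/within_cont cg Dg]; split => //.
1,2: by apply/within_cont => p Mp; apply: cvgD; [exact: cf|exact: cg].
move=> X TX; have [df Ckf] := Df X TX; have [dg Ckg] := Dg X TX; split.
  by move=> p Mp; apply: derivableD; [exact: df|exact: dg].
by apply: Ck_on_ext (IH _ _ Ckf Ckg) => p Mp; rewrite deriveD //; auto.
Qed.

Lemma Ck_onM k (f g : E -> R) :
  Ck_on T M k f -> Ck_on T M k g -> Ck_on T M k (fun p => f p * g p).
Proof.
elim: k f g => [|k IH] f g Cf Cg.
  case: Cf Cg => [/within_cont cf _] [/within_cont cg _]; split => //.
  by apply/within_cont => p Mp; apply: cvgM; [exact: cf|exact: cg].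
have [Cf1 Cg1] := (Ck_onW Cf, Ck_onW Cg).
case: Cf Cg => [/within_cont cf Df] [/within_cont cg Dg]; split => //.
  by apply/within_cont => p Mp; apply: cvgM; [exact: cf|exact: cg].
move=> X TX; have [df Ckf] := Df X TX; have [dg Ckg] := Dg X TX; split.
  by move=> p Mp; apply: derivableM; [exact: df|exact: dg].
apply: Ck_on_ext (Ck_onD (IH _ _ Cf1 Ckg) (IH _ _ Cg1 Ckf)) => p Mp.
by rewrite deriveM //; auto.
Qed.

Lemma Ck_onV k (f : E -> R) : (forall p, M p -> f p != 0) ->
  Ck_on T M k f -> Ck_on T M k (fun p => (f p)^-1).
Proof.
move=> f0; elim: k => [|k IH] Cf.
  case: Cf => [/within_cont cf _]; split => //.
  by apply/within_cont => p Mp; apply: cvgV; [exact: f0|exact: cf].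
have CV := IH (Ck_onW Cf); case: Cf => [/within_cont cf Df]; split.
  by apply/within_cont => p Mp; apply: cvgV; [exact: f0|exact: cf].
move=> X TX; have [df Ckf] := Df X TX; split.
  by move=> p Mp; apply: derivableV; [exact: f0|exact: df].
apply: Ck_on_ext (Ck_onM (Ck_on_cst (F := R) k (-1)) (Ck_onM (Ck_onM CV CV) Ckf)).
move=> p Mp.
rewrite deriveV; [|exact: f0|exact: df].
by rewrite scaleNr -[_ *: _]/(_ * _) mulN1r expr2 invfM.
Qed.

Lemma derivable_linear (F : normedModType R) (f : E -> F) p X :
  (forall a X Y, f (a *: X + Y) = a *: f X + f Y) ->
  derivable f p X /\ 'D_X f p = f X.
Proof.
move=> flin.
have cv : h^-1 *: ((f \o shift p) (h *: X) - f p) @[h --> (0 : R)^'] --> f X.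
  apply: cvg_near_cst; apply: filterS (nbhs_dnbhs_neq (0 : R)) => h h0 /=.
  by rewrite flin addrK scalerA mulVf// scale1r.
by split; [apply/cvg_ex; exists (f X) | apply/cvg_lim].
Qed.

Lemma Ck_on_linear (F : normedModType R) k (f : E -> F) :
  (forall a X Y, f (a *: X + Y) = a *: f X + f Y) -> continuous f ->
  Ck_on T M k f.
Proof.
move=> flin cf; case: k => [|k]; split => //; try exact: continuous_subspaceT.
move=> X TX; split=> [p _|]; first by have [] := derivable_linear p X flin.
apply: Ck_on_ext (Ck_on_cst k (f X)) => p Mp.
by have [_ ->] := derivable_linear p X flin.
Qed.

End Calculus.

(** * Complex-valued functions through real and imaginary parts *)

Section ComplexMatrices.
Local Open Scope classical_set_scope.
Variable R : realType.
Local Notation C := R[i].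

Lemma Re_add (x y : C) : complex.Re (x + y) = complex.Re x + complex.Re y.
Proof. by case: x y => [a b] [c d]. Qed.

Lemma Im_add (x y : C) : complex.Im (x + y) = complex.Im x + complex.Im y.
Proof. by case: x y => [a b] [c d]. Qed.

Lemma Re_opp (x : C) : complex.Re (- x) = - complex.Re x.
Proof. by case: x. Qed.

Lemma Re_mul (x y : C) : complex.Re (x * y) =
  complex.Re x * complex.Re y - complex.Im x * complex.Im y.
Proof. by case: x y => [a b] [c d]. Qed.

Lemma Im_mul (x y : C) : complex.Im (x * y) =
  complex.Re x * complex.Im y + complex.Im x * complex.Re y.
Proof. by case: x y => [a b] [c d]. Qed.

Lemma complexP (x y : C) :
  complex.Re x = complex.Re y -> complex.Im x = complex.Im y -> x = y.
Proof. by case: x y => [a b] [c d] /= -> ->. Qed.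

Lemma conj_complexE (x : C) : Num.conj x = (complex.Re x -i* complex.Im x)%C.
Proof. by case: x. Qed.

Lemma Re_conjc (x : C) : complex.Re (Num.conj x) = complex.Re x.
Proof. by rewrite conj_complexE. Qed.

Lemma Im_conjc (x : C) : complex.Im (Num.conj x) = - complex.Im x.
Proof. by rewrite conj_complexE. Qed.

Lemma Re_inv (x : C) : complex.Re x^-1 =
  complex.Re x * (complex.Re x * complex.Re x + complex.Im x * complex.Im x)^-1.
Proof. by case: x => a b /=; rewrite !expr2. Qed.

Lemma Im_inv (x : C) : complex.Im x^-1 =
  - complex.Im x * (complex.Re x * complex.Re x + complex.Im x * complex.Im x)^-1.
Proof. by case: x => a b /=; rewrite !expr2 mulNr. Qed.

Variables (E : normedModType R) (T M : set E).
Hypothesis TM : charted T M.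

(** Smoothness is defined for maps between real normed spaces, so a complex function is treated as a
    pair of real ones. Conjugation is then an admissible operation. *)
Definition csmooth (f : E -> C) :=
  smooth_on T M (fun p => complex.Re (f p) : R) /\
  smooth_on T M (fun p => complex.Im (f p) : R).

Definition cderive (f : E -> C) (p X : E) : C :=
  ('D_X (fun q => complex.Re (f q) : R) p +i*
   'D_X (fun q => complex.Im (f q) : R) p)%C.

Section Real.
Implicit Types f g : E -> R.

Lemma smooth_ext f g : (forall p, M p -> f p = g p) ->
  smooth_on T M f -> smooth_on T M g.
Proof. by move=> fg sf k; exact: Ck_on_ext (sf k). Qed.

Lemma smooth_derivable f p X : smooth_on T M f -> M p -> T X -> derivable f p X.
Proof. by move=> sf Mp TX; have [_ /(_ X TX)[+ _]] := sf 1%N; apply. Qed.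

Lemma smoothD f g : smooth_on T M f -> smooth_on T M g ->
  smooth_on T M (fun p => f p + g p).
Proof. by move=> sf sg k; exact: Ck_onD. Qed.

Lemma smoothM f g : smooth_on T M f -> smooth_on T M g ->
  smooth_on T M (fun p => f p * g p).
Proof. by move=> sf sg k; exact: Ck_onM. Qed.

Lemma smoothN f : smooth_on T M f -> smooth_on T M (fun p => - f p).
Proof.
move=> sf; apply: smooth_ext (smoothM (fun k => Ck_on_cst TM (F := R) k (-1)) sf).
by move=> p _; rewrite mulN1r.
Qed.

Lemma smoothV f : (forall p, M p -> f p != 0) -> smooth_on T M f ->
  smooth_on T M (fun p => (f p)^-1).
Proof. by move=> f0 sf k; exact: Ck_onV. Qed.

Lemma derive_smoothD f g p X : smooth_on T M f -> smooth_on T M g -> M p -> T X ->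
  'D_X (fun q => f q + g q) p = 'D_X f p + 'D_X g p.
Proof. by move=> sf sg Mp TX; apply: deriveD; exact: smooth_derivable. Qed.

Lemma derive_smoothN f p X : smooth_on T M f -> M p -> T X ->
  'D_X (fun q => - f q) p = - 'D_X f p.
Proof. by move=> sf Mp TX; apply: deriveN; exact: smooth_derivable. Qed.

Lemma derive_smoothM f g p X : smooth_on T M f -> smooth_on T M g -> M p -> T X ->
  'D_X (fun q => f q * g q) p = f p * 'D_X g p + g p * 'D_X f p.
Proof. by move=> sf sg Mp TX; apply: deriveM; exact: smooth_derivable. Qed.

End Real.

Section Complex.
Implicit Types f g : E -> C.

Lemma csmooth_ext f g : (forall p, M p -> f p = g p) -> csmooth f -> csmooth g.
Proof.
by move=> fg [sf sf']; split; [apply: smooth_ext sf|apply: smooth_ext sf'] => p Mp;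
  rewrite fg.
Qed.

Lemma csmooth_cst c : csmooth (fun=> c).
Proof. by split => k; exact: Ck_on_cst. Qed.

Lemma csmoothD f g : csmooth f -> csmooth g -> csmooth (fun p => f p + g p).
Proof.
move=> [f1 f2] [g1 g2]; split.
  by apply: smooth_ext (smoothD f1 g1) => p _; rewrite Re_add.
by apply: smooth_ext (smoothD f2 g2) => p _; rewrite Im_add.
Qed.

Lemma csmoothM f g : csmooth f -> csmooth g -> csmooth (fun p => f p * g p).
Proof.
move=> [f1 f2] [g1 g2]; split.
  apply: smooth_ext (smoothD (smoothM f1 g1) (smoothN (smoothM f2 g2))) => p _.
  by rewrite Re_mul.
apply: smooth_ext (smoothD (smoothM f1 g2) (smoothM f2 g1)) => p _.
by rewrite Im_mul.
Qed.

Lemma csmooth_conj f : csmooth f -> csmooth (fun p => Num.conj (f p)).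
Proof.
move=> [f1 f2]; split.
  by apply: smooth_ext f1 => p _; rewrite Re_conjc.
by apply: smooth_ext (smoothN f2) => p _; rewrite Im_conjc.
Qed.

Lemma csmoothV f : (forall p, M p -> f p != 0) -> csmooth f ->
  csmooth (fun p => (f p)^-1).
Proof.
move=> f0 [f1 f2].
have sn := smoothD (smoothM f1 f1) (smoothM f2 f2).
have /smoothV/(_ sn) sV : forall p, M p -> complex.Re (f p) * complex.Re (f p) +
    complex.Im (f p) * complex.Im (f p) != 0.
  move=> p /f0; apply: contraNneq => /eqP.
  rewrite -!expr2 paddr_eq0 ?sqr_ge0// !sqrf_eq0 => /andP[/eqP a /eqP b].
  apply/eqP.
  exact: complexP.
split.
  by apply: smooth_ext (smoothM f1 sV) => p _; rewrite Re_inv.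
by apply: smooth_ext (smoothM (smoothN f2) sV) => p _; rewrite Im_inv.
Qed.

Lemma csmooth_sum (I : finType) (P : pred I) (f : I -> E -> C) :
  (forall i, csmooth (f i)) -> csmooth (fun p => \sum_(i | P i) f i p).
Proof.
move=> sf; elim: (index_enum I) => [|i s IH].
  by apply: csmooth_ext (csmooth_cst 0) => p _; rewrite big_nil.
have [Pi|Pi] := boolP (P i).
  by apply: csmooth_ext (csmoothD (sf i) IH) => p _; rewrite big_cons Pi.
by apply: csmooth_ext IH => p _; rewrite big_cons (negPf Pi).
Qed.

Lemma csmooth_prod (I : finType) (f : I -> E -> C) :
  (forall i, csmooth (f i)) -> csmooth (fun p => \prod_i f i p).
Proof.
move=> sf; elim: (index_enum I) => [|i s IH].
  by apply: csmooth_ext (csmooth_cst 1) => p _; rewrite big_nil.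
by apply: csmooth_ext (csmoothM (sf i) IH) => p _; rewrite big_cons.
Qed.

Variables p X : E.
Hypotheses (Mp : M p) (TX : T X).
Local Notation D f := (cderive f p X).

Lemma cderive_ext f g : (forall q, M q -> f q = g q) -> D f = D g.
Proof.
by move=> fg; congr Complex; apply: (derive_charted TM) => // q Mq; rewrite fg.
Qed.

Lemma cderive_cst c : D (fun=> c) = 0.
Proof. by rewrite /cderive !derive_cst. Qed.

Lemma cderiveD f g : csmooth f -> csmooth g -> D (fun q => f q + g q) = D f + D g.
Proof.
move=> [f1 f2] [g1 g2]; apply: complexP; rewrite ?Re_add ?Im_add /=.
  by under eq_fun do rewrite Re_add; exact: derive_smoothD.
by under eq_fun do rewrite Im_add; exact: derive_smoothD.
Qed.

Lemma cderiveM f g : csmooth f -> csmooth g ->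
  D (fun q => f q * g q) = D f * g p + f p * D g.
Proof.
move=> [f1 f2] [g1 g2].
apply: complexP; rewrite ?Re_add ?Im_add ?Re_mul ?Im_mul /=.
  under eq_fun do rewrite Re_mul.
  have [s1 s2] := (smoothM f1 g1, smoothM f2 g2).
  by rewrite derive_smoothD ?derive_smoothN ?derive_smoothM //;
    [ring | exact: smoothN].
under eq_fun do rewrite Im_mul.
have [s1 s2] := (smoothM f1 g2, smoothM f2 g1).
by rewrite derive_smoothD ?derive_smoothM //; ring.
Qed.

Lemma cderive_conj f : csmooth f -> D (fun q => Num.conj (f q)) = Num.conj (D f).
Proof.
move=> [f1 f2]; apply: complexP; rewrite ?Re_conjc ?Im_conjc /=.
  by under eq_fun do rewrite Re_conjc.
by under eq_fun do rewrite Im_conjc; exact: derive_smoothN.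
Qed.

Lemma cderive_sum (I : finType) (P : pred I) (f : I -> E -> C) :
  (forall i, csmooth (f i)) -> D (fun q => \sum_(i | P i) f i q) = \sum_(i | P i) D (f i).
Proof.
move=> sf.
(* Additivity of the derivative requires the partial sums to be smooth, so both claims go through
   one induction. *)
suff: csmooth (fun q => \sum_(i | P i) f i q) /\
  D (fun q => \sum_(i | P i) f i q) = \sum_(i | P i) D (f i) by case.
elim: (index_enum I) => [|i s [IH1 IH2]].
  split; first by apply: csmooth_ext (csmooth_cst 0) => q _; rewrite big_nil.
  rewrite [RHS]big_nil -[RHS](cderive_cst 0).
  by apply: cderive_ext => q _; rewrite big_nil.
rewrite [X in _ /\ _ = X]big_cons; case: ifP => Pi; last first.
  rewrite -IH2; split.
    by apply: csmooth_ext IH1 => q _; rewrite big_cons Pi.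
  by apply: cderive_ext => q _; rewrite big_cons Pi.
rewrite -IH2 -cderiveD //; split.
  by apply: csmooth_ext (csmoothD (sf i) IH1) => q _; rewrite big_cons Pi.
by apply: cderive_ext => q _; rewrite big_cons Pi.
Qed.

End Complex.

End ComplexMatrices.

(** * Matrix-valued functions *)

Section MatrixCalculus.
Local Open Scope classical_set_scope.
Variables (R : realType) (E : normedModType R) (T M : set E).
Hypothesis TM : charted T M.
Local Notation C := R[i].

Definition msmooth m n (F : E -> 'M[C]_(m, n)) :=
  forall i j, csmooth T M (fun p => F p i j).

Definition mderive m n (F : E -> 'M[C]_(m, n)) (p X : E) : 'M[C]_(m, n) :=
  \matrix_(i, j) cderive (fun q => F q i j) p X.

Section Closure.
Variables m n : nat.
Implicit Types F G : E -> 'M[C]_(m, n).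

Lemma msmooth_ext F G : (forall p, M p -> F p = G p) -> msmooth F -> msmooth G.
Proof. by move=> FG sF i j; apply: (csmooth_ext TM) (sF i j) => p /FG ->. Qed.

Lemma msmooth_cst A : msmooth (fun=> A : 'M_(m, n)).
Proof. by move=> i j; exact: csmooth_cst. Qed.

Lemma msmoothD F G : msmooth F -> msmooth G -> msmooth (fun p => F p + G p).
Proof.
by move=> sF sG i j; apply: (csmooth_ext TM) (csmoothD TM (sF i j) (sG i j)) => p _;
  rewrite !mxE.
Qed.

Lemma msmoothZ c F : msmooth F -> msmooth (fun p => c *: F p).
Proof.
move=> sF i j.
apply: (csmooth_ext TM) (csmoothM TM (csmooth_cst TM c) (sF i j)) => p _.
by rewrite !mxE.
Qed.

Lemma msmoothN F : msmooth F -> msmooth (fun p => - F p).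
Proof. by move=> /(msmoothZ (-1)); apply: msmooth_ext => p _; rewrite scaleN1r. Qed.

Lemma msmoothB F G : msmooth F -> msmooth G -> msmooth (fun p => F p - G p).
Proof. by move=> sF /msmoothN; exact: msmoothD. Qed.

Lemma msmooth_conj F : msmooth F -> msmooth (fun p => (F p)^cj).
Proof.
by move=> sF i j; apply: (csmooth_ext TM) (csmooth_conj TM (sF i j)) => p _;
  rewrite !mxE.
Qed.

Lemma msmooth_tr F : msmooth F -> msmooth (fun p => (F p)^T).
Proof.
by move=> sF i j; apply: (csmooth_ext TM) (sF j i) => p _; rewrite !mxE.
Qed.

Lemma msmoothM l F (G : E -> 'M_(n, l)) :
  msmooth F -> msmooth G -> msmooth (fun p => F p *m G p).
Proof.
move=> sF sG i j.
have sFG k : csmooth T M (fun p => F p i k * G p k j) by exact: csmoothM.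
by apply: (csmooth_ext TM) (csmooth_sum TM xpredT sFG) => p _; rewrite !mxE.
Qed.

End Closure.

Lemma csmooth_det n (F : E -> 'M[C]_n) : msmooth F -> csmooth T M (fun p => \det (F p)).
Proof.
move=> sF; apply: csmooth_sum => // s; apply: csmoothM => //.
  exact: csmooth_cst.
by apply: csmooth_prod => // i; exact: sF.
Qed.

(** On M the inverse has the entries cofactor over determinant, and the determinant does not vanish
    there. *)
Lemma msmoothV n (F : E -> 'M[C]_n) : (forall p, M p -> F p \in unitmx) ->
  msmooth F -> msmooth (fun p => invmx (F p)).
Proof.
move=> uF sF i j.
have d0 p : M p -> \det (F p) != 0 by move=> /uF; rewrite unitmxE unitfE.
have sdet := csmooth_det sF.
have sadj : csmooth T M (fun p => cofactor (F p) j i).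
  apply: csmoothM => //; first exact: csmooth_cst.
  apply: csmooth_det => k l.
  by apply: (csmooth_ext TM) (sF (lift j k) (lift i l)) => p _; rewrite !mxE.
apply: (csmooth_ext TM) (csmoothM TM (csmoothV TM d0 sdet) sadj) => p /uF Fp.
by rewrite /invmx Fp !mxE.
Qed.

Lemma csmooth_tr n (F : E -> 'M[C]_n) : msmooth F -> csmooth T M (fun p => \tr (F p)).
Proof. by move=> sF; apply: csmooth_sum => // i; exact: sF. Qed.

Section Derivation.
Variables p X : E.
Hypotheses (Mp : M p) (TX : T X).
Local Notation D F := (mderive F p X).

Section Rules.
Variables m n : nat.
Implicit Types F G : E -> 'M[C]_(m, n).

Lemma mderive_ext F G : (forall q, M q -> F q = G q) -> D F = D G.
Proof.
by move=> FG; apply/matrixP => i j; rewrite !mxE; apply: (cderive_ext TM) => // q /FG ->.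
Qed.

Lemma mderive_cst A : D (fun=> A : 'M_(m, n)) = 0.
Proof. by apply/matrixP => i j; rewrite !mxE cderive_cst. Qed.

Lemma mderiveD F G : msmooth F -> msmooth G -> D (fun q => F q + G q) = D F + D G.
Proof.
move=> sF sG; apply/matrixP => i j; rewrite !mxE -(cderiveD Mp TX (sF i j) (sG i j)).
by apply: (cderive_ext TM) => // q _; rewrite mxE.
Qed.

Lemma mderiveM l F (G : E -> 'M_(n, l)) : msmooth F -> msmooth G ->
  D (fun q => F q *m G q) = D F *m G p + F p *m D G.
Proof.
move=> sF sG; apply/matrixP => i j; rewrite !mxE.
have sFG k : csmooth T M (fun p => F p i k * G p k j) by exact: csmoothM.
transitivity (cderive (fun q => \sum_k F q i k * G q k j) p X).
  by apply: (cderive_ext TM) => // q _; rewrite mxE.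
rewrite (cderive_sum TM Mp TX xpredT sFG) -big_split; apply: eq_bigr => k _.
by rewrite (cderiveM TM Mp TX (sF i k) (sG k j)) !mxE.
Qed.

Lemma mderive_conj F : msmooth F -> D (fun q => (F q)^cj) = (D F)^cj.
Proof.
move=> sF; apply/matrixP => i j; rewrite !mxE -(cderive_conj Mp TX (sF i j)).
by apply: (cderive_ext TM) => // q _; rewrite mxE.
Qed.

Lemma mderive_tr F : D (fun q => (F q)^T) = (D F)^T.
Proof.
apply/matrixP => i j; rewrite !mxE.
by apply: (cderive_ext TM) => // q _; rewrite mxE.
Qed.

Lemma mderiveZ c F : msmooth F -> D (fun q => c *: F q) = c *: D F.
Proof.
move=> sF; apply/matrixP => i j; rewrite !mxE.
transitivity (cderive (fun q => c * F q i j) p X).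
  by apply: (cderive_ext TM) => // q _; rewrite mxE.
by rewrite (cderiveM TM Mp TX (csmooth_cst TM c) (sF i j)) cderive_cst mul0r add0r.
Qed.

Lemma mderiveN F : msmooth F -> D (fun q => - F q) = - D F.
Proof.
by move=> sF; rewrite -scaleN1r -mderiveZ//; apply: mderive_ext => q _; rewrite scaleN1r.
Qed.

Lemma mderiveB F G : msmooth F -> msmooth G -> D (fun q => F q - G q) = D F - D G.
Proof. by move=> sF sG; rewrite mderiveD ?mderiveN//; exact: msmoothN. Qed.

End Rules.

(** Obtained by differentiating [F *m invmx F = 1]. *)
Lemma mderiveV n (F : E -> 'M[C]_n) : (forall q, M q -> F q \in unitmx) ->
  msmooth F -> D (fun q => invmx (F q)) = - (invmx (F p) *m D F *m invmx (F p)).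
Proof.
move=> uF sF; have sV := msmoothV uF sF.
have : D (fun q => F q *m invmx (F q)) = 0.
  by rewrite -(mderive_cst 1%:M); apply: mderive_ext => q /uF; exact: mulmxV.
rewrite mderiveM// addrC => /(canRL (addrK _)); rewrite sub0r => /(congr1 (mulmx (invmx (F p)))).
by rewrite mulmxA mulVmx ?uF// mul1mx mulmxN mulmxA.
Qed.

Lemma mderive_affl m n l (A : 'M[C]_(m, n)) (B : 'M[C]_(m, l)) (F : E -> 'M_(n, l)) :
  msmooth F -> D (fun q => A *m F q + B) = A *m D F.
Proof.
move=> sF; have sA : msmooth (fun=> A) by exact: msmooth_cst.
have sB : msmooth (fun=> B) by exact: msmooth_cst.
by rewrite mderiveD ?mderiveM ?mderive_cst ?mul0mx ?add0r ?addr0 //; exact: msmoothM.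
Qed.

Lemma mderive_affr m n l (A : 'M[C]_(n, l)) (B : 'M[C]_(m, l)) (F : E -> 'M_(m, n)) :
  msmooth F -> D (fun q => F q *m A + B) = D F *m A.
Proof.
move=> sF; have sA : msmooth (fun=> A) by exact: msmooth_cst.
have sB : msmooth (fun=> B) by exact: msmooth_cst.
by rewrite mderiveD ?mderiveM ?mderive_cst ?mulmx0 ?add0r ?addr0 //; exact: msmoothM.
Qed.

Lemma mderive_fracr m n (F : E -> 'M[C]_(m, n)) (G : E -> 'M[C]_n) :
  (forall q, M q -> G q \in unitmx) -> msmooth F -> msmooth G ->
  D (fun q => F q *m invmx (G q)) = (D F - F p *m invmx (G p) *m D G) *m invmx (G p).
Proof.
move=> uG sF sG; have sV := msmoothV uG sG.
by rewrite mderiveM // mderiveV // mulmxBl mulmxN !mulmxA.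
Qed.

Lemma mderive_fracl m n (F : E -> 'M[C]_(m, n)) (G : E -> 'M[C]_m) :
  (forall q, M q -> G q \in unitmx) -> msmooth F -> msmooth G ->
  D (fun q => invmx (G q) *m F q) = invmx (G p) *m (D F - D G *m (invmx (G p) *m F p)).
Proof.
move=> uG sF sG; have sV := msmoothV uG sG.
by rewrite mderiveM // mderiveV // mulmxBr mulNmx !mulmxA addrC.
Qed.

Lemma cderive_tr n (F : E -> 'M[C]_n) : msmooth F ->
  cderive (fun q => \tr (F q)) p X = \tr (D F).
Proof.
by move=> sF; rewrite /mxtrace (cderive_sum TM)//; apply: eq_bigr => i _; rewrite mxE.
Qed.

End Derivation.

End MatrixCalculus.

(** * Maps into pairs of matrices *)

Section VectorValued.
Local Open Scope classical_set_scope.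
Variables (R : realType) (E : normedModType R) (T M : set E).
Hypothesis TM : charted T M.

Lemma is_derive_pair (F G : normedModType R) (f : E -> F) (g : E -> G) p X :
  derivable f p X -> derivable g p X ->
  derivable (fun q => (f q, g q)) p X /\
  'D_X (fun q => (f q, g q)) p = ('D_X f p, 'D_X g p).
Proof.
move=> df dg.
suff cv : h^-1 *: (((fun q => (f q, g q)) \o shift p) (h *: X) - (f p, g p))
    @[h --> (0 : R)^'] --> ('D_X f p, 'D_X g p).
  by split; [apply/cvg_ex; eexists; exact: cv | exact/cvg_lim].
exact: cvg_pair df dg.
Qed.

Lemma Ck_on_pair (F G : normedModType R) k (f : E -> F) (g : E -> G) :
  Ck_on T M k f -> Ck_on T M k g -> Ck_on T M k (fun p => (f p, g p)).
Proof.
elim: k f g => [|k IH] f g [/within_cont cf Df] [/within_cont cg Dg].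
all: split; first by apply/within_cont => p Mp; exact: cvg_pair (cf p Mp) (cg p Mp).
  by [].
move=> X TX; have [df Ckf] := Df X TX; have [dg Ckg] := Dg X TX; split.
  by move=> p Mp; have [] := is_derive_pair (df p Mp) (dg p Mp).
apply: (Ck_on_ext TM) (IH _ _ Ckf Ckg) => p Mp.
by have [_ ->] := is_derive_pair (df p Mp) (dg p Mp).
Qed.

Lemma Ck_on_mx m n k (F : E -> 'M[R]_(m, n)) :
  (forall i j, Ck_on T M k (fun p => F p i j)) -> Ck_on T M k F.
Proof.
have wc (G : E -> 'M[R]_(m, n)) : (forall i j, {within M, continuous (fun p => G p i j)}) ->
    {within M, continuous G}.
  move=> cG; apply/within_cont => p Mp; apply/cvgrPdist_le => /= e e0.
  near=> x.
  rewrite /Num.Def.normr/= mx_normrE (bigmax_le _ (ltW e0))//= => i _.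
  rewrite !mxE/=; move: i; near: x; apply: filter_forall => /= i.
  by have /within_cont/(_ p Mp)/cvgrPdist_le := cG i.1 i.2; apply.
elim: k F => [|k IH] F CF.
  by split => //; apply: wc => i j; have [] := CF i j.
split; first by apply: wc => i j; have [] := CF i j.
move=> X TX.
have dF p : M p -> derivable F p X.
  by move=> Mp; apply/derivable_mxP => i j; have [_ /(_ X TX)[]] := CF i j; auto.
split=> //; apply: IH => i j; have [_ /(_ X TX)[_]] := CF i j.
by apply: (Ck_on_ext TM) => p Mp; rewrite derive_mx ?mxE//; exact: dF.
Unshelve. all: by end_near. Qed.

Variable n : nat.
Local Notation C := R[i].

Lemma smooth_mkpoint (S : E -> 'M[C]_n) (a : E -> 'cV[C]_n) :
  msmooth T M S -> msmooth T M a -> smooth_on T M (fun p => mkpoint (S p) (a p)).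
Proof.
have smx m l (F : E -> 'M[C]_(m, l)) k : msmooth T M F ->
    Ck_on T M k (fun p => map_mx (@complex.Re R) (F p)) /\
    Ck_on T M k (fun p => map_mx (@complex.Im R) (F p)).
  move=> sF; split; apply: Ck_on_mx => i j; have [sRe sIm] := sF i j.
    by apply: (Ck_on_ext TM) (sRe k) => p _; rewrite mxE.
  by apply: (Ck_on_ext TM) (sIm k) => p _; rewrite mxE.
move=> sS sa k; have [S1 S2] := smx _ _ _ k sS; have [a1 a2] := smx _ _ _ k sa.
by apply: Ck_on_pair; exact: Ck_on_pair.
Qed.

Lemma derive_mkpoint (S : E -> 'M[C]_n) (a : E -> 'cV[C]_n) p X :
  msmooth T M S -> msmooth T M a -> M p -> T X ->
  'D_X (fun q => mkpoint (S q) (a q)) p = mkpoint (mderive S p X) (mderive a p X).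
Proof.
move=> sS sa Mp TX.
have dmx m l (F : E -> 'M[C]_(m, l)) : msmooth T M F ->
  (derivable (fun q => map_mx (@complex.Re R) (F q)) p X /\
   'D_X (fun q => map_mx (@complex.Re R) (F q)) p = map_mx (@complex.Re R) (mderive F p X)) /\
  (derivable (fun q => map_mx (@complex.Im R) (F q)) p X /\
   'D_X (fun q => map_mx (@complex.Im R) (F q)) p = map_mx (@complex.Im R) (mderive F p X)).
  move=> sF.
  have dRe : derivable (fun q => map_mx (@complex.Re R) (F q)) p X.
    apply/derivable_mxP => i j.
    apply: (derivable_charted TM) (smooth_derivable (proj1 (sF i j)) Mp TX) => // q _.
    by rewrite mxE.
  have dIm : derivable (fun q => map_mx (@complex.Im R) (F q)) p X.
    apply/derivable_mxP => i j.
    apply: (derivable_charted TM) (smooth_derivable (proj2 (sF i j)) Mp TX) => // q _.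
    by rewrite mxE.
  split; split; [exact: dRe| |exact: dIm|].
    rewrite (derive_mx dRe); apply/matrixP => i j; rewrite !mxE /=.
    by apply: (derive_charted TM) => // q _; rewrite mxE.
  rewrite (derive_mx dIm); apply/matrixP => i j; rewrite !mxE /=.
  by apply: (derive_charted TM) => // q _; rewrite mxE.
have [[d1 e1] [d2 e2]] := dmx _ _ _ sS; have [[d3 e3] [d4 e4]] := dmx _ _ _ sa.
have [d12 e12] := is_derive_pair d1 d2; have [d34 e34] := is_derive_pair d3 d4.
by have [_ ->] := is_derive_pair d12 d34; rewrite e12 e34 e1 e2 e3 e4.
Qed.

End VectorValued.

(** * The coordinate functions of a point *)

Section CoordinateMaps.
Local Open Scope classical_set_scope.
Variables (R : realType) (n : nat).
Local Notation E := (coords R n).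
Local Notation C := R[i].
Variables (T M : set E).
Hypothesis TM : charted T M.

Lemma mkpointK (x : E) : mkpoint (matpart x) (vecpart x) = x.
Proof.
case: x => [[a b] [c d]]; congr (_, _, (_, _)); apply/matrixP => i j; by rewrite !mxE.
Qed.

Lemma matpart_mk (S : 'M[C]_n) (a : 'cV[C]_n) : matpart (mkpoint S a) = S.
Proof. by apply/matrixP => i j; rewrite !mxE; case: (S i j). Qed.

Lemma vecpart_mk (S : 'M[C]_n) (a : 'cV[C]_n) : vecpart (mkpoint S a) = a.
Proof. by apply/matrixP => i j; rewrite !mxE; case: (a i j). Qed.

Lemma pt_eq (x y : E) : matpart x = matpart y -> vecpart x = vecpart y -> x = y.
Proof. by move=> e1 e2; rewrite -(mkpointK x) -(mkpointK y) e1 e2. Qed.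

Lemma matpart_lin (a : R) (X Y : E) :
  matpart (a *: X + Y) = a%:C%C *: matpart X + matpart Y.
Proof.
case: X Y => [[X1 X2] X3] [[Y1 Y2] Y3]; apply/matrixP => i j; rewrite !mxE /=.
by apply: complexP => /=; ring.
Qed.

Lemma vecpart_lin (a : R) (X Y : E) :
  vecpart (a *: X + Y) = a%:C%C *: vecpart X + vecpart Y.
Proof.
case: X Y => [X3 [X1 X2]] [Y3 [Y1 Y2]]; apply/matrixP => i j; rewrite !mxE /=.
by apply: complexP => /=; ring.
Qed.

Lemma matpart_charted : msmooth T M (@matpart R n) /\
  (forall p X, M p -> T X -> mderive (@matpart R n) p X = matpart X).
Proof.
have co i j : continuous (fun x : E => x.1.1 i j) /\ continuous (fun x : E => x.1.2 i j).
  split=> x.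
    apply: (cvg_comp (fun x : E => x.1.1) (fun A => A i j) (G := nbhs x.1.1)).
      apply: (cvg_comp (fun x : E => x.1) (fun A => A.1) (G := nbhs x.1)).
        exact: cvg_fst.
      exact: cvg_fst.
    exact: coord_continuous.
  apply: (cvg_comp (fun x : E => x.1.2) (fun A => A i j) (G := nbhs x.1.2)).
    apply: (cvg_comp (fun x : E => x.1) (fun A => A.2) (G := nbhs x.1)).
      exact: cvg_fst.
    exact: cvg_snd.
  exact: coord_continuous.
have l1 i j a (X Y : E) : (a *: X + Y).1.1 i j = a *: X.1.1 i j + Y.1.1 i j.
  by rewrite !mxE.
have l2 i j a (X Y : E) : (a *: X + Y).1.2 i j = a *: X.1.2 i j + Y.1.2 i j.
  by rewrite !mxE.
split=> [i j|p X Mp TX].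
  have [c1 c2] := co i j; split.
    by apply: (smooth_ext TM) (fun k => Ck_on_linear TM k (l1 i j) c1) => p _; rewrite mxE.
  by apply: (smooth_ext TM) (fun k => Ck_on_linear TM k (l2 i j) c2) => p _; rewrite mxE.
apply/matrixP => i j; rewrite !mxE; congr Complex.
  under eq_fun do rewrite mxE /=.
  by rewrite (proj2 (derivable_linear p X (l1 i j))).
under eq_fun do rewrite mxE /=.
by rewrite (proj2 (derivable_linear p X (l2 i j))).
Qed.

Lemma vecpart_charted : msmooth T M (@vecpart R n) /\
  (forall p X, M p -> T X -> mderive (@vecpart R n) p X = vecpart X).
Proof.
have co i j : continuous (fun x : E => x.2.1 i j) /\ continuous (fun x : E => x.2.2 i j).
  split=> x.
    apply: (cvg_comp (fun x : E => x.2.1) (fun A => A i j) (G := nbhs x.2.1)).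
      apply: (cvg_comp (fun x : E => x.2) (fun A => A.1) (G := nbhs x.2)).
        exact: cvg_snd.
      exact: cvg_fst.
    exact: coord_continuous.
  apply: (cvg_comp (fun x : E => x.2.2) (fun A => A i j) (G := nbhs x.2.2)).
    apply: (cvg_comp (fun x : E => x.2) (fun A => A.2) (G := nbhs x.2)).
      exact: cvg_snd.
    exact: cvg_snd.
  exact: coord_continuous.
have l1 i j a (X Y : E) : (a *: X + Y).2.1 i j = a *: X.2.1 i j + Y.2.1 i j.
  by rewrite !mxE.
have l2 i j a (X Y : E) : (a *: X + Y).2.2 i j = a *: X.2.2 i j + Y.2.2 i j.
  by rewrite !mxE.
split=> [i j|p X Mp TX].
  have [c1 c2] := co i j; split.
    by apply: (smooth_ext TM) (fun k => Ck_on_linear TM k (l1 i j) c1) => p _; rewrite mxE.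
  by apply: (smooth_ext TM) (fun k => Ck_on_linear TM k (l2 i j) c2) => p _; rewrite mxE.
apply/matrixP => i j; rewrite !mxE; congr Complex.
  under eq_fun do rewrite mxE /=.
  by rewrite (proj2 (derivable_linear p X (l1 i j))).
under eq_fun do rewrite mxE /=.
by rewrite (proj2 (derivable_linear p X (l2 i j))).
Qed.

End CoordinateMaps.

(** * Real matrices inside complex ones *)

Section ComplexPositive.
Local Open Scope classical_set_scope.
Variable R : realType.
Local Notation C := R[i].

Definition rmx m n (r : 'M[R]_(m, n)) : 'M[C]_(m, n) := map_mx (real_complex R) r.

Lemma conj_rmx m n (r : 'M[R]_(m, n)) : (rmx r)^cj = rmx r.
Proof. by apply/matrixP => i j; rewrite !mxE; apply: complexP; rewrite /= ?oppr0. Qed.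

Lemma rmx_mul m n p (A : 'M[R]_(m, n)) (B : 'M_(n, p)) : rmx (A *m B) = rmx A *m rmx B.
Proof. exact: map_mxM. Qed.
Lemma rmx_add m n (A B : 'M[R]_(m, n)) : rmx (A + B) = rmx A + rmx B.
Proof. exact: map_mxD. Qed.
Lemma rmx_tr m n (A : 'M[R]_(m, n)) : rmx A^T = (rmx A)^T.
Proof. by rewrite /rmx map_trmx. Qed.
Lemma rmx_inv n (A : 'M[R]_n) : rmx (invmx A) = invmx (rmx A).
Proof. exact: map_invmx. Qed.
Lemma rmx1 n : rmx (1%:M : 'M_n) = 1%:M.
Proof. exact: map_mx1. Qed.
Lemma rmx0 m n : rmx (0 : 'M_(m, n)) = 0.
Proof. exact: map_mx0. Qed.
Lemma conj_i : Num.conj ('i%C : C) = - 'i%C.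
Proof. by apply: complexP; rewrite /= ?oppr0. Qed.
Lemma mul_ii : 'i%C * 'i%C = -1 :> C.
Proof. by apply: complexP => /=; ring. Qed.

Lemma cplxmxE m n (a b : 'M[R]_(m, n)) : cplxmx a b = rmx a + 'i%C *: rmx b.
Proof.
apply/matrixP => i j; rewrite !mxE.
by apply: complexP; rewrite ?Re_add ?Im_add ?Re_mul ?Im_mul /=; ring.
Qed.

Lemma cplxmxK m n (A : 'M[C]_(m, n)) :
  A = cplxmx (map_mx (@complex.Re R) A) (map_mx (@complex.Im R) A).
Proof. by apply/matrixP => i j; rewrite !mxE; case: (A i j). Qed.

Lemma posdefR_C n (r : 'M[R]_n) : r^T = r -> posdefR r <-> posdefC (rmx r).
Proof.
move=> sr; split=> [pr x x0|pr x x0].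
  set a := map_mx (@complex.Re R) x; set b := map_mx (@complex.Im R) x.
  have ex : x = rmx a + 'i%C *: rmx b by rewrite -cplxmxE -cplxmxK.
  have -> : (x^adj *m rmx r *m x) 0 0 = ((a^T *m r *m a + b^T *m r *m b) 0 0)%:C%C.
    transitivity ((rmx (a^T *m r *m a + b^T *m r *m b)) 0 0); last by rewrite mxE.
    congr (fun_of_matrix _ 0 0); rewrite rmx_add !rmx_mul !rmx_tr ex.
    by apply: quad_real; rewrite ?conj_rmx -?rmx_tr ?sr //; [exact: mul_ii|exact: conj_i].
  rewrite ltcR mxE.
  have nn (c : 'cV[R]_n) : 0 <= (c^T *m r *m c) 0 0.
    by have [->|/pr/ltW//] := eqVneq c 0; rewrite mulmx0 mxE.
  have [a0|/pr a0] := eqVneq a 0; last by rewrite ltr_wpDr.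
  rewrite ltr_wpDl// pr//; apply: contraNneq x0 => b0.
  by rewrite ex a0 b0 !rmx0 scaler0 addr0.
have := pr (rmx x).
have -> : rmx x != 0 by apply: contraNneq x0 => /matrixP e; apply/eqP/matrixP => i j;
  have := e i j; rewrite !mxE => -[].
move=> /(_ isT); rewrite conj_rmx -ltcR; congr (_ < _).
by rewrite -rmx_tr -!rmx_mul mxE.
Qed.

End ComplexPositive.

(** * Openness of the positive definite condition *)

Section Openness.
Local Open Scope classical_set_scope.
Variables (R : realType) (E : normedModType R) (n : nat).
Local Notation C := R[i].

Lemma chartedT : charted (R := R) (E := E) setT setT.
Proof. by split=> //; exists setT; [exact: openT|rewrite setIT]. Qed.

Lemma norm_Re_Im (x : C) (e : R) : `|complex.Re x| < e / 2 -> `|complex.Im x| < e / 2 ->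
  `|x| <= e%:C%C.
Proof.
move=> xr xi; rewrite [x]complexE (le_trans (ler_normD _ _))//.
have nR (a : R) : `|a%:C%C| = `|a|%:C%C.
  by rewrite normc_def /= expr0n addr0 sqrtr_sqr.
have nI : `|'i%C : C| = 1 by rewrite normc_def /= expr0n expr1n add0r sqrtr1.
rewrite normrM nI mul1r !nR -rmorphD lecR.
by apply: ltW; rewrite (splitr e) ltrD.
Qed.

(** A congruence normalizes [F y0] to the identity. Nearby, the normalized matrix differs from the
    identity by small entries, so its form stays within a factor less than 1 of the squared norm. *)
Lemma open_posdefC (F : E -> 'M[C]_n) : msmooth setT setT F ->
  (forall y, (F y)^adj = F y) -> open [set y | posdefC (F y)].
Proof.
move=> sF hF; rewrite openE => y0 /= pF.
have [L uL eL] := posdef_cholesky (hF y0) pF.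
pose P := invmx L; pose G y := P *m F y *m P^adj - 1%:M.
have uP : P \in unitmx by rewrite unitmx_inv.
have uPa : P^adj \in unitmx by rewrite unitmx_tr conj_unit.
have G0 : G y0 = 0.
  by rewrite /G eL /P !mulmxA mulVmx// mul1mx !conjE tr_inv mulmxV ?subrr// unitmx_tr conj_unit.
have sG : msmooth setT setT G.
  have T := chartedT.
  apply: msmoothB => //; last exact: msmooth_cst.
  by apply: msmoothM => //; [apply: msmoothM|] => //; exact: msmooth_cst.
(* The form of an n by n matrix with entries bounded by e is at most [e * n] times the squared norm;
   taking [n.+1] makes [e * n < 1], also for n = 0. *)
pose e : R := n.+1%:R^-1.
have e0 : 0 < e by rewrite invr_gt0.
have small : \forall y \near y0, forall ij : 'I_n * 'I_n, `|G y ij.1 ij.2| <= e%:C%C.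
  apply: filter_forall => -[i j] /=.
  have near0 (f : E -> R) : smooth_on setT setT f -> f y0 = 0 ->
      \forall y \near y0, `|f y| < e / 2.
    move=> /(_ 0%N)[/within_cont/(_ y0 I) cf _] f0.
    move/cvgrPdist_lt/(_ (e / 2)) : cf; rewrite divr_gt0// f0 => /(_ isT).
    by rewrite near_withinE; apply: filterS => y /(_ I); rewrite sub0r normrN.
  have [s1 s2] := sG i j.
  have n1 := near0 _ s1; have n2 := near0 _ s2.
  rewrite G0 mxE /= in n1 n2.
  apply: filterS2 (n1 erefl) (n2 erefl) => y; exact: norm_Re_Im.
apply: filterS small => y small /= x x0.
have [w w0 ex] : exists2 w, w != 0 & x = P^adj *m w.
  exists (invmx P^adj *m x); last by rewrite mulKVmx.
  by apply: contraNneq x0 => w0; rewrite -(mulKVmx uPa x) w0 mulmx0.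
set z := (_ *m _ *m _) 0 0.
pose s : C := \sum_i `|w i 0| ^+ 2.
have s0 : 0 < s.
  rewrite lt_def sumr_ge0 => [|i _]; last by rewrite exprn_ge0.
  rewrite andbT; apply: contraNneq w0 => /eqP; rewrite psumr_eq0 => [/allP h|i _]; last first.
    by rewrite exprn_ge0.
  apply/eqP/matrixP => i j; rewrite ord1 mxE; apply/eqP.
  by have /= := h i (mem_index_enum i); rewrite sqrf_eq0 normr_eq0.
have zE : z - s = (w^adj *m G y *m w) 0 0.
  rewrite /G mulmxBr mulmxBl mulmx1 [RHS]mxE [X in _ = _ + X]mxE.
  congr (_ - _).
    by rewrite /z ex !conjE trmx_mul trmxK !mulmxA.
  by rewrite /s mxE; apply: eq_bigr => i _; rewrite !mxE normCK mulrC.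
have zr : z \is Num.real.
  apply/CrealP; rewrite /z.
  transitivity (((x^adj *m F y *m x)^adj) 0 0); first by rewrite !mxE.
  by rewrite !conjE !trE hF mulmxA.
have sr : s \is Num.real by rewrite ger0_real ?ltW.
(* Both numbers are real, z because F is Hermitian, so this distance bound forces z to be
   positive. *)
suff : `|z - s| < s by rewrite real_ltr_norml ?realB// ltrBrDr addNr => /andP[].
have -> : z - s = \sum_i \sum_j Num.conj (w i 0) * G y i j * w j 0.
  rewrite zE mxE exchange_big; apply: eq_bigr => j _.
  by rewrite mxE mulr_suml; apply: eq_bigr => i _; rewrite !mxE.
have le2 i j : `|Num.conj (w i 0) * G y i j * w j 0| <=
    e%:C%C * ((`|w i 0| ^+ 2 + `|w j 0| ^+ 2) / 2).
  rewrite !normrM norm_conjC mulrAC mulrC ler_pM ?mulr_ge0//.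
    exact: (small (i, j)).
  rewrite ler_pdivlMr// -subr_ge0.
  have -> : `|w i 0| ^+ 2 + `|w j 0| ^+ 2 - `|w i 0| * `|w j 0| * 2 =
    (`|w i 0| - `|w j 0|) ^+ 2 by ring.
  by rewrite real_exprn_even_ge0// realB.
apply: (@le_lt_trans _ _ (\sum_i \sum_j e%:C%C * ((`|w i 0| ^+ 2 + `|w j 0| ^+ 2) / 2))).
  apply: le_trans (ler_norm_sum _ _ _) _; apply: ler_sum => i _.
  by apply: le_trans (ler_norm_sum _ _ _) _; apply: ler_sum.
have -> : \sum_i \sum_j e%:C%C * ((`|w i 0| ^+ 2 + `|w j 0| ^+ 2) / 2) =
    e%:C%C * n%:R * s.
  transitivity (e%:C%C / 2 * (\sum_(i < n) \sum_(j < n) `|w i 0| ^+ 2 +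
      \sum_(i < n) \sum_(j < n) `|w j 0| ^+ 2)).
    rewrite -big_split mulr_sumr; apply: eq_bigr => i _.
    by rewrite -big_split mulr_sumr; apply: eq_bigr => j _; rewrite mulrA mulrAC.
  rewrite [X in _ + X]exchange_big /= -/s.
  have -> : \sum_(i < n) \sum_(j < n) `|w i 0| ^+ 2 = n%:R * s.
    by rewrite mulr_sumr; apply: eq_bigr => i _; rewrite sumr_const card_ord mulr_natl.
  by field.
rewrite -[ltRHS]mul1r ltr_pM2r//.
have -> : n%:R = (n%:R)%:C%C :> C by rewrite rmorph_nat.
by rewrite -rmorphM -(rmorph1 (real_complex R)) ltcR mulrC ltr_pdivrMr// mul1r ltr_nat.
Qed.

End Openness.

(** * Hermitian forms and Kähler forms *)

Section HermitianForms.
Local Open Scope classical_set_scope.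
Variables (R : realType) (E : normedModType R) (T : set E) (J : E -> E) (M : set E).
Local Notation C := R[i].

Lemma charted_domain : complex_domain T J M -> charted T M.
Proof. by case. Qed.

(* The symmetry of [t] in its first two arguments says that the (2,1)-part of
   [d omega] vanishes; the (1,2)-part is its conjugate. *)
Lemma hermitian_kahler (omega h : E -> E -> E -> C) (t : E -> E -> E -> E -> C) :
  complex_domain T J M ->
  (forall p X Y, M p -> T X -> T Y -> omega p X Y = 'i%C * (h p X Y - h p Y X)) ->
  (forall p a X Y Z, M p -> T X -> T Y -> T Z ->
     h p (a *: X + Y) Z = a%:C%C * h p X Z + h p Y Z) ->
  (forall p X Y, M p -> T X -> T Y -> h p Y X = Num.conj (h p X Y)) ->
  (forall p X Y, M p -> T X -> T Y -> h p (J X) Y = 'i%C * h p X Y) ->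
  (forall p X, M p -> T X -> X != 0 -> 0 < h p X X) ->
  (forall X Y, T X -> T Y -> csmooth T M (fun p => h p X Y)) ->
  (forall p X Y Z, M p -> T X -> T Y -> T Z ->
     cderive (fun q => h q Y Z) p X = t p X Y Z + Num.conj (t p X Z Y)) ->
  (forall p X Y Z, M p -> T X -> T Y -> T Z -> t p X Y Z = t p Y X Z) ->
  kahler_form T J M omega.
Proof.
move=> dom omegaE hlin hconj hJ hpos hsm hder tsym.
have TM := charted_domain dom; have JT := cplxstr_tangent dom.
have Tlin := tangent_lin dom.
have hJr p X Y : M p -> T X -> T Y -> h p X (J Y) = - 'i%C * h p X Y.
  move=> Mp TX TY; rewrite (hconj p (J Y) X)//; last exact: JT.
  by rewrite hJ// rmorphM /= -hconj//; congr (_ * _); exact: conj_i.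
split.
- move=> p X Y Mp TX TY; rewrite omegaE// (hconj p X Y Mp TX TY).
  by rewrite Im_mul Re_add Re_opp Re_conjc subrr /= mul0r mul1r add0r.
- move=> p a X Y Z Mp TX TY TZ; have TXY := Tlin a X Y TX TY.
  rewrite !omegaE// hlin// (hconj p _ Z Mp TXY TZ) hlin//.
  rewrite rmorphD rmorphM /= -!hconj//.
  have -> : Num.conj (a%:C%C : C) = a%:C%C by apply: complexP; rewrite /= ?oppr0.
  by ring.
- by move=> p X Y Mp TX TY; rewrite !omegaE//; ring.
- move=> X Y TX TY.
  have s : csmooth T M (fun p => 'i%C * (h p X Y + -1 * h p Y X)).
    apply: (csmoothM TM); first exact: csmooth_cst.
    apply: (csmoothD TM); first exact: hsm.
    by apply: (csmoothM TM); [exact: csmooth_cst | exact: hsm].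
  by case: s => + _; apply: (smooth_ext TM) => p Mp; rewrite omegaE// mulN1r.
- move=> p X Y Z Mp TX TY TZ.
  have d A B D : T A -> T B -> T D -> 'D_A (fun x => complex.Re (omega x B D) : R) p =
      complex.Re ('i%C * (t p A B D + Num.conj (t p A D B) -
                          (t p A D B + Num.conj (t p A B D)))).
    move=> TA TB TD.
    rewrite (derive_charted TM (g := fun x => complex.Re ('i%C * (h x B D + -1 * h x D B))))//.
      transitivity (complex.Re (cderive (fun x => 'i%C * (h x B D + -1 * h x D B)) p A)).
        by [].
      have s1 : csmooth T M (fun p => -1 * h p D B).
        by apply: (csmoothM TM); [exact: csmooth_cst | exact: hsm].
      have s2 := csmoothD TM (hsm _ _ TB TD) s1.
      rewrite (cderiveM TM Mp TA (csmooth_cst TM 'i%C) s2) cderive_cst mul0r add0r.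
      rewrite (cderiveD Mp TA (hsm _ _ TB TD) s1).
      rewrite (cderiveM TM Mp TA (csmooth_cst TM (-1)) (hsm _ _ TD TB)) cderive_cst mul0r add0r.
      by rewrite !hder// mulN1r.
    by move=> q Mq; rewrite omegaE// mulN1r.
  rewrite !d// -Re_opp -!Re_add -[RHS]/(complex.Re (0 : C)); congr complex.Re.
  by rewrite (tsym p Y X Z)// (tsym p Z X Y)// (tsym p Z Y X)//; ring.
- move=> p X Y Mp TX TY; have [TJX TJY] := (JT _ TX, JT _ TY).
  by rewrite !omegaE// !hJ// !hJr// !mulrA mulrN mul_ii opprK !mul1r.
- move=> p X Mp TX X0; have TJX := JT _ TX.
  rewrite omegaE// hJ// hJr// mulNr -opprD mulrN -mulrDr -mulr2n mulrA mul_ii mulN1r opprK.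
  by rewrite mulrn_wgt0// hpos.
Qed.

Lemma homogeneous_from_base (omega : E -> E -> E -> C) (gT : Type) (G : set gT) mul one inv act o :
  complex_domain T J M -> kahler_form T J M omega -> group_on G mul one inv ->
  (forall p, M p -> act one p = p) ->
  (forall g h p, G g -> G h -> M p -> act (mul g h) p = act g (act h p)) ->
  (forall g, G g -> holomorphic_isometry T J M omega (act g)) ->
  M o -> (forall p, M p -> exists2 g, G g & act g o = p) ->
  homogeneous_kahler T J M omega G mul one inv act.
Proof.
move=> dom form grp act1 actM isom Mo trans; split => // p q Mp Mq.
have [g Gg gp] := trans p Mp; have [h Gh hq] := trans q Mq.
have Gi := group_inv grp Gg; exists (mul h (inv g)); first exact: (group_mul grp).
by rewrite actM// -gp -(actM (inv g) g)// (group_mulV grp)// act1.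
Qed.

End HermitianForms.

Section Coordinates.
Local Open Scope classical_set_scope.
Variables (R : realType) (n : nat).
Local Notation E := (coords R n).
Local Notation C := R[i].
Local Notation T := (@sym_tangent R n).
Local Notation J := (@mulI R n).

Lemma matpart_mulI (X : E) : matpart (J X) = 'i%C *: matpart X.
Proof. exact: matpart_mk. Qed.
Lemma vecpart_mulI (X : E) : vecpart (J X) = 'i%C *: vecpart X.
Proof. exact: vecpart_mk. Qed.

(** [F] must be smooth and Hermitian on the whole coordinate space, also where the matrix part is
    not symmetric, because the set claimed open lies in that space. *)
Lemma coords_domain (F : E -> 'M[C]_n) (M : set E) : msmooth setT setT F ->
  (forall y, (F y)^adj = F y) -> (forall x, M x <-> T x /\ posdefC (F x)) ->
  complex_domain T J M.
Proof.
move=> sF hF MF; split.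
- rewrite /sym_tangent /=; have := matpart_lin (-1) (0 : E) 0.
  rewrite scaler0 addr0 => ->.
  have -> : (-1)%:C%C = -1 :> C by apply: complexP; rewrite /= ?oppr0.
  by rewrite scaleN1r addNr trmx0.
- by move=> a X Y; rewrite /sym_tangent /= !matpart_lin !trE => -> ->.
- move=> a X Y; apply: pt_eq; rewrite ?matpart_lin ?vecpart_lin ?matpart_mulI ?vecpart_mulI.
    by rewrite matpart_lin scalerDr !scalerA mulrC.
  by rewrite vecpart_lin scalerDr !scalerA mulrC.
- move=> X; have e (a : E) : - a = (-1) *: a + 0 by rewrite scaleN1r addr0.
  have m1 : (-1)%:C%C = -1 :> C by apply: complexP; rewrite /= ?oppr0.
  have matN : matpart (- X) = - matpart X.
    by apply/matrixP => i j; rewrite !mxE; apply: complexP.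
  have vecN : vecpart (- X) = - vecpart X.
    by apply/matrixP => i j; rewrite !mxE; apply: complexP.
  apply: pt_eq; rewrite ?matpart_mulI ?vecpart_mulI ?matN ?vecN.
    by rewrite scalerA mul_ii scaleN1r.
  by rewrite scalerA mul_ii scaleN1r.
- by move=> X; rewrite /sym_tangent /= matpart_mulI !trE => ->.
- exists [set y | posdefC (F y)]; first exact: open_posdefC.
  by apply/seteqP; split=> x; [move/MF | move=> h; apply/MF].
Qed.

End Coordinates.

(** * The Siegel-Jacobi ball *)

Ltac msm TM := repeat first
  [ assumption
  | exact: (proj1 (matpart_charted TM))
  | exact: (proj1 (vecpart_charted TM))
  | apply: (msmooth_cst TM)
  | apply: (msmoothB TM) | apply: (msmoothD TM) | apply: (msmoothN TM)
  | apply: (msmoothM TM) | apply: (msmoothZ TM)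
  | apply: (msmooth_conj TM) | apply: (msmooth_tr TM) ].

Section Ball.
Local Open Scope classical_set_scope.
Variables (R : realType) (n : nat).
Local Notation E := (coords R n).
Local Notation C := R[i].
Local Notation T := (@sym_tangent R n).
Local Notation J := (@mulI R n).
Local Notation M := (@siegel_jacobi_ball R n).

Lemma ball_domain : complex_domain T J M.
Proof.
have TT := @chartedT R E.
(* The adjoint makes this Hermitian for every W; on symmetric W it agrees with [1 - W W^cj]. *)
apply: (@coords_domain _ _ (fun x : E => 1%:M - matpart x *m (matpart x)^adj)).
- by msm TT.
- move=> y; rewrite conj_add conj_opp conj_one conj_mul conj_tr conj_K.
  by rewrite tr_add tr_opp trmx1 trmx_mul trmxK.
- move=> x; have e : (matpart x)^T = matpart x -> (matpart x)^adj = (matpart x)^cj.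
    by move=> sx; rewrite -[LHS]conj_tr sx.
  by split=> -[sx px]; [rewrite (e sx)|move: px; rewrite (e sx)].
Qed.

Let TM : charted T M := charted_domain ball_domain.

Lemma ball_M_unit x : M x -> 1%:M - matpart x *m (matpart x)^cj \in unitmx.
Proof. by case=> _ /posdef_unit. Qed.

Lemma ball_Ml x : M x -> ball_M x *m (1%:M - matpart x *m (matpart x)^cj) = 1%:M.
Proof. by move=> Mx; exact: mulVmx (ball_M_unit Mx). Qed.

Lemma ball_Mr x : M x -> (1%:M - matpart x *m (matpart x)^cj) *m ball_M x = 1%:M.
Proof. by move=> Mx; exact: mulmxV (ball_M_unit Mx). Qed.

Lemma ball_WM x : M x -> matpart x *m (ball_M x)^cj = ball_M x *m matpart x.
Proof. by move=> Mx; exact: ball_commute (ball_Mr Mx) (ball_Ml Mx). Qed.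

Lemma ball_etaP x eta : M x ->
  vecpart x = eta - matpart x *m eta^cj <-> ball_eta x = eta.
Proof. by move=> Mx; exact: ball_solve (ball_Ml Mx) (ball_WM Mx). Qed.

Lemma ball_hermitian x : M x ->
  (1%:M - matpart x *m (matpart x)^cj)^adj = 1%:M - matpart x *m (matpart x)^cj.
Proof.
case=> sW _; rewrite conj_add conj_opp conj_one conj_mul conj_K.
by rewrite tr_add tr_opp trmx1 trmx_mul -conj_tr sW.
Qed.

Lemma ball_M_adj x : M x -> (ball_M x)^adj = ball_M x.
Proof. by move=> Mx; rewrite /ball_M conj_inv tr_inv ball_hermitian. Qed.

Lemma ball_M_conj x : M x -> (ball_M x)^cj = (ball_M x)^T.
Proof. by move=> Mx; rewrite -[in RHS]ball_M_adj // trmxK. Qed.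

Section Action.
Variables (p q : 'M[C]_n) (a : 'cV[C]_n).
Hypothesis G : jacobiC_group ((p, q), a).
Local Notation act := (act_ball ((p, q), a)).
Local Notation N x := (matpart x *m q^adj + p^adj).
Local Notation K x := (matpart x *m p^T + q^T).

Lemma jacobiC_pTp : p^T *m p^cj = 1%:M + q^adj *m q.
Proof.
case: G => _ _ /(congr1 (fun A => A^cj)) + _.
by rewrite conj_add conj_opp conj_one !conj_mul conj_tr !conj_K conj_tr => /(canRL (subrK _)).
Qed.
Lemma jacobiC_pAp : p^adj *m p = 1%:M + q^T *m q^cj.
Proof. by case: G => _ _ /(canRL (subrK _)). Qed.
Lemma jacobiC_pTq : p^T *m q^cj = q^adj *m p.
Proof. by case: G. Qed.
Lemma jacobiC_qTp : q^T *m p^cj = p^adj *m q.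
Proof.
case: G => _ _ _ /(congr1 (fun A => A^cj)).
by rewrite !conj_mul !conj_tr !conj_K.
Qed.

Lemma ball_act_unit x : M x -> N x \in unitmx.
Proof.
case=> sW pW.
exact: ball_N_unit pW (ball_NN_KK jacobiC_pTp jacobiC_pAp jacobiC_pTq jacobiC_qTp sW). Qed.

Lemma ball_act_unitT x : M x -> q^cj *m matpart x + p^cj \in unitmx.
Proof.
move=> Mx; have := ball_act_unit Mx; rewrite -unitmx_tr; case: Mx => sW _.
by rewrite (ball_NT p q sW).
Qed.

Lemma matpart_act x : M x -> matpart (act x) = invmx (N x) *m K x.
Proof.
move=> Mx; have uN := ball_act_unit Mx; case: Mx => sW _; rewrite [LHS]matpart_mk.
exact: ball_mobius jacobiC_pTp jacobiC_pAp jacobiC_pTq jacobiC_qTp _ sW uN.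
Qed.

Lemma vecpart_act x : vecpart (act x) = invmx (N x) *m (vecpart x + a - matpart x *m a^cj).
Proof. exact: vecpart_mk. Qed.

Lemma act_defect x : M x -> 1%:M - matpart (act x) *m (matpart (act x))^cj =
  invmx (N x) *m (1%:M - matpart x *m (matpart x)^cj) *m (invmx (N x))^adj.
Proof.
move=> Mx; have uN := ball_act_unit Mx; rewrite (matpart_act Mx); case: Mx => sW _.
exact: ball_mobius_defect jacobiC_pTp jacobiC_pAp jacobiC_pTq jacobiC_qTp _ sW uN.
Qed.

Lemma act_ball_maps x : M x -> M (act x).
Proof.
move=> Mx; have uN := ball_act_unit Mx; have eD := act_defect Mx; have eW := matpart_act Mx.
case: (Mx) => sW pW; split.
  by rewrite eW; exact: ball_mobius_sym jacobiC_pTp jacobiC_pAp jacobiC_pTq jacobiC_qTp _ sW uN.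
have uP : (invmx (N x))^adj \in unitmx by rewrite adj_unit unitmx_inv.
have := posdef_congr uP pW; rewrite adj_K.
by rewrite -eD.
Qed.

Lemma ball_M_act x : M x -> ball_M (act x) = (N x)^adj *m ball_M x *m N x.
Proof.
move=> Mx; rewrite /ball_M (act_defect Mx).
exact: invmx_congr (ball_act_unit Mx) (ball_M_unit Mx).
Qed.

Lemma ball_eta_act x : M x -> ball_eta (act x) =
  p *m (ball_eta x + a) + q *m (ball_eta x + a)^cj.
Proof.
move=> Mx; have uN := ball_act_unit Mx; have zE := proj2 (ball_etaP (ball_eta x) Mx) erefl.
apply/(ball_etaP _ (act_ball_maps Mx)); rewrite (matpart_act Mx).
exact: ball_mobius_eta jacobiC_pTp jacobiC_pAp jacobiC_pTq jacobiC_qTp _ uN _ _ _ _ zE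
  (vecpart_act x).
Qed.

Lemma act_ball_msmooth :
  msmooth T M (fun x => (p *m matpart x + q) *m invmx (q^cj *m matpart x + p^cj)) /\
  msmooth T M (fun x => invmx (N x) *m (vecpart x + a - matpart x *m a^cj)).
Proof.
have s1 : msmooth T M (fun x => invmx (q^cj *m matpart x + p^cj)).
  by apply: (msmoothV TM); [exact: ball_act_unitT|msm TM].
have s2 : msmooth T M (fun x => invmx (N x)).
  by apply: (msmoothV TM); [exact: ball_act_unit|msm TM].
by split; msm TM.
Qed.

Lemma act_ball_smooth : smooth_on T M act.
Proof. by have [sS sb] := act_ball_msmooth; exact: (smooth_mkpoint TM). Qed.

Lemma derive_act_ball x X : M x -> T X ->
  'D_X act x = mkpoint (invmx (N x) *m matpart X *m (invmx (N x))^T)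
    (invmx (N x) *m (vecpart X - matpart X *m (a^cj + q^adj *m vecpart (act x)))).
Proof.
move=> Mx TX; have [sS sb] := act_ball_msmooth.
have sW := proj1 (matpart_charted TM); have sz := proj1 (vecpart_charted TM).
have dW := proj2 (matpart_charted TM) _ _ Mx TX.
have dz := proj2 (vecpart_charted TM) _ _ Mx TX.
have cst m l (A : 'M[C]_(m, l)) : msmooth T M (fun=> A) := msmooth_cst TM A.
have s1 := msmoothD TM (msmoothM TM (cst _ _ p) sW) (cst _ _ q).
have s2 := msmoothD TM (msmoothM TM (cst _ _ q^cj) sW) (cst _ _ p^cj).
have s3 := msmoothD TM (msmoothM TM sW (cst _ _ q^adj)) (cst _ _ p^adj).
have s4 := msmoothD TM sz (cst _ _ a).
have s5 := msmoothM TM sW (cst _ _ a^cj).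
have s6 := msmoothB TM s4 s5.
have uN := ball_act_unit Mx; case: (Mx) => symW _.
rewrite [LHS](derive_mkpoint TM sS sb Mx TX); congr mkpoint.
  rewrite (mderive_fracr TM Mx TX ball_act_unitT s1 s2).
  rewrite (mderive_affl TM Mx TX p q sW) (mderive_affl TM Mx TX _ _ sW) dW.
  exact: ball_mobius_dW jacobiC_pTp jacobiC_pAp jacobiC_pTq jacobiC_qTp symW uN.
rewrite (mderive_fracl TM Mx TX ball_act_unit s6 s3) (mderive_affr TM Mx TX _ _ sW).
rewrite (mderiveB TM Mx TX s4 s5) (mderiveD TM Mx TX sz (msmooth_cst TM a)) mderive_cst addr0.
rewrite (mderiveM TM Mx TX sW (msmooth_cst TM (a^cj))) mderive_cst mulmx0 addr0 dW dz.
rewrite vecpart_act; congr (_ *m _).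
by rewrite (mulmxDr (matpart X) a^cj) opprD addrA (mulmxA (matpart X)).
Qed.

Lemma act_ball_A x X : M x -> T X ->
  ball_A (act x) ('D_X act x) = invmx (N x) *m ball_A x X.
Proof.
move=> Mx TX; have uN := ball_act_unit Mx; case: (Mx) => symW _.
rewrite (derive_act_ball Mx TX) /ball_A matpart_mk vecpart_mk.
apply: (ball_mobius_A jacobiC_pTp jacobiC_pAp jacobiC_pTq jacobiC_qTp symW uN).
  exact: (ball_eta_act Mx).
by rewrite -(matpart_act Mx); exact: (proj2 (ball_etaP _ (act_ball_maps Mx)) erefl).
Qed.

Lemma act_ball_B x X : M x -> T X ->
  ball_B (act x) ('D_X act x) = (N x)^adj *m ball_B x X *m (invmx (N x))^T.
Proof.
move=> Mx TX; have uN := ball_act_unit Mx; have eM := ball_M_act Mx.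
rewrite (derive_act_ball Mx TX) /ball_B matpart_mk eM.
exact: congr_mul_inv uN.
Qed.

End Action.
End Ball.

(** * The Kähler form and homogeneity of the ball *)

Section BallForm.
Local Open Scope classical_set_scope.
Variables (R : realType) (n : nat).
Local Notation E := (coords R n).
Local Notation C := R[i].
Local Notation T := (@sym_tangent R n).
Local Notation J := (@mulI R n).
Local Notation M := (@siegel_jacobi_ball R n).
Variable k : R.
Hypothesis hk : 0 < k.

Definition ball_h (x X Y : E) : C :=
  (k / 2)%:C%C * \tr (ball_B x X *m (ball_B x Y)^cj) +
  \tr ((ball_A x X)^T *m (ball_M x)^cj *m (ball_A x Y)^cj).

Lemma omega_ballE x X Y : omega_ball k x X Y = 'i%C * (ball_h x X Y - ball_h x Y X).
Proof. by rewrite /omega_ball /wedge !tr_sub; exact: hermitian_difference. Qed.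

Lemma ball_B_lin (x : E) (c : R) X Y :
  ball_B x (c *: X + Y) = c%:C%C *: ball_B x X + ball_B x Y.
Proof. by rewrite /ball_B matpart_lin mulmxDr -scalemxAr. Qed.

Lemma ball_A_lin (x : E) (c : R) X Y :
  ball_A x (c *: X + Y) = c%:C%C *: ball_A x X + ball_A x Y.
Proof.
rewrite /ball_A matpart_lin vecpart_lin mulmxDl scalerDr -scalemxAl.
by rewrite -!addrA; congr (_ + _); rewrite addrCA.
Qed.

Lemma ball_B_J (x X : E) : ball_B x (J X) = 'i%C *: ball_B x X.
Proof. by rewrite /ball_B matpart_mulI -scalemxAr. Qed.

Lemma ball_A_J (x X : E) : ball_A x (J X) = 'i%C *: ball_A x X.
Proof. by rewrite /ball_A matpart_mulI vecpart_mulI scalerDr -scalemxAl. Qed.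

Lemma ball_h_lin (x : E) (c : R) X Y Z :
  ball_h x (c *: X + Y) Z = c%:C%C * ball_h x X Z + ball_h x Y Z.
Proof.
rewrite /ball_h ball_B_lin ball_A_lin tr_add tr_scale.
rewrite [(_ + _) *m (ball_B x Z)^cj]mulmxDl [(_ + _) *m (ball_M x)^cj]mulmxDl.
rewrite [(_ + _) *m (ball_A x Z)^cj]mulmxDl -!scalemxAl !mxtraceD !mxtraceZ.
exact: form_linear.
Qed.

Lemma ball_h_J (x X Y : E) : ball_h x (J X) Y = 'i%C * ball_h x X Y.
Proof.
rewrite /ball_h ball_B_J ball_A_J tr_scale -!scalemxAl !mxtraceZ.
by rewrite mulrCA -mulrDr.
Qed.

Lemma conj_real (c : R) : Num.conj (c%:C%C : C) = c%:C%C.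
Proof. by apply: complexP; rewrite /= ?oppr0. Qed.

Lemma ball_h_conj x X Y : M x -> ball_h x Y X = Num.conj (ball_h x X Y).
Proof.
move=> Mx; have hM := ball_M_adj Mx; rewrite /ball_h.
rewrite [RHS]raddfD /= [X in _ = X + _]rmorphM /= !conj_trace [X in _ = X * _ + _]conj_real.
rewrite (conj_mul (ball_B x X)) conj_K [\tr (ball_B x Y *m _)]mxtrace_mulC; congr (_ + _).
exact: form_conj hM.
Qed.

Lemma ball_M_pos x : M x -> posdef (ball_M x).
Proof. by move=> Mx; apply: posdef_inv (ball_hermitian Mx) _; case: Mx. Qed.

Lemma ball_h_pos x X : M x -> T X -> X != 0 -> 0 < ball_h x X X.
Proof.
move=> Mx TX X0; have pM := ball_M_pos Mx; have hM := ball_M_adj Mx.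
have k2 : 0 < (k / 2)%:C%C :> C by rewrite ltcR divr_gt0.
have pA (A : 'cV[C]_n) : A != 0 -> 0 < \tr (A^T *m (ball_M x)^cj *m A^cj).
  exact: posdef_conj_tr hM pM A.
(* If dW vanishes on X, then A is dz there and is nonzero. Otherwise the first trace is positive and
   the second nonnegative. *)
have [X1|X1] := eqVneq (matpart X) 0.
  have -> : ball_h x X X = \tr ((vecpart X)^T *m (ball_M x)^cj *m (vecpart X)^cj).
    by rewrite /ball_h /ball_B /ball_A X1 mulmx0 mul0mx mxtrace0 mulr0 add0r mul0mx addr0.
  apply: pA; apply: contraNneq X0 => X2; rewrite -(mkpointK X) X1 X2 /mkpoint.
  by rewrite !map_mx0.
have p1 : 0 < \tr (ball_B x X *m (ball_B x X)^cj).
  by rewrite /ball_B conj_mul mulmxA; exact: trace_posdef_gt0 hM pM TX X1.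
apply: ltr_pwDl; first exact: mulr_gt0.
have [->|/pA/ltW//] := eqVneq (ball_A x X) 0.
by rewrite trmx0 !mul0mx mxtrace0.
Qed.

Let TM : charted T M := charted_domain (ball_domain R n).

Let sW : msmooth T M (@matpart R n) := proj1 (matpart_charted TM).
Let sz : msmooth T M (@vecpart R n) := proj1 (vecpart_charted TM).
Let cst m l (A : 'M[C]_(m, l)) : msmooth T M (fun=> A) := msmooth_cst TM A.
Let sIWW := msmoothB TM (cst 1%:M) (msmoothM TM sW (msmooth_conj TM sW)).

Lemma ball_M_smooth : msmooth T M (@ball_M R n).
Proof. exact: (msmoothV TM (@ball_M_unit R n) sIWW). Qed.

Lemma ball_eta_smooth : msmooth T M (@ball_eta R n).
Proof.
exact: (msmoothM TM ball_M_smooth (msmoothD TM sz (msmoothM TM sW (msmooth_conj TM sz)))).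
Qed.

Lemma ball_A_smooth Y : msmooth T M (fun x => ball_A x Y).
Proof.
exact: (msmoothD TM (cst _) (msmoothM TM (cst _) (msmooth_conj TM ball_eta_smooth))).
Qed.

Lemma ball_B_smooth Y : msmooth T M (fun x => ball_B x Y).
Proof. exact: (msmoothM TM ball_M_smooth (cst _)). Qed.

Lemma mderive_ball_M x X : M x -> T X -> mderive (@ball_M R n) x X =
  ball_M x *m (matpart X *m (matpart x)^cj + matpart x *m (matpart X)^cj) *m ball_M x.
Proof.
move=> Mx TX; have dW := proj2 (matpart_charted TM) _ _ Mx TX.
have sWc := msmooth_conj TM sW; have sWW := msmoothM TM sW sWc.
rewrite [LHS](mderiveV TM Mx TX (@ball_M_unit R n) sIWW).
rewrite (mderiveB TM Mx TX (cst 1%:M) sWW) (mderiveM TM Mx TX sW sWc).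
by rewrite (mderive_conj TM Mx TX sW) mderive_cst dW sub0r mulmxN mulNmx opprK.
Qed.

(** The implicit equation [z = eta - W eta^cj] is differentiated instead of the formula for eta. The
    result [A = d eta - W (d eta)^cj] has the same form and is inverted by the same [ball_solve]. *)
Lemma mderive_ball_eta x X : M x -> T X -> mderive (@ball_eta R n) x X =
  ball_M x *m (ball_A x X + matpart x *m (ball_A x X)^cj).
Proof.
move=> Mx TX; have dW := proj2 (matpart_charted TM) _ _ Mx TX.
have dz := proj2 (vecpart_charted TM) _ _ Mx TX.
have sec := msmooth_conj TM ball_eta_smooth; have sWe := msmoothM TM sW sec.
apply/esym/(ball_solve _ _ (ball_Ml Mx) (ball_WM Mx)); rewrite /ball_A -dz.
have -> : mderive (@vecpart R n) x X =
    mderive (fun y => ball_eta y - matpart y *m (ball_eta y)^cj) x X.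
  by apply: (mderive_ext TM Mx TX) => y My; apply/(ball_etaP _ My).
rewrite (mderiveB TM Mx TX ball_eta_smooth sWe) (mderiveM TM Mx TX sW sec).
rewrite (mderive_conj TM Mx TX ball_eta_smooth) dW.
move: (mderive _ _ _) (_ *m _) (_ *m _) => u v w.
by rewrite opprD addrA -addrA addrC; apply/matrixP => i j; rewrite !mxE; ring.
Qed.

Lemma mderive_ball_A x X Y : M x -> T X -> mderive (fun y => ball_A y Y) x X =
  matpart Y *m ((ball_M x)^cj *m ((ball_A x X)^cj + (matpart x)^cj *m ball_A x X)).
Proof.
move=> Mx TX; have sec := msmooth_conj TM ball_eta_smooth.
have se2 := msmoothM TM (cst (matpart Y)) sec.
rewrite [LHS](mderiveD TM Mx TX (cst (vecpart Y)) se2) (mderiveM TM Mx TX (cst _) sec).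
rewrite (mderive_conj TM Mx TX ball_eta_smooth) !mderive_cst mul0mx !add0r.
by rewrite (mderive_ball_eta Mx TX) conj_mul conj_add conj_mul conj_K.
Qed.

Lemma mderive_ball_B x X Y : M x -> T X -> mderive (fun y => ball_B y Y) x X =
  ball_M x *m (matpart X *m (matpart x)^cj + matpart x *m (matpart X)^cj) *m ball_M x
    *m matpart Y.
Proof.
move=> Mx TX; rewrite [LHS](mderiveM TM Mx TX ball_M_smooth (cst _)) mderive_cst mulmx0 addr0.
by rewrite mderive_ball_M.
Qed.

Let s1 Y Z : msmooth T M (fun x => ball_B x Y *m (ball_B x Z)^cj) :=
  msmoothM TM (ball_B_smooth Y) (msmooth_conj TM (ball_B_smooth Z)).
Let s2 Y : msmooth T M (fun x => (ball_A x Y)^T *m (ball_M x)^cj) :=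
  msmoothM TM (msmooth_tr TM (ball_A_smooth Y)) (msmooth_conj TM ball_M_smooth).
Let s3 Y Z : msmooth T M (fun x => (ball_A x Y)^T *m (ball_M x)^cj *m (ball_A x Z)^cj) :=
  msmoothM TM (s2 Y) (msmooth_conj TM (ball_A_smooth Z)).
Let sk : csmooth T M (fun=> (k / 2)%:C%C : C) := csmooth_cst TM _.

Lemma ball_h_smooth X Y : csmooth T M (fun x => ball_h x X Y).
Proof.
exact: (csmoothD TM (csmoothM TM sk (csmooth_tr TM (s1 X Y))) (csmooth_tr TM (s3 X Y))).
Qed.

(** The part of the derivative of h(Y, Z) along X that is complex linear in X. Exchanging X and Y
    swaps the first four traces in pairs and fixes the fifth by transposition. *)
Definition ball_t (x X Y Z : E) : C :=
  let W := matpart x in let A := ball_M x in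
  (k / 2)%:C%C *
    (\tr (A *m matpart X *m A^cj *m W^cj *m matpart Y *m A^cj *m (matpart Z)^cj) +
     \tr (A *m matpart Y *m A^cj *m W^cj *m matpart X *m A^cj *m (matpart Z)^cj)) +
  (\tr ((ball_A x X)^T *m A^cj *m W^cj *m matpart Y *m A^cj *m (ball_A x Z)^cj) +
   \tr ((ball_A x Y)^T *m A^cj *m W^cj *m matpart X *m A^cj *m (ball_A x Z)^cj) +
   \tr ((ball_A x Y)^T *m A^cj *m (matpart Z)^cj *m A *m ball_A x X)).

Lemma ball_t_sym x X Y Z : M x -> T X -> T Y -> T Z -> ball_t x X Y Z = ball_t x Y X Z.
Proof.
move=> Mx TX TY TZ; apply: form_sym.
exact: ball_form_sym _ _ (ball_M_conj Mx) TZ.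
Qed.

Lemma ball_h_derive x X Y Z : M x -> T X -> T Y -> T Z ->
  cderive (fun y => ball_h y Y Z) x X = ball_t x X Y Z + Num.conj (ball_t x X Z Y).
Proof.
move=> Mx TX TY TZ; case: (Mx) => symW _.
rewrite (cderiveD Mx TX (csmoothM TM sk (csmooth_tr TM (s1 Y Z))) (csmooth_tr TM (s3 Y Z))).
rewrite (cderiveM TM Mx TX sk (csmooth_tr TM (s1 Y Z))) cderive_cst mul0r add0r.
rewrite (cderive_tr TM Mx TX (s1 Y Z)) (cderive_tr TM Mx TX (s3 Y Z)).
rewrite (mderiveM TM Mx TX (ball_B_smooth Y) (msmooth_conj TM (ball_B_smooth Z))).
rewrite (mderive_conj TM Mx TX (ball_B_smooth Z)) !(mderive_ball_B _ Mx TX).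
rewrite (mderiveM TM Mx TX (s2 Y) (msmooth_conj TM (ball_A_smooth Z))).
rewrite (mderiveM TM Mx TX (msmooth_tr TM (ball_A_smooth Y)) (msmooth_conj TM ball_M_smooth)).
rewrite (mderive_tr TM Mx TX) (mderive_conj TM Mx TX ball_M_smooth).
rewrite (mderive_conj TM Mx TX (ball_A_smooth Z)) !(mderive_ball_A _ Mx TX) (mderive_ball_M Mx TX).
rewrite /ball_B (ball_closed_matrix _ _ _ (ball_WM Mx)).
rewrite (ball_closed_vector _ _ _ symW (ball_M_conj Mx) TX TY TZ (ball_WM Mx)).
rewrite /ball_t [Num.conj (_ * _ + _)]rmorphD /= [Num.conj (_ * _)]rmorphM /=.
rewrite [Num.conj (k / 2)%:C%C]conj_real.
by rewrite mulrDr addrACA.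
Qed.

Lemma ball_kahler : kahler_form T J M (omega_ball k).
Proof.
apply: (@hermitian_kahler _ _ T J M _ ball_h ball_t).
- exact: ball_domain.
- by move=> x X Y _ _ _; exact: omega_ballE.
- by move=> x c X Y Z _ _ _ _; exact: ball_h_lin.
- by move=> x X Y Mx _ _; exact: ball_h_conj.
- by move=> x X Y _ _ _; exact: ball_h_J.
- exact: ball_h_pos.
- by move=> X Y _ _; exact: ball_h_smooth.
- exact: ball_h_derive.
- exact: ball_t_sym.
Qed.

Lemma mulI_mk (S : 'M[C]_n) (b : 'cV[C]_n) :
  J (mkpoint S b) = mkpoint ('i%C *: S) ('i%C *: b).
Proof. by rewrite /mulI matpart_mk vecpart_mk. Qed.

Section Isometry.
Variables (p q : 'M[C]_n) (a : 'cV[C]_n).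
Hypothesis G : jacobiC_group ((p, q), a).
Local Notation act := (act_ball ((p, q), a)).

Lemma act_ball_h x X Y : M x -> T X -> T Y ->
  ball_h (act x) ('D_X act x) ('D_Y act x) = ball_h x X Y.
Proof.
move=> Mx TX TY.
exact: (ball_form_transport _ (ball_act_unit G Mx) (ball_M_act G Mx) (act_ball_B G Mx TX)
  (act_ball_B G Mx TY) (act_ball_A G Mx TX) (act_ball_A G Mx TY)).
Qed.

Lemma act_ball_isometry : holomorphic_isometry T J M (omega_ball k) act.
Proof.
split.
- exact: act_ball_maps.
- exact: act_ball_smooth.
- move=> x X Mx TX; have TJX := cplxstr_tangent (ball_domain R n) TX.
  apply: (etrans (derive_act_ball G Mx TJX)).
  apply: (etrans _ (congr1 J (esym (derive_act_ball G Mx TX)))).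
  apply: (etrans _ (esym (mulI_mk _ _))).
  apply: (congr2 (@mkpoint R n)); first exact: scale_congr (matpart_mulI X).
  exact: scale_affineN (matpart_mulI X) (vecpart_mulI X).
- move=> x X Y Mx TX TY; rewrite /pullback.
  apply: (etrans (omega_ballE _ _ _)); apply: (etrans _ (esym (omega_ballE _ _ _))).
  exact: (congr2 (fun u v => 'i%C * (u - v)) (act_ball_h Mx TX TY) (act_ball_h Mx TY TX)).
Qed.

End Isometry.


Lemma ball_group : group_on (@jacobiC_group R n) (@jacobiC_mul R n) (@jacobiC_one R n)
  (@jacobiC_inv R n).
Proof.
split.
- by move=> [[p q] a] [[p' q'] a'] G H; exact: (unitary_symplectic_mul G H).
- exact: unitary_symplectic_one.
- by move=> [[p q] a] G; exact: (unitary_symplectic_inv G).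
- move=> [[p q] a] [[p' q'] a'] [[p2 q2] a2] _ _ _.
  have [e1 e2] := jacobiC_assoc_mx p q p' q' p2 q2.
  by congr (_, _, _); [exact: e1|exact: e2|exact: jacobiC_assoc_vec].
- move=> [[p q] a] _; rewrite /jacobiC_mul /jacobiC_one !mul1mx !mul0mx !addr0.
  by rewrite map_mx0 !mulmx0 subr0 addr0.
- move=> [[p q] a] G; have [e1 e2 e3] := jacobiC_inv_mul a G.
  by congr (_, _, _); [exact: e1|exact: e2|exact: e3].
Qed.

Lemma act_ball_one (x : E) : act_ball (@jacobiC_one R n) x = x.
Proof.
apply: pt_eq; rewrite [LHS](matpart_mk, vecpart_mk).
  by rewrite map_mx0 map_mx1 mul0mx mul1mx addr0 add0r invmx1 mulmx1.
by rewrite !map_mx0 map_mx1 trmx0 trmx1 !mulmx0 add0r subr0 addr0 invmx1 mul1mx.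
Qed.

Lemma act_ball_mul g h x : jacobiC_group g -> jacobiC_group h -> M x ->
  act_ball (jacobiC_mul g h) x = act_ball g (act_ball h x).
Proof.
case: g h => [[p q] a] [[p' q'] a'] G H Mx.
have M1 := act_ball_maps H Mx.
have u1 := ball_act_unitT H Mx; have u2 := ball_act_unit H Mx.
have v1 := ball_act_unitT G M1; have v2 := ball_act_unit G M1.
have eW := matpart_act H Mx.
have W'E : (matpart x *m q'^adj + p'^adj) *m matpart (act_ball (p', q', a') x) =
    matpart x *m p'^T + q'^T.
  by rewrite eW (mulKVmx u2).
apply: pt_eq.
  apply: (etrans (matpart_mk _ _)); apply: (etrans _ (esym (matpart_mk _ _))).
  rewrite [matpart (act_ball _ x)]matpart_mk in v1 *.
  exact: ball_act_comp u1 v1.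
apply: (etrans (vecpart_mk _ _)); apply: (etrans _ (esym (vecpart_mk _ _))).
rewrite [vecpart (act_ball _ x)]vecpart_mk.
exact: ball_act_comp_vec u2 v2 W'E.
Qed.

Definition origin : E := mkpoint 0 0.

Lemma ball_origin : M origin.
Proof.
by split; rewrite matpart_mk ?trmx0 // mul0mx subr0; exact: posdef_one.
Qed.

Lemma ball_transitive x : M x -> exists2 g, jacobiC_group g & act_ball g origin = x.
Proof.
move=> Mx; have [L uL eL] := posdef_cholesky (ball_hermitian Mx) (proj2 Mx).
set W := matpart x in eL; set p := invmx L^adj; set q := W *m p^cj.
have G : unitary_symplectic p q by exact: ball_transitive_mx (proj1 Mx) uL eL.
have uLa : L^adj \in unitmx by rewrite adj_unit.
have up : p \in unitmx by rewrite unitmx_inv.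
have upa : p^adj \in unitmx by rewrite adj_unit.
have upc : p^cj \in unitmx by rewrite conj_unit.
(* At the origin the denominator N is [p^adj], so the image has fibre coordinate [(p^adj)^-1 a];
   this dictates a. *)
exists ((p, q), p^adj *m vecpart x); first exact: G.
apply: pt_eq.
  apply: (etrans (matpart_mk _ _)); rewrite matpart_mk !mulmx0 !add0r /q.
  by rewrite (mulmxK upc).
apply: (etrans (vecpart_mk _ _)); rewrite matpart_mk vecpart_mk !mul0mx !add0r subr0.
by rewrite (mulKmx upa).
Qed.

Lemma ball_homogeneous : homogeneous_kahler T J M (omega_ball k) (@jacobiC_group R n)
  (@jacobiC_mul R n) (@jacobiC_one R n) (@jacobiC_inv R n) (@act_ball R n).
Proof.
apply: (homogeneous_from_base (ball_domain R n) ball_kahler ball_group (o := origin)).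
- by move=> x _; exact: act_ball_one.
- by move=> g h x; exact: act_ball_mul.
- by move=> [[p q] a] G; exact: act_ball_isometry.
- exact: ball_origin.
- exact: ball_transitive.
Qed.

End BallForm.

(** * The Siegel-Jacobi upper half space *)

Section Space.
Local Open Scope classical_set_scope.
Variables (R : realType) (n : nat).
Local Notation E := (coords R n).
Local Notation C := R[i].
Local Notation T := (@sym_tangent R n).
Local Notation J := (@mulI R n).
Local Notation M := (@siegel_jacobi_space R n).
Local Notation Q y := ((matpart y)^cj - matpart y).

Lemma space_Q (y : E) : 'i%C *: Q y = rmx (y.1.2 + y.1.2).
Proof.
apply/matrixP => i j; rewrite !mxE.
by apply: complexP; rewrite /= ?Re_add ?Im_add ?Re_mul ?Im_mul /=; ring.
Qed.

(** The condition on the imaginary part of v is restated through ['i (v^cj - v)], which the action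
    changes by a congruence. *)
Lemma spaceP (y : E) : M y <-> T y /\ posdef ('i%C *: Q y).
Proof.
have symE : T y <-> y.1.1^T = y.1.1 /\ y.1.2^T = y.1.2.
  split=> [/matrixP e|[/matrixP e1 /matrixP e2]].
    by split; apply/matrixP => i j; have := e i j; rewrite !mxE => -[].
  by apply/matrixP => i j; have := e1 i j; have := e2 i j; rewrite !mxE => -> ->.
have posE : y.1.2^T = y.1.2 -> posdefR y.1.2 <-> posdef ('i%C *: Q y).
  by move=> sr; rewrite space_Q rmx_add posdef_double; exact: posdefR_C.
split=> [[s1 s2 pr]|[/symE[s1 s2] pq]]; first by split; [exact/symE|exact/(posE s2)].
by split => //; exact/(posE s2).
Qed.

Lemma space_domain : complex_domain T J M.
Proof.
have TT := @chartedT R E.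
have sW := proj1 (matpart_charted TT).
(* As on the ball, the adjoint replaces the conjugate to have a Hermitian matrix at every point of
   the coordinate space. *)
apply: (@coords_domain _ _ (fun y : E => 'i%C *: ((matpart y)^adj - matpart y))).
- exact: (msmoothZ TT _ (msmoothB TT (msmooth_tr TT (msmooth_conj TT sW)) sW)).
- move=> y; rewrite conj_scale conj_add conj_opp conj_tr conj_K conj_i.
  by rewrite tr_scale tr_add tr_opp trmxK scaleNr -scalerN opprB.
- move=> y; have e : (matpart y)^T = matpart y -> (matpart y)^adj = (matpart y)^cj.
    by move=> sy; rewrite -[LHS]conj_tr sy.
  split=> [/spaceP[sy py]|[sy py]]; first by rewrite (e sy).
  by apply/spaceP; move: py; rewrite (e sy).
Qed.

Let TM : charted T M := charted_domain space_domain.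

Lemma space_sym y : M y -> (matpart y)^T = matpart y.
Proof. by case/spaceP. Qed.

Lemma space_pos y : M y -> posdef ('i%C *: Q y).
Proof. by case/spaceP. Qed.

Lemma i_neq0 : 'i%C != 0 :> C.
Proof. by apply/eqP => -[] /eqP; rewrite oner_eq0. Qed.

Lemma space_Q_unit y : M y -> Q y \in unitmx.
Proof. by move/space_pos/posdef_unit; rewrite unitmxZ // unitfE i_neq0. Qed.

Lemma space_Dl y : M y -> space_D y *m Q y = 1%:M.
Proof. by move=> My; exact: mulVmx (space_Q_unit My). Qed.

Lemma space_Dr y : M y -> Q y *m space_D y = 1%:M.
Proof. by move=> My; exact: mulmxV (space_Q_unit My). Qed.

Definition space_q (y : E) : 'cV[C]_n := space_D y *m ((vecpart y)^cj - vecpart y).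

Lemma space_D_conj y : M y -> (space_D y)^cj = - space_D y.
Proof. by move=> My; have [] := space_real (vecpart y) (space_Dl My) (space_Dr My). Qed.

Lemma space_q_conj y : M y -> (space_q y)^cj = space_q y.
Proof. by move=> My; have [] := space_real (vecpart y) (space_Dl My) (space_Dr My). Qed.

Definition space_w (y : E) : 'cV[C]_n := vecpart y - matpart y *m space_q y.

Lemma space_w_conj y : M y -> (space_w y)^cj = space_w y.
Proof. by move=> My; have [] := space_real (vecpart y) (space_Dl My) (space_Dr My). Qed.

Lemma space_qw y : vecpart y = matpart y *m space_q y + space_w y.
Proof. by rewrite /space_w addrC subrK. Qed.

Lemma space_D_sym y : M y -> (space_D y)^T = space_D y.
Proof.
by move=> My; rewrite /space_D tr_inv tr_add tr_opp -conj_tr (space_sym My).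
Qed.

Lemma space_GE (y X : E) : space_G y X = vecpart X - matpart X *m space_q y.
Proof. by rewrite /space_G -mulmxA. Qed.

Section Action.
Variable g : ('M[R]_(n + n) * 'rV[R]_(n + n))%type.
Hypothesis Gg : jacobiR_group g.
Local Notation a := (blk_a g).
Local Notation b := (blk_b g).
Local Notation c := (blk_c g).
Local Notation d := (blk_d g).
Local Notation act := (act_space g).
Local Notation N y := (matpart y *m c^T + d^T).
Local Notation K y := (matpart y *m a^T + b^T).

Lemma blk_relations : [/\ a^T *m c = c^T *m a, a^T *m d = 1%:M + c^T *m b,
  d^T *m a = 1%:M + b^T *m c & b^T *m d = d^T *m b].
Proof.
have : g.1^T *m sympl_form R n *m g.1 = sympl_form R n by exact: Gg.
rewrite -{1 2}[g.1]submxK => /symplectic_blocks[e1 e2 e3 e4].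
rewrite -[a]/(rmx _) -[b]/(rmx _) -[c]/(rmx _) -[d]/(rmx _).
by rewrite -!rmx_tr -!rmx_mul e1 e2 e3 e4 !rmx_add rmx1.
Qed.

Lemma blk_conj : [/\ a^cj = a, b^cj = b, c^cj = c & d^cj = d].
Proof. by split; exact: conj_rmx. Qed.

Let aTc := let: And4 h _ _ _ := blk_relations in h.
Let aTd := let: And4 _ h _ _ := blk_relations in h.
Let dTa := let: And4 _ _ h _ := blk_relations in h.
Let bTd := let: And4 _ _ _ h := blk_relations in h.
Let ra := let: And4 h _ _ _ := blk_conj in h.
Let rb := let: And4 _ h _ _ := blk_conj in h.
Let rc := let: And4 _ _ h _ := blk_conj in h.
Let rd := let: And4 _ _ _ h := blk_conj in h.
Let l : 'cV[C]_n := vec_n g.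
Let m : 'cV[C]_n := vec_m g.
Let rl : l^cj = l. Proof. exact: conj_rmx. Qed.
Let rm : m^cj = m. Proof. exact: conj_rmx. Qed.

Lemma space_act_unit y : M y -> N y \in unitmx.
Proof.
move=> My; apply: space_N_unit (space_pos My) _.
exact: space_NK_defect ra rb rc rd aTc aTd dTa bTd _ (space_sym My).
Qed.

Lemma space_act_unitT y : M y -> c *m matpart y + d \in unitmx.
Proof.
by move=> My; have := space_act_unit My; rewrite -unitmx_tr (space_NT _ _ (space_sym My)).
Qed.

Lemma space_act_two_forms y : M y ->
  (a *m matpart y + b) *m invmx (c *m matpart y + d) = invmx (N y) *m K y.
Proof.
by move=> My; exact: space_mobius aTc aTd dTa bTd _ (space_sym My) (space_act_unit My).
Qed.

Lemma matpart_act_space y : M y -> matpart (act y) = invmx (N y) *m K y.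
Proof. by move=> My; rewrite [LHS]matpart_mk; exact: space_act_two_forms. Qed.

Lemma vecpart_act_space y : vecpart (act y) = invmx (N y) *m (vecpart y + matpart y *m l + m).
Proof. exact: vecpart_mk. Qed.

Lemma act_space_Q y : M y -> Q (act y) = invmx (N y) *m Q y *m (invmx (N y))^adj.
Proof.
move=> My; rewrite (matpart_act_space My).
exact: space_mobius_defect ra rb rc rd aTc aTd dTa bTd _ (space_sym My) (space_act_unit My).
Qed.

Lemma act_space_maps y : M y -> M (act y).
Proof.
move=> My; have uN := space_act_unit My; apply/spaceP; split.
  rewrite /sym_tangent /= (matpart_act_space My).
  exact: space_mobius_sym aTc aTd dTa bTd _ (space_sym My) uN.
have uP : (invmx (N y))^adj \in unitmx by rewrite adj_unit unitmx_inv.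
have := posdef_congr uP (space_pos My); rewrite adj_K -scalemxAr -scalemxAl.
by rewrite -(act_space_Q My).
Qed.

Lemma space_D_act y : M y -> space_D (act y) = (N y)^adj *m space_D y *m N y.
Proof.
move=> My; rewrite /space_D (act_space_Q My).
exact: invmx_congr (space_act_unit My) (space_Q_unit My).
Qed.

(** D is symmetric, so its transformation law may be transposed; this is the shape that cancels in
    [G^T D G^cj]. *)
Lemma space_D_act_tr y : M y -> space_D (act y) = (N y)^T *m space_D y *m (N y)^cj.
Proof.
move=> My; rewrite -(space_D_sym (act_space_maps My)) (space_D_act My) !trmx_mul trmxK.
by rewrite (space_D_sym My) mulmxA.
Qed.

(** Both candidates for the pair (q, w) at y are real and represent the same u, so they agree by
    [space_solve]. *)
Lemma space_q_act y : M y ->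
  space_q y = a^T *m space_q (act y) + c^T *m space_w (act y) - l.
Proof.
move=> My; have M1 := act_space_maps My; have uN := space_act_unit My.
have r1 := space_q_conj M1; have r2 := space_w_conj M1.
have e2 := space_qw (act y); rewrite (matpart_act_space My) in e2.
have e1 := conj_real_comb ra rc r1 r2 rl; have e3 := conj_real_comb rb rd r1 r2 rm.
exact: space_solve (space_Dl My) e1 e3 (space_mobius_q uN (vecpart_act_space y) e2).
Qed.

Let sW : msmooth T M (@matpart R n) := proj1 (matpart_charted TM).
Let sz : msmooth T M (@vecpart R n) := proj1 (vecpart_charted TM).
Let cst k j (A : 'M[C]_(k, j)) : msmooth T M (fun=> A) := msmooth_cst TM A.
Let s1 := msmoothD TM (msmoothM TM (cst a) sW) (cst b).
Let s2 := msmoothD TM (msmoothM TM (cst c) sW) (cst d).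
Let s3 := msmoothD TM (msmoothM TM sW (cst c^T)) (cst d^T).
Let s4 := msmoothD TM sz (msmoothM TM sW (cst l)).
Let s5 := msmoothD TM s4 (cst m).

Lemma act_space_smooth : smooth_on T M act.
Proof.
apply: (smooth_mkpoint TM).
  exact: (msmoothM TM s1 (msmoothV TM space_act_unitT s2)).
exact: (msmoothM TM (msmoothV TM space_act_unit s3) s5).
Qed.

Lemma derive_act_space y X : M y -> T X ->
  'D_X act y = mkpoint (invmx (N y) *m matpart X *m (invmx (N y))^T)
    (invmx (N y) *m (vecpart X + matpart X *m (l - c^T *m vecpart (act y)))).
Proof.
move=> My TX; have uN := space_act_unit My.
have dW := proj2 (matpart_charted TM) _ _ My TX.
have dz := proj2 (vecpart_charted TM) _ _ My TX.
have sS := msmoothM TM s1 (msmoothV TM space_act_unitT s2).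
have sb := msmoothM TM (msmoothV TM space_act_unit s3) s5.
rewrite [LHS](derive_mkpoint TM sS sb My TX); congr mkpoint.
  rewrite (mderive_fracr TM My TX space_act_unitT s1 s2).
  rewrite (mderive_affl TM My TX a b sW) (mderive_affl TM My TX c d sW) dW.
  exact: space_mobius_dv aTc aTd dTa bTd (space_sym My) uN.
rewrite (mderive_fracl TM My TX space_act_unit s5 s3) (mderive_affr TM My TX _ _ sW).
rewrite (mderiveD TM My TX s4 (cst m)) (mderiveD TM My TX sz (msmoothM TM sW (cst l))).
rewrite (mderiveM TM My TX sW (cst l)) !mderive_cst mulmx0 !addr0 dW dz.
rewrite vecpart_act_space; congr (_ *m _).
by rewrite (mulmxBr (matpart X) l) addrA (mulmxA (matpart X) c^T).
Qed.

Lemma act_space_G y X : M y -> T X ->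
  space_G (act y) ('D_X act y) = invmx (N y) *m space_G y X.
Proof.
move=> My TX; have uN := space_act_unit My.
rewrite (derive_act_space My TX) !space_GE matpart_mk vecpart_mk.
apply: (space_mobius_G aTc aTd dTa bTd (space_sym My) uN); last exact: space_q_act.
by rewrite -(matpart_act_space My); exact: space_qw.
Qed.

Lemma act_space_H y X : M y -> T X ->
  space_H (act y) ('D_X act y) = (N y)^adj *m space_H y X *m (invmx (N y))^T.
Proof.
move=> My TX; have uN := space_act_unit My.
rewrite (derive_act_space My TX) /space_H matpart_mk (space_D_act My).
exact: congr_mul_inv uN.
Qed.

End Action.
End Space.

(** * The Kähler form and homogeneity of the upper half space *)

Section SpaceForm.
Local Open Scope classical_set_scope.
Variables (R : realType) (n : nat).
Local Notation E := (coords R n).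
Local Notation C := R[i].
Local Notation T := (@sym_tangent R n).
Local Notation J := (@mulI R n).
Local Notation M := (@siegel_jacobi_space R n).
Local Notation Q y := ((matpart y)^cj - matpart y).
Variable k : R.
Hypothesis hk : 0 < k.

Definition space_h (y X Y : E) : C :=
  (k / 2)%:C%C * \tr (space_H y X *m (space_H y Y)^cj) +
  2 / 'i%C * \tr ((space_G y X)^T *m space_D y *m (space_G y Y)^cj).

Lemma omega_spaceE y X Y : omega_space k y X Y = 'i%C * (space_h y X Y - space_h y Y X).
Proof.
by rewrite /omega_space /wedge !tr_sub; exact: hermitian_difference2.
Qed.

Lemma space_H_lin (y : E) (c : R) X Y :
  space_H y (c *: X + Y) = c%:C%C *: space_H y X + space_H y Y.
Proof. by rewrite /space_H matpart_lin mulmxDr -scalemxAr. Qed.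

Lemma space_G_lin (y : E) (c : R) X Y :
  space_G y (c *: X + Y) = c%:C%C *: space_G y X + space_G y Y.
Proof.
rewrite !space_GE matpart_lin vecpart_lin mulmxDl opprD scalerBr -scalemxAl.
by rewrite -!addrA; congr (_ + _); rewrite addrCA.
Qed.

Lemma space_H_J (y X : E) : space_H y (J X) = 'i%C *: space_H y X.
Proof. by rewrite /space_H matpart_mulI -scalemxAr. Qed.

Lemma space_G_J (y X : E) : space_G y (J X) = 'i%C *: space_G y X.
Proof. by rewrite !space_GE matpart_mulI vecpart_mulI scalerBr -scalemxAl. Qed.

Lemma space_h_lin (y : E) (c : R) X Y Z :
  space_h y (c *: X + Y) Z = c%:C%C * space_h y X Z + space_h y Y Z.
Proof.
rewrite /space_h space_H_lin space_G_lin tr_add tr_scale.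
rewrite [(_ + _) *m (space_H y Z)^cj]mulmxDl [(_ + _) *m space_D y]mulmxDl.
rewrite [(_ + _) *m (space_G y Z)^cj]mulmxDl -!scalemxAl !mxtraceD !mxtraceZ.
exact: form_linear2.
Qed.

Lemma space_h_J (y X Y : E) : space_h y (J X) Y = 'i%C * space_h y X Y.
Proof.
rewrite /space_h space_H_J space_G_J tr_scale -!scalemxAl !mxtraceZ.
exact: form_scale2.
Qed.

Lemma conj_2i : Num.conj (2 / 'i%C : C) = - (2 / 'i%C).
Proof. exact: conj_2_div (conj_i R). Qed.

Lemma space_h_conj y X Y : M y -> space_h y Y X = Num.conj (space_h y X Y).
Proof.
move=> My.
exact: space_hermitian (space_D_sym My) (space_D_conj My) (conj_real _) conj_2i.
Qed.

Lemma space_h_pos y X : M y -> T X -> X != 0 -> 0 < space_h y X X.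
Proof.
move=> My TX X0.
have sQ : (Q y)^T = Q y by rewrite tr_add tr_opp -conj_tr (space_sym My).
have cQ : (Q y)^cj = - Q y by rewrite conj_add conj_opp conj_K opprB.
have [pN hN rN DE] := inv_scale_posdef (mul_ii R) (conj_i R) sQ cQ (space_pos My).
have k2 : 0 < (k / 2)%:C%C :> C by rewrite ltcR divr_gt0.
have pG (g : 'cV[C]_n) : g != 0 -> 0 < 2 / 'i%C * \tr (g^T *m space_D y *m g^cj).
  exact: (space_vector_gt0 (mul_ii R) pN hN rN DE).
have [X1|X1] := eqVneq (matpart X) 0.
  have -> : space_h y X X =
      2 / 'i%C * \tr ((vecpart X)^T *m space_D y *m (vecpart X)^cj).
    by rewrite /space_h /space_H space_GE X1 mulmx0 mul0mx mxtrace0 mulr0 add0r mul0mx subr0.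
  apply: pG; apply: contraNneq X0 => X2; rewrite -(mkpointK X) X1 X2 /mkpoint.
  by rewrite !map_mx0.
have p1 : 0 < \tr (space_H y X *m (space_H y X)^cj).
  exact: (space_matrix_gt0 (mul_ii R) (conj_i R) pN hN DE TX X1).
apply: ltr_pwDl; first exact: mulr_gt0.
have [->|/pG/ltW//] := eqVneq (space_G y X) 0.
by rewrite trmx0 !mul0mx mxtrace0 mulr0.
Qed.

Let TM : charted T M := charted_domain (space_domain R n).
Let sW : msmooth T M (@matpart R n) := proj1 (matpart_charted TM).
Let sz : msmooth T M (@vecpart R n) := proj1 (vecpart_charted TM).
Let cst m l (A : 'M[C]_(m, l)) : msmooth T M (fun=> A) := msmooth_cst TM A.
Let sQ := msmoothB TM (msmooth_conj TM sW) sW.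
Let su := msmoothB TM (msmooth_conj TM sz) sz.

Lemma space_D_smooth : msmooth T M (@space_D R n).
Proof. exact: (msmoothV TM (@space_Q_unit R n) sQ). Qed.

Lemma space_q_smooth : msmooth T M (@space_q R n).
Proof. exact: (msmoothM TM space_D_smooth su). Qed.

Lemma space_H_smooth Y : msmooth T M (fun y => space_H y Y).
Proof. exact: (msmoothM TM space_D_smooth (cst _)). Qed.

Lemma space_G_smooth Y : msmooth T M (fun y => space_G y Y).
Proof.
apply: (msmooth_ext TM) (msmoothB TM (cst (vecpart Y))
  (msmoothM TM (cst (matpart Y)) space_q_smooth)).
by move=> y _; rewrite space_GE.
Qed.

Lemma mderive_space_D y X : M y -> T X -> mderive (@space_D R n) y X =
  space_D y *m (matpart X - (matpart X)^cj) *m space_D y.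
Proof.
move=> My TX; have dW := proj2 (matpart_charted TM) _ _ My TX.
rewrite [LHS](mderiveV TM My TX (@space_Q_unit R n) sQ).
rewrite (mderiveB TM My TX (msmooth_conj TM sW) sW) (mderive_conj TM My TX sW) dW.
by rewrite -mulNmx -mulmxN opprB.
Qed.

(** Because q is real, [dv q] and its conjugate absorb the derivative of D, turning du into
    [G = du - dv q]. *)
Lemma mderive_space_q y X : M y -> T X -> mderive (@space_q R n) y X =
  space_D y *m ((space_G y X)^cj - space_G y X).
Proof.
move=> My TX; have dz := proj2 (vecpart_charted TM) _ _ My TX.
rewrite [LHS](mderiveM TM My TX space_D_smooth su) (mderive_space_D My TX).
rewrite (mderiveB TM My TX (msmooth_conj TM sz) sz) (mderive_conj TM My TX sz) dz.
rewrite space_GE; exact: space_derive_q (space_q_conj My) erefl.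
Qed.

Lemma mderive_space_G y X Y : M y -> T X -> mderive (fun z => space_G z Y) y X =
  matpart Y *m - (space_D y *m ((space_G y X)^cj - space_G y X)).
Proof.
move=> My TX; have sq2 := msmoothM TM (cst (matpart Y)) space_q_smooth.
transitivity (mderive (fun z => vecpart Y - matpart Y *m space_q z) y X).
  by apply: (mderive_ext TM My TX) => z _; exact: space_GE.
rewrite (mderiveB TM My TX (cst (vecpart Y)) sq2) (mderiveM TM My TX (cst _) space_q_smooth).
by rewrite !mderive_cst mul0mx !add0r (mderive_space_q My TX) mulmxN.
Qed.

Lemma mderive_space_H y X Y : M y -> T X -> mderive (fun z => space_H z Y) y X =
  space_D y *m (matpart X - (matpart X)^cj) *m space_D y *m matpart Y.
Proof.
move=> My TX; rewrite [LHS](mderiveM TM My TX space_D_smooth (cst _)) mderive_cst mulmx0 addr0.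
by rewrite (mderive_space_D My TX).
Qed.

Let s1 Y Z : msmooth T M (fun y => space_H y Y *m (space_H y Z)^cj) :=
  msmoothM TM (space_H_smooth Y) (msmooth_conj TM (space_H_smooth Z)).
Let s2 Y : msmooth T M (fun y => (space_G y Y)^T *m space_D y) :=
  msmoothM TM (msmooth_tr TM (space_G_smooth Y)) space_D_smooth.
Let s3 Y Z : msmooth T M (fun y => (space_G y Y)^T *m space_D y *m (space_G y Z)^cj) :=
  msmoothM TM (s2 Y) (msmooth_conj TM (space_G_smooth Z)).
Let sk : csmooth T M (fun=> (k / 2)%:C%C : C) := csmooth_cst TM _.
Let si : csmooth T M (fun=> 2 / 'i%C : C) := csmooth_cst TM _.
Let c1 Y Z := csmoothM TM sk (csmooth_tr TM (s1 Y Z)).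
Let c2 Y Z := csmoothM TM si (csmooth_tr TM (s3 Y Z)).

Lemma space_h_smooth X Y : csmooth T M (fun y => space_h y X Y).
Proof. exact: (csmoothD TM (c1 X Y) (c2 X Y)). Qed.

(** The counterpart of [ball_t]: the complex linear part in X, with the same pairing of traces under
    exchange of X and Y. *)
Definition space_t (y X Y Z : E) : C :=
  let D := space_D y in
  (k / 2)%:C%C *
    - (\tr (D *m matpart X *m D *m matpart Y *m D *m (matpart Z)^cj) +
       \tr (D *m matpart Y *m D *m matpart X *m D *m (matpart Z)^cj)) +
  2 / 'i%C *
  (\tr ((space_G y X)^T *m D *m matpart Y *m D *m (space_G y Z)^cj) +
   \tr ((space_G y Y)^T *m D *m matpart X *m D *m (space_G y Z)^cj) +
   \tr ((space_G y Y)^T *m D *m (matpart Z)^cj *m D *m space_G y X)).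

Lemma space_t_sym y X Y Z : M y -> T X -> T Y -> T Z -> space_t y X Y Z = space_t y Y X Z.
Proof. by move=> My TX TY TZ; exact: space_form_sym (space_D_sym My) TZ. Qed.

Lemma space_h_derive y X Y Z : M y -> T X -> T Y -> T Z ->
  cderive (fun z => space_h z Y Z) y X = space_t y X Y Z + Num.conj (space_t y X Z Y).
Proof.
move=> My TX TY TZ.
rewrite (cderiveD My TX (c1 Y Z) (c2 Y Z)).
rewrite (cderiveM TM My TX sk (csmooth_tr TM (s1 Y Z))) cderive_cst mul0r add0r.
rewrite (cderiveM TM My TX si (csmooth_tr TM (s3 Y Z))) cderive_cst mul0r add0r.
rewrite (cderive_tr TM My TX (s1 Y Z)) (cderive_tr TM My TX (s3 Y Z)).
rewrite (mderiveM TM My TX (space_H_smooth Y) (msmooth_conj TM (space_H_smooth Z))).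
rewrite (mderive_conj TM My TX (space_H_smooth Z)) !(mderive_space_H _ My TX).
rewrite (mderiveM TM My TX (s2 Y) (msmooth_conj TM (space_G_smooth Z))).
rewrite (mderiveM TM My TX (msmooth_tr TM (space_G_smooth Y)) space_D_smooth).
rewrite (mderive_tr TM My TX) (mderive_conj TM My TX (space_G_smooth Z)).
rewrite !(mderive_space_G _ My TX) (mderive_space_D My TX).
rewrite /space_H (space_closed_matrix _ _ _ (space_D_conj My)).
rewrite (space_closed_vector _ _ _ (space_D_sym My) (space_D_conj My) TX TY TZ conj_2i).
rewrite /space_t [Num.conj (_ * _ + _)]rmorphD /= [Num.conj ((k / 2)%:C%C * _)]rmorphM /=.
rewrite [Num.conj (k / 2)%:C%C]conj_real.
by rewrite mulrDr addrACA.
Qed.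

Lemma space_kahler : kahler_form T J M (omega_space k).
Proof.
apply: (@hermitian_kahler _ _ T J M _ space_h space_t).
- exact: space_domain.
- by move=> y X Y _ _ _; exact: omega_spaceE.
- by move=> y c X Y Z _ _ _ _; exact: space_h_lin.
- by move=> y X Y My _ _; exact: space_h_conj.
- by move=> y X Y _ _ _; exact: space_h_J.
- exact: space_h_pos.
- by move=> X Y _ _; exact: space_h_smooth.
- exact: space_h_derive.
- exact: space_t_sym.
Qed.

Section Isometry.
Variable g : ('M[R]_(n + n) * 'rV[R]_(n + n))%type.
Hypothesis Gg : jacobiR_group g.
Local Notation act := (act_space g).

Lemma act_space_h y X Y : M y -> T X -> T Y ->
  space_h (act y) ('D_X act y) ('D_Y act y) = space_h y X Y.
Proof.
move=> My TX TY.
exact: (space_form_transport _ _ (space_act_unit Gg My) (space_D_act_tr Gg My)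
  (act_space_H Gg My TX) (act_space_H Gg My TY) (act_space_G Gg My TX) (act_space_G Gg My TY)).
Qed.

Lemma act_space_isometry : holomorphic_isometry T J M (omega_space k) act.
Proof.
split.
- exact: act_space_maps.
- exact: act_space_smooth.
- move=> y X My TX; have TJX := cplxstr_tangent (space_domain R n) TX.
  apply: (etrans (derive_act_space Gg My TJX)).
  apply: (etrans _ (congr1 J (esym (derive_act_space Gg My TX)))).
  apply: (etrans _ (esym (mulI_mk _ _))).
  apply: (congr2 (@mkpoint R n)); first exact: scale_congr (matpart_mulI X).
  exact: scale_affine (matpart_mulI X) (vecpart_mulI X).
- move=> y X Y My TX TY; rewrite /pullback.
  apply: (etrans (omega_spaceE _ _ _)); apply: (etrans _ (esym (omega_spaceE _ _ _))).
  exact: (congr2 (fun u v => 'i%C * (u - v)) (act_space_h My TX TY) (act_space_h My TY TX)).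
Qed.

End Isometry.

Lemma space_group : group_on (@jacobiR_group R n) (@jacobiR_mul R n) (@jacobiR_one R n)
  (@jacobiR_inv R n).
Proof.
split.
- by move=> g h G H; exact: (symplectic_mul G H).
- by rewrite /jacobiR_group /= trmx1 mul1mx mulmx1.
- by move=> g G; exact: (symplectic_inv G).
- move=> g h x _ _ _; rewrite /jacobiR_mul /= !mulmxA; congr (_, _).
  by rewrite mulmxDl addrA.
- by move=> [g l] _; rewrite /jacobiR_mul /= mul1mx mul0mx add0r.
- move=> [g l] G; have u := symplectic_unit G; rewrite /jacobiR_mul /=.
  by rewrite (mulVmx u) mulNmx (mulmxKV u) addNr.
Qed.

Lemma blk_mul (g h : ('M[R]_(n + n) * 'rV[R]_(n + n))%type) :
  [/\ blk_a (jacobiR_mul g h) = blk_a g *m blk_a h + blk_b g *m blk_c h,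
      blk_b (jacobiR_mul g h) = blk_a g *m blk_b h + blk_b g *m blk_d h,
      blk_c (jacobiR_mul g h) = blk_c g *m blk_a h + blk_d g *m blk_c h &
      blk_d (jacobiR_mul g h) = blk_c g *m blk_b h + blk_d g *m blk_d h].
Proof.
have e : (jacobiR_mul g h).1 = block_mx
    (ulsubmx g.1 *m ulsubmx h.1 + ursubmx g.1 *m dlsubmx h.1)
    (ulsubmx g.1 *m ursubmx h.1 + ursubmx g.1 *m drsubmx h.1)
    (dlsubmx g.1 *m ulsubmx h.1 + drsubmx g.1 *m dlsubmx h.1)
    (dlsubmx g.1 *m ursubmx h.1 + drsubmx g.1 *m drsubmx h.1).
  by rewrite /= -{1}[g.1]submxK -{1}[h.1]submxK mulmx_block.
rewrite /blk_a /blk_b /blk_c /blk_d e block_mxKul block_mxKur block_mxKdl block_mxKdr.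
by rewrite !map_mxD !map_mxM.
Qed.

Lemma vec_mul (g h : ('M[R]_(n + n) * 'rV[R]_(n + n))%type) :
  vec_n (jacobiR_mul g h) = (blk_a h)^T *m vec_n g + (blk_c h)^T *m vec_m g + vec_n h /\
  vec_m (jacobiR_mul g h) = (blk_b h)^T *m vec_n g + (blk_d h)^T *m vec_m g + vec_m h.
Proof.
have e : (jacobiR_mul g h).2 = row_mx
    (lsubmx g.2 *m ulsubmx h.1 + rsubmx g.2 *m dlsubmx h.1 + lsubmx h.2)
    (lsubmx g.2 *m ursubmx h.1 + rsubmx g.2 *m drsubmx h.1 + rsubmx h.2).
  by rewrite /= -{1}[g.2]hsubmxK -{1}[h.1]submxK -{1}[h.2]hsubmxK mul_row_block add_row_mx.
rewrite /vec_n /vec_m e row_mxKl row_mxKr.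
by split; rewrite !linearD /= !trmx_mul !map_mxD !map_mxM /= -!map_trmx.
Qed.

Lemma act_space_one (y : E) : act_space (@jacobiR_one R n) y = y.
Proof.
have e : [/\ blk_a (@jacobiR_one R n) = 1%:M, blk_b (@jacobiR_one R n) = 0,
    blk_c (@jacobiR_one R n) = 0 & blk_d (@jacobiR_one R n) = 1%:M].
  rewrite /blk_a /blk_b /blk_c /blk_d /= (scalar_mx_block n n 1).
  by rewrite block_mxKul block_mxKur block_mxKdl block_mxKdr !map_mx1 !map_mx0.
have [e1 e2 e3 e4] := e.
have e5 : vec_n (@jacobiR_one R n) = 0 by rewrite /vec_n /= !linear0 map_mx0.
have e6 : vec_m (@jacobiR_one R n) = 0 by rewrite /vec_m /= !linear0 map_mx0.
apply: pt_eq.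
  apply: (etrans (matpart_mk _ _)).
  by rewrite e1 e2 e3 e4 mul0mx mul1mx addr0 add0r invmx1 mulmx1.
apply: (etrans (vecpart_mk _ _)).
by rewrite e3 e4 e5 e6 trmx0 trmx1 !mulmx0 add0r !addr0 invmx1 mul1mx.
Qed.

Lemma act_space_mul g h y : jacobiR_group g -> jacobiR_group h -> M y ->
  act_space (jacobiR_mul g h) y = act_space g (act_space h y).
Proof.
move=> G H My; have M1 := act_space_maps H My.
have u1 := space_act_unitT H My; have u2 := space_act_unit H My.
have v1 := space_act_unitT G M1; have v2 := space_act_unit G M1.
have [ea eb ec ed] := blk_mul g h; have [en em] := vec_mul g h.
have vE : (matpart y *m (blk_c h)^T + (blk_d h)^T) *m matpart (act_space h y) =
    matpart y *m (blk_a h)^T + (blk_b h)^T.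
  by rewrite (matpart_act_space H My) (mulKVmx u2).
apply: pt_eq.
  apply: (etrans (matpart_mk _ _)); apply: (etrans _ (esym (matpart_mk _ _))).
  rewrite ea eb ec ed; rewrite [matpart (act_space _ y)]matpart_mk in v1 *.
  exact: space_act_comp u1 v1.
apply: (etrans (vecpart_mk _ _)); apply: (etrans _ (esym (vecpart_mk _ _))).
rewrite ec ed en em [vecpart (act_space _ y)]vecpart_mk.
exact: space_act_comp_vec u2 v2 vE.
Qed.

Definition space_base : E := mkpoint ('i%C)%:M 0.

Lemma space_base_in : M space_base.
Proof.
apply/spaceP; split; first by rewrite /sym_tangent /= matpart_mk tr_scalar_mx.
rewrite matpart_mk conj_scalar conj_i.
have -> : 'i%C *: ((- 'i%C)%:M - ('i%C)%:M) = 1%:M + 1%:M :> 'M[C]_n.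
  rewrite -(scalemx1 n ('i%C)) -(scalemx1 n (- 'i%C)) scaleNr -opprD scalerN scalerDr scalerA.
  by rewrite mul_ii scaleN1r opprD opprK.
by apply/posdef_double; exact: posdef_one.
Qed.

Lemma space_transitive y : M y -> exists2 g, jacobiR_group g & act_space g space_base = y.
Proof.
move=> [ss sr pr].
have [L uL eL] := cholesky_real sr pr.
set s := y.1.1 in ss.
pose g : 'M[R]_(n + n) := block_mx L (s *m invmx L^T) 0 (invmx L^T).
(* At the base point (i, 0) the denominator is [L^-1], so the image has fibre coordinate
   [L (i n + m)]. Hence n and m are [L^-1] applied to the imaginary and real parts of u. *)
pose l : 'rV[R]_(n + n) := row_mx (invmx L *m y.2.2)^T (invmx L *m y.2.1)^T.
have G : jacobiR_group (g, l) by exact: symplectic_triangular uL ss.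
exists (g, l); first exact: G.
have ea : blk_a (g, l) = rmx L by rewrite /blk_a /= block_mxKul.
have eb : blk_b (g, l) = rmx (s *m invmx L^T) by rewrite /blk_b /= block_mxKur.
have ec : blk_c (g, l) = 0 by rewrite /blk_c /= block_mxKdl map_mx0.
have ed : blk_d (g, l) = rmx (invmx L^T) by rewrite /blk_d /= block_mxKdr.
have en : vec_n (g, l) = rmx (invmx L *m y.2.2) by rewrite /vec_n /= row_mxKl trmxK.
have em : vec_m (g, l) = rmx (invmx L *m y.2.1) by rewrite /vec_m /= row_mxKr trmxK.
have uLT : L^T \in unitmx by rewrite unitmx_tr.
apply: pt_eq.
  apply: (etrans (matpart_mk _ _)); rewrite matpart_mk ea eb ec ed.
  rewrite mul0mx add0r mul_mx_scalar -rmx_inv invmxK mulmxDl -scalemxAl -!rmx_mul -eL.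
  by rewrite (mulmxKV uLT) addrC [RHS]cplxmxE.
apply: (etrans (vecpart_mk _ _)); rewrite matpart_mk vecpart_mk ec ed en em.
rewrite trmx0 mulmx0 add0r add0r mul_scalar_mx -rmx_tr trmx_inv trmxK -rmx_inv invmxK.
rewrite mulmxDr -scalemxAr -!rmx_mul !(mulKVmx uL).
by rewrite addrC [RHS]cplxmxE.
Qed.

Lemma space_homogeneous : homogeneous_kahler T J M (omega_space k) (@jacobiR_group R n)
  (@jacobiR_mul R n) (@jacobiR_one R n) (@jacobiR_inv R n) (@act_space R n).
Proof.
apply: (homogeneous_from_base (space_domain R n) space_kahler space_group (o := space_base)).
- by move=> y _; exact: act_space_one.
- by move=> g h y; exact: act_space_mul.
- by move=> g G; exact: act_space_isometry.
- exact: space_base_in.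
- exact: space_transitive.
Qed.

End SpaceForm.

(** * The partial Cayley transform *)

Section Cayley.
Local Open Scope classical_set_scope.
Variables (R : realType) (n : nat).
Local Notation E := (coords R n).
Local Notation C := R[i].
Local Notation T := (@sym_tangent R n).
Local Notation J := (@mulI R n).
Local Notation X_n := (@siegel_jacobi_space R n).
Local Notation D_n := (@siegel_jacobi_ball R n).
Local Notation ii := ('i%C : C).
Local Notation S y := (invmx (matpart y + ii%:M)).
Local Notation Phi := (@partial_cayley R n).
Variable k : R.

Let ii2 : ii * ii = -1 := mul_ii R.
Let cii : Num.conj ii = - ii := conj_i R.

Lemma cayley_denom_unit y : X_n y -> matpart y + ii%:M \in unitmx.
Proof. by move=> My; exact (cayley_unit ii2 cii (space_sym My) (space_pos My)). Qed.

Lemma matpart_cayley y : X_n y -> matpart (Phi y) = 1%:M - (2 * ii) *: S y.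
Proof. by move=> My; rewrite [LHS]matpart_mk; exact: cayley_W (cayley_denom_unit My). Qed.

Lemma vecpart_cayley y : vecpart (Phi y) = (2 * ii) *: (S y *m vecpart y).
Proof. exact: vecpart_mk. Qed.

Lemma cayley_maps y : X_n y -> D_n (Phi y).
Proof.
move=> My; have [h1 h2] := cayley_ball ii2 cii (space_sym My) (space_pos My).
by split; rewrite (matpart_cayley My).
Qed.

Let TX : charted T X_n := charted_domain (space_domain R n).
Let TD : charted T D_n := charted_domain (ball_domain R n).
Let sv : msmooth T X_n (@matpart R n) := proj1 (matpart_charted TX).
Let su : msmooth T X_n (@vecpart R n) := proj1 (vecpart_charted TX).
Let cst m l (A : 'M[C]_(m, l)) : msmooth T X_n (fun=> A) := msmooth_cst TX A.
Let s1 := msmoothB TX sv (cst ii%:M).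
Let s2 := msmoothD TX sv (cst ii%:M).
Let s3 := msmoothM TX s1 (msmoothV TX cayley_denom_unit s2).
Let s4 := msmoothM TX (msmoothV TX cayley_denom_unit s2) su.

Lemma cayley_smooth : smooth_on T X_n Phi.
Proof. exact: (smooth_mkpoint TX s3 (msmoothZ TX (2 * ii) s4)). Qed.

Lemma derive_cayley y X : X_n y -> T X ->
  'D_X Phi y = mkpoint ((2 * ii) *: (S y *m matpart X *m S y))
    ((2 * ii) *: (S y *m (vecpart X - matpart X *m (S y *m vecpart y)))).
Proof.
move=> My HX; have dv := proj2 (matpart_charted TX) _ _ My HX.
have du := proj2 (vecpart_charted TX) _ _ My HX.
apply: (etrans (derive_mkpoint TX s3 (msmoothZ TX (2 * ii) s4) My HX)).
apply: (congr2 (@mkpoint R n)).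
  apply: (etrans (mderive_fracr TX My HX cayley_denom_unit s1 s2)).
  rewrite (mderiveB TX My HX sv (cst ii%:M)) (mderiveD TX My HX sv (cst ii%:M)).
  rewrite !mderive_cst dv subr0 addr0.
  exact: cayley_derive_W (cayley_denom_unit My).
apply: (etrans (mderiveZ TX My HX (2 * ii) s4)).
rewrite (mderive_fracl TX My HX cayley_denom_unit su s2).
by rewrite (mderiveD TX My HX sv (cst ii%:M)) mderive_cst dv du addr0.
Qed.

Lemma cayley_ball_eta y : X_n y -> ball_eta (Phi y) = space_w y + ii *: space_q y.
Proof.
move=> My; apply/(ball_etaP _ (cayley_maps My)).
rewrite (matpart_cayley My) vecpart_cayley.
exact (cayley_eta ii2 cii (mulVmx (cayley_denom_unit My)) (space_q_conj My)
  (space_w_conj My) (space_qw y)).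
Qed.

Lemma cayley_ball_A y X : X_n y -> T X ->
  ball_A (Phi y) ('D_X Phi y) = (2 * ii) *: (S y *m space_G y X).
Proof.
move=> My HX; rewrite (derive_cayley My HX) /ball_A matpart_mk vecpart_mk.
rewrite (cayley_ball_eta My) space_GE.
exact (cayley_derive_A cii _ _ (cayley_denom_unit My) (space_q_conj My)
  (space_w_conj My) (space_qw y)).
Qed.

Lemma cayley_ball_M y : X_n y ->
  ball_M (Phi y) = (- ii / 2) *: (invmx (S y)^adj *m space_D y *m invmx (S y)).
Proof.
move=> My; have uS : S y \in unitmx by rewrite unitmx_inv; exact: cayley_denom_unit.
rewrite /ball_M (matpart_cayley My) (cayley_defect ii2 cii (cayley_denom_unit My) (space_sym My)).
exact (cayley_M ii2 uS (space_Q_unit My)).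
Qed.

Lemma cayley_ball_B y X : X_n y -> T X ->
  ball_B (Phi y) ('D_X Phi y) = ball_M (Phi y) *m ((2 * ii) *: (S y *m matpart X *m S y)).
Proof. by move=> My HX; rewrite (derive_cayley My HX) /ball_B matpart_mk. Qed.

Lemma cayley_h y X Y : X_n y -> T X -> T Y ->
  ball_h k (Phi y) ('D_X Phi y) ('D_Y Phi y) = space_h k y X Y.
Proof.
move=> My HX HY; have uS : S y \in unitmx by rewrite unitmx_inv; exact: cayley_denom_unit.
have sS : (S y)^T = S y by rewrite tr_inv tr_add tr_scalar_mx (space_sym My).
exact: (cayley_form_transport ii2 cii _ uS sS (space_D_conj My) (cayley_ball_M My)
  (cayley_ball_B My HX) (cayley_ball_B My HY) (cayley_ball_A My HX) (cayley_ball_A My HY)).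
Qed.

(** Obtained by solving [W = 1 - 2i (v + i)^-1] for v; then [z = 2i (v + i)^-1 u = (1 - W) u] gives
    u. *)
Definition cayley_inverse (x : E) : E :=
  mkpoint ((2 * ii) *: invmx (1%:M - matpart x) - ii%:M)
          (invmx (1%:M - matpart x) *m vecpart x).

Lemma one_sub_W_unit x : D_n x -> 1%:M - matpart x \in unitmx.
Proof. by case=> sW pW; exact: one_sub_unit. Qed.

Lemma cayley_inverse_maps x : D_n x -> X_n (cayley_inverse x).
Proof.
case=> sW pW; have [h1 h2] := cayley_inv_space ii2 cii sW pW.
by apply/spaceP; rewrite /sym_tangent /= matpart_mk.
Qed.

Lemma cayley_inverse_smooth : smooth_on T D_n cayley_inverse.
Proof.
have sW := proj1 (matpart_charted TD); have sz := proj1 (vecpart_charted TD).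
have sT := msmoothV TD one_sub_W_unit (msmoothB TD (msmooth_cst TD 1%:M) sW).
exact: (smooth_mkpoint TD (msmoothB TD (msmoothZ TD (2 * ii) sT) (msmooth_cst TD ii%:M))
  (msmoothM TD sT sz)).
Qed.

Lemma cayley_diffeomorphism :
  kahler_diffeomorphism T X_n (omega_space k) T D_n (omega_ball k) Phi.
Proof.
split.
  exists cayley_inverse; split.
  - move=> y My; split; first exact: cayley_maps.
    have [e1 e2] := cayleyK_v ii2 (vecpart y) (cayley_denom_unit My).
    apply: pt_eq.
      apply: (etrans (matpart_mk _ _)); rewrite [matpart (Phi y)]matpart_mk.
      exact: e1.
    apply: (etrans (vecpart_mk _ _)); rewrite [matpart (Phi y)]matpart_mk vecpart_cayley.
    exact: e2.
  - move=> x Mx; split; first exact: cayley_inverse_maps.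
    have [e1 e2] := cayleyK_W ii2 (vecpart x) (one_sub_W_unit Mx).
    apply: pt_eq.
      apply: (etrans (matpart_mk _ _)); rewrite matpart_mk.
      exact: e1.
    apply: (etrans (vecpart_mk _ _)); rewrite matpart_mk vecpart_mk.
    exact: e2.
  - exact: cayley_smooth.
  - exact: cayley_inverse_smooth.
move=> y X Y My HX HY; rewrite /pullback.
apply: (etrans (omega_ballE _ _ _ _)); apply: (etrans _ (esym (omega_spaceE _ _ _ _))).
exact: (congr2 (fun u v => 'i%C * (u - v)) (cayley_h My HX HY) (cayley_h My HY HX)).
Qed.

End Cayley.

Theorem proposition3 (R : realType) (n : nat) (hn : (0 < n)%N)
    (k : R) (hk : 0 < k) :
  [/\ ball_inverses_defined R n /\ space_inverses_defined R n,
      homogeneous_kahler (@sym_tangent R n) (@mulI R n)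
        (@siegel_jacobi_ball R n) (@omega_ball R n k)
        (@jacobiC_group R n) (@jacobiC_mul R n) (@jacobiC_one R n)
        (@jacobiC_inv R n) (@act_ball R n),
      homogeneous_kahler (@sym_tangent R n) (@mulI R n)
        (@siegel_jacobi_space R n) (@omega_space R n k)
        (@jacobiR_group R n) (@jacobiR_mul R n) (@jacobiR_one R n)
        (@jacobiR_inv R n) (@act_space R n),
      (forall g y, @jacobiR_group R n g -> @siegel_jacobi_space R n y ->
         let v := matpart y in
         (blk_a g *m v + blk_b g) *m invmx (blk_c g *m v + blk_d g) =
         invmx (v *m (blk_c g)^T + (blk_d g)^T)
           *m (v *m (blk_a g)^T + (blk_b g)^T)) &
      kahler_diffeomorphism
        (@sym_tangent R n) (@siegel_jacobi_space R n) (@omega_space R n k)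
        (@sym_tangent R n) (@siegel_jacobi_ball R n) (@omega_ball R n k)
        (@partial_cayley R n)].
Proof.
split.
- split.
    move=> x Mx; split; first exact: ball_M_unit.
    by move=> p q a G; split; [exact: ball_act_unitT G _ Mx | exact: ball_act_unit G _ Mx].
  move=> y My; split; [exact: cayley_denom_unit | exact: space_Q_unit |].
  by move=> g G; split; [exact: space_act_unitT | exact: space_act_unit].
- exact: ball_homogeneous.
- exact: space_homogeneous.
- by move=> g y G My; exact (space_act_two_forms G My).
- exact: cayley_diffeomorphism.
Qed.
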